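(* Let $L=L(\kappa,\tau,\kappa_s,\tau_s,\kappa_{ss},\tau_{ss},\dots)$ be a smooth function of finitely many arguments, and consider the one-dimensional $SE(3)$-invariant variational problem $\int L(\kappa,\tau,\kappa_s,\tau_s,\kappa_{ss},\tau_{ss},\dots)\,\mathrm{d}s$ for space curves, where $s$ is Euclidean arc length, $\kappa$ the Euclidean curvature and $\tau$ the torsion. With the arc-length constraint imposed through a Lagrange multiplier $\lambda(s)$, i.e. for the functional $\int[L-\lambda(s)(\eta-1)]\,\mathrm{d}s$ with $\eta=\sqrt{x_s^2+y_s^2+z_s^2}$, the invariantized Euler--Lagrange equations are $\mathsf{E}^x(L)=0$, $\mathsf{E}^y(L)=0$, $\mathsf{E}^z(L)=0$, where $$\mathsf{E}^x(L)=\kappa_s\mathsf{E}^\kappa(L)+\tau_s\mathsf{E}^\tau(L)-\mathcal{D}_s(2\tau\mathsf{E}^\tau(L))+\lambda_s,$$ $$\mathsf{E}^y(L)=\mathcal{D}_s^2\mathsf{E}^\kappa(L)+\frac{2\tau}{\kappa}\mathcal{D}_s^2\mathsf{E}^\tau(L)+\left(\frac{\tau_s}{\kappa}-\frac{2\tau\kappa_s}{\kappa^2}\right)\mathcal{D}_s\mathsf{E}^\tau(L)+(\kappa^2-\tau^2)\mathsf{E}^\kappa(L)+2\tau\kappa\mathsf{E}^\tau(L)+\lambda(s)\kappa,$$ $$\mathsf{E}^z(L)=-\frac1\kappa\mathcal{D}_s^3\mathsf{E}^\tau(L)+\frac{2\kappa_s}{\kappa^2}\mathcal{D}_s^2\mathsf{E}^\tau(L)+\left(\frac{\kappa_{ss}}{\kappa^2}+\frac{\tau^2}{\kappa}-\frac{2\kappa_s^2}{\kappa^3}-\kappa\right)\mathcal{D}_s\mathsf{E}^\tau(L)-\kappa_s\mathsf{E}^\tau(L)+2\tau\mathcal{D}_s\mathsf{E}^\kappa(L)+\tau_s\mathsf{E}^\kappa(L).$$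 The equation $\mathsf{E}^x(L)=0$ eliminates the multiplier (the constant of integration being absorbed into $\lambda$): $$\lambda(s)=2\tau\mathsf{E}^\tau(L)-L+\sum_{m\ge1}\sum_{i=0}^{m-1}(-1)^i\mathcal{D}_s^i\left(\frac{\partial L}{\partial\kappa_m}\right)\kappa_{m-i}+\sum_{m\ge1}\sum_{i=0}^{m-1}(-1)^i\mathcal{D}_s^i\left(\frac{\partial L}{\partial\tau_m}\right)\tau_{m-i},$$ leaving two Euler--Lagrange equations $\mathsf{E}^y(L)=0$, $\mathsf{E}^z(L)=0$ in the two unknowns $\kappa,\tau$. With this $\lambda(s)$, along every extremal curve $\mathbf{x}(s)=(x(s),y(s),z(s))^T$ the associated Noether conservation laws are $$\begin{pmatrix}\rho_{FS}&\mathbf{0}\\ DX\rho_{FS}&D\rho_{FS}D\end{pmatrix}\boldsymbol{\upsilon}(I)=\begin{pmatrix}\mathbf{c}_1\\ \mathbf{c}_2\end{pmatrix},$$ where $\mathbf{c}_1=(c_1,c_2,c_3)^T$ and $\mathbf{c}_2=(c_4,c_5,c_6)^T$ are constant vectors and $$\boldsymbol{\upsilon}(I)=\begin{pmatrix}\tau\mathsf{E}^\tau(L)-\kappa\mathsf{E}^\kappa(L)-\lambda(s)\\ -\mathcal{D}_s\mathsf{E}^\kappa(L)-\frac{\tau}{\kappa}\mathcal{D}_s\mathsf{E}^\tau(L)\\ \frac1\kappa\mathcal{D}_s^2\mathsf{E}^\tau(L)-\frac{\kappa_s}{\kappa^2}\mathcal{D}_s\mathsf{E}^\tau(L)+\kappa\mathsf{E}^\tau(L)-\tau\mathsf{E}^\kappa(L)\\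 \mathsf{E}^\tau(L)\\ -\frac1\kappa\mathcal{D}_s\mathsf{E}^\tau(L)\\ \mathsf{E}^\kappa(L)\end{pmatrix}.$$
   Context: Curves are space curves $\mathbf{x}(s)=(x(s),y(s),z(s))^T$ parametrized by Euclidean arc length, $|\mathbf{x}_s|=1$; subscripts $s$ denote derivatives in $s$, and $\mathcal{D}_s=\mathrm{d}/\mathrm{d}s$. Curvature and torsion are $$\kappa=\frac{\|\mathbf{x}_s\times\mathbf{x}_{ss}\|}{\|\mathbf{x}_s\|^3},\qquad \tau=\frac{\mathbf{x}_{sss}\cdot(\mathbf{x}_s\times\mathbf{x}_{ss})}{\|\mathbf{x}_s\times\mathbf{x}_{ss}\|^2},$$ with $\kappa_m=\partial^m\kappa/\partial s^m$, $\tau_m=\partial^m\tau/\partial s^m$. The Euler operators are $\mathsf{E}^\kappa(L)=\sum_{m\ge0}(-1)^m\mathcal{D}_s^m(\partial L/\partial\kappa_m)$ and $\mathsf{E}^\tau(L)=\sum_{m\ge0}(-1)^m\mathcal{D}_s^m(\partial L/\partial\tau_m)$. All expressions in $L$ are evaluated along the curve. $\rho_{FS}=\left(\mathbf{x}_s\;\;\tfrac{\mathbf{x}_{ss}}{\kappa}\;\;\tfrac{\mathbf{x}_s\times\mathbf{x}_{ss}}{\kappa}\right)$ is the $3\times3$ Frenet--Serret frame (columns as listed), $D=\mathrm{diag}(1,-1,1)$, and $$X=\begin{pmatrix}0&-z&y\\ z&0&-x\\ -y&x&0\end{pmatrix}.$$ The group $SE(3)$ acts on space by rotations and translations. An extremal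 curve is a curve that extremizes the functional $\int L\,\mathrm{d}s$.
   Formalization: With a single λ the statement is false when τE^τ(L)≠0 (helix, L=τ²/2+7τ₀²/2): in the functional and in E^y, λ is replaced by λ−2τE^τ(L), while E^x, the formula for λ (plus an explicit constant c) and υ(I) keep λ. *)

(* Defs.v *)
From HB Require Import structures.
From mathcomp Require Import all_boot all_order all_algebra.
From mathcomp Require Import all_classical all_reals all_analysis.
Set Implicit Arguments.
Unset Strict Implicit.
Unset Printing Implicit Defensive.
Import Order.TTheory GRing.Theory Num.Theory numFieldNormedType.Exports.
Local Open Scope ring_scope.
Local Open Scope classical_set_scope.

(* Ds k f is the k-th derivative of a function of one real variable. *)
Notation Ds := derive1n.

Definition vec3 (R : realType) (a b c : R) : 'cV[R]_3 :=
  \col_(i < 3) [:: a; b; c]`_i.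

Definition dot (R : realType) (u v : 'cV[R]_3) : R :=
  \sum_(i < 3) u i 0 * v i 0.

(* The canonical norm `|u| on matrices is the sup norm. *)
Definition enorm (R : realType) (u : 'cV[R]_3) : R := Num.sqrt (dot u u).

Definition cx (R : realType) (u : 'cV[R]_3) : R := u (inord 0) 0.
Definition cy (R : realType) (u : 'cV[R]_3) : R := u (inord 1) 0.
Definition cz (R : realType) (u : 'cV[R]_3) : R := u (inord 2) 0.

Definition cross (R : realType) (u v : 'cV[R]_3) : 'cV[R]_3 :=
  vec3 (cy u * cz v - cz u * cy v)
       (cz u * cx v - cx u * cz v)
       (cx u * cy v - cy u * cx v).

(* C^oo on an open set I of the line; the values outside I are irrelevant. *)
Definition smooth_on (R : realType) (V : normedModType R) (I : set R)
    (f : R -> V) : Prop :=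
  forall (k : nat) (s : R), I s -> derivable (Ds k f) s 1.

(* A Lagrangian takes the matrix whose row 0 is (kappa_0, ..., kappa_n) and
   whose row 1 is (tau_0, ..., tau_n).  It may ignore some of its arguments, so
   the common order n is no restriction. *)
Definition partial (R : realType) (n : nat) (j : 'I_2) (m : 'I_n.+1)
    (L : 'M[R]_(2, n.+1) -> R) : 'M[R]_(2, n.+1) -> R :=
  fun p => 'D_(delta_mx j m) L p.

(* C^oo on an open set U of arguments: every iterated partial derivative is
   differentiable on U. *)
Definition smooth_lagrangian (R : realType) (n : nat)
    (U : set 'M[R]_(2, n.+1)) (L : 'M[R]_(2, n.+1) -> R) : Prop :=
  forall (l : seq ('I_2 * 'I_n.+1)) (p : 'M[R]_(2, n.+1)), U p ->
    differentiable (foldr (fun jm F => partial jm.1 jm.2 F) L l) p.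

Definition eta (R : realType) (x : R -> 'cV[R]_3) (s : R) : R :=
  enorm (Ds 1 x s).

Definition kappa (R : realType) (x : R -> 'cV[R]_3) (s : R) : R :=
  enorm (cross (Ds 1 x s) (Ds 2 x s)) / enorm (Ds 1 x s) ^+ 3.

Definition tau (R : realType) (x : R -> 'cV[R]_3) (s : R) : R :=
  dot (Ds 3 x s) (cross (Ds 1 x s) (Ds 2 x s))
  / enorm (cross (Ds 1 x s) (Ds 2 x s)) ^+ 2.

(* A smooth curve parametrized by arc length on I, with nonvanishing curvature
   (without which tau and the Frenet-Serret frame are undefined). *)
Definition arclength_curve (R : realType) (I : set R) (x : R -> 'cV[R]_3)
    : Prop :=
  [/\ smooth_on I x,
      forall s, I s -> eta x s = 1 &
      forall s, I s -> kappa x s != 0].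

Definition invariant_fun (R : realType) (j : 'I_2) (x : R -> 'cV[R]_3)
    : R -> R :=
  if j == 0 then kappa x else tau x.

Definition jet (R : realType) (n : nat) (x : R -> 'cV[R]_3) (s : R)
    : 'M[R]_(2, n.+1) :=
  \matrix_(j < 2, m < n.+1) Ds m (invariant_fun j x) s.

(* dL/dkappa_m (j = 0) and dL/dtau_m (j = 1) along the curve. *)
Definition dL (R : realType) (n : nat) (L : 'M[R]_(2, n.+1) -> R)
    (x : R -> 'cV[R]_3) (j : 'I_2) (m : 'I_n.+1) (s : R) : R :=
  partial j m L (jet n x s).

Definition Euler (R : realType) (n : nat) (j : 'I_2)
    (L : 'M[R]_(2, n.+1) -> R) (x : R -> 'cV[R]_3) (s : R) : R :=
  \sum_(m < n.+1) (-1) ^+ m * Ds m (dL L x j m) s.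

Definition Ekappa (R : realType) (n : nat) (L : 'M[R]_(2, n.+1) -> R)
    (x : R -> 'cV[R]_3) : R -> R := Euler 0 L x.

Definition Etau (R : realType) (n : nat) (L : 'M[R]_(2, n.+1) -> R)
    (x : R -> 'cV[R]_3) : R -> R := Euler 1 L x.

(* For a curve that is not of unit speed, s is just its parameter, and kappa_m,
   tau_m are the derivatives with respect to that parameter. *)
Definition action (R : realType) (n : nat) (L : 'M[R]_(2, n.+1) -> R)
    (mu : R -> R) (a b : R) (x : R -> 'cV[R]_3) : R :=
  \int[lebesgue_measure]_(s in `[a, b])
     (L (jet n x s) - mu s * (eta x s - 1)).

(* Smooth variations supported in a compact interval [a, b] inside I; by
   smoothness all their derivatives vanish at a and b. *)
Definition variation (R : realType) (I : set R) (a b : R)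
    (v : R -> 'cV[R]_3) : Prop :=
  [/\ a < b, `[a, b] `<=` I, smooth_on setT v &
      forall s, s \notin `[a, b] -> v s = 0].

(* G is the Euler-Lagrange expression (variational derivative with respect to
   the coordinates of the curve) of the constrained functional at x. *)
Definition Euler_Lagrange_expression (R : realType) (n : nat)
    (L : 'M[R]_(2, n.+1) -> R) (mu : R -> R) (I : set R)
    (x : R -> 'cV[R]_3) (G : R -> 'cV[R]_3) : Prop :=
  forall (a b : R) (v : R -> 'cV[R]_3), variation I a b v ->
    is_derive (0 : R) (1 : R)
      (fun e : R => action L mu a b (fun s => x s + e *: v s))
      (\int[lebesgue_measure]_(s in `[a, b]) dot (v s) (G s)).

Definition extremal_with (R : realType) (n : nat)
    (L : 'M[R]_(2, n.+1) -> R) (mu : R -> R) (I : set R)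
    (x : R -> 'cV[R]_3) : Prop :=
  forall (a b : R) (v : R -> 'cV[R]_3), variation I a b v ->
    is_derive (0 : R) (1 : R)
      (fun e : R => action L mu a b (fun s => x s + e *: v s)) 0.

Definition extremal_curve (R : realType) (n : nat)
    (L : 'M[R]_(2, n.+1) -> R) (I : set R) (x : R -> 'cV[R]_3) : Prop :=
  exists2 mu : R -> R, smooth_on I mu & extremal_with L mu I x.

Definition Ex (R : realType) (n : nat) (L : 'M[R]_(2, n.+1) -> R)
    (lam : R -> R) (x : R -> 'cV[R]_3) (s : R) : R :=
  Ds 1 (kappa x) s * Ekappa L x s + Ds 1 (tau x) s * Etau L x s
  - Ds 1 (fun t => 2 * tau x t * Etau L x t) s + Ds 1 lam s.

Definition Ey (R : realType) (n : nat) (L : 'M[R]_(2, n.+1) -> R)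
    (lam : R -> R) (x : R -> 'cV[R]_3) (s : R) : R :=
  let k := kappa x s in let k1 := Ds 1 (kappa x) s in
  let t := tau x s in let t1 := Ds 1 (tau x) s in
  let Ek := Ekappa L x in let Et := Etau L x in
  Ds 2 Ek s + 2 * t / k * Ds 2 Et s
  + (t1 / k - 2 * t * k1 / k ^+ 2) * Ds 1 Et s
  + (k ^+ 2 - t ^+ 2) * Ek s + 2 * t * k * Et s + lam s * k.

Definition Ez (R : realType) (n : nat) (L : 'M[R]_(2, n.+1) -> R)
    (x : R -> 'cV[R]_3) (s : R) : R :=
  let k := kappa x s in let k1 := Ds 1 (kappa x) s in
  let k2 := Ds 2 (kappa x) s in
  let t := tau x s in let t1 := Ds 1 (tau x) s in
  let Ek := Ekappa L x in let Et := Etau L x in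
  - (1 / k) * Ds 3 Et s + 2 * k1 / k ^+ 2 * Ds 2 Et s
  + (k2 / k ^+ 2 + t ^+ 2 / k - 2 * k1 ^+ 2 / k ^+ 3 - k) * Ds 1 Et s
  - k1 * Et s + 2 * t * Ds 1 Ek s + t1 * Ek s.

(* kappa and tau are invariant under reparametrization, so a tangential field
   f T changes them by f kappa_s and f tau_s, and the tangential component of
   the Euler-Lagrange expression of int [L - mu (eta - 1)] ds is
     kappa_s E^kappa(L) + tau_s E^tau(L) + mu_s,
   whereas its normal component is Ey with multiplier mu.  Hence the multiplier
   lam occurring in Ex, lambda_sol and upsilon is mu + 2 tau E^tau(L). *)
Definition constraint_multiplier (R : realType) (n : nat)
    (L : 'M[R]_(2, n.+1) -> R) (x : R -> 'cV[R]_3) (lam : R -> R) : R -> R :=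
  fun s => lam s - 2 * tau x s * Etau L x s.

Definition lambda_sol (R : realType) (n : nat) (L : 'M[R]_(2, n.+1) -> R)
    (x : R -> 'cV[R]_3) (s : R) : R :=
  2 * tau x s * Etau L x s - L (jet n x s)
  + \sum_(m < n.+1 | (1 <= m)%N) \sum_(0 <= i < m)
      (-1) ^+ i * Ds i (dL L x 0 m) s * Ds (m - i)%N (kappa x) s
  + \sum_(m < n.+1 | (1 <= m)%N) \sum_(0 <= i < m)
      (-1) ^+ i * Ds i (dL L x 1 m) s * Ds (m - i)%N (tau x) s.

Definition rhoFS (R : realType) (x : R -> 'cV[R]_3) (s : R) : 'M[R]_3 :=
  \matrix_(i < 3, j < 3)
    ([:: Ds 1 x s;
         (kappa x s)^-1 *: Ds 2 x s;
         (kappa x s)^-1 *: cross (Ds 1 x s) (Ds 2 x s)]`_j : 'cV[R]_3) i 0.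

Definition Dmx (R : realType) : 'M[R]_3 :=
  diag_mx (\row_(j < 3) [:: 1; -1; 1]`_j).

Definition Xmx (R : realType) (u : 'cV[R]_3) : 'M[R]_3 :=
  \matrix_(i < 3, j < 3)
    (nth [::] [:: [:: 0;      - cz u; cy u];
                  [:: cz u;   0;      - cx u];
                  [:: - cy u; cx u;   0]] i)`_j.

Definition upsilon (R : realType) (n : nat) (L : 'M[R]_(2, n.+1) -> R)
    (lam : R -> R) (x : R -> 'cV[R]_3) (s : R) : 'cV[R]_(3 + 3) :=
  let k := kappa x s in let k1 := Ds 1 (kappa x) s in
  let t := tau x s in
  let Ek := Ekappa L x in let Et := Etau L x in
  col_mx
    (vec3 (t * Et s - k * Ek s - lam s)
          (- Ds 1 Ek s - t / k * Ds 1 Et s)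
          (1 / k * Ds 2 Et s - k1 / k ^+ 2 * Ds 1 Et s + k * Et s - t * Ek s))
    (vec3 (Et s)
          (- (1 / k) * Ds 1 Et s)
          (Ek s)).

Definition Noether_matrix (R : realType) (x : R -> 'cV[R]_3) (s : R)
    : 'M[R]_(3 + 3, 3 + 3) :=
  let rho := rhoFS x s in
  block_mx rho 0
           (Dmx R *m Xmx (x s) *m rho) (Dmx R *m rho *m Dmx R).

(* Main.v *)
Require Import Defs.
From HB Require Import structures.
From mathcomp Require Import all_boot all_order all_algebra.
From mathcomp Require Import ring lra.
From mathcomp Require Import all_classical all_reals all_analysis.
Set Implicit Arguments.
Unset Strict Implicit.
Unset Printing Implicit Defensive.
Import Order.TTheory GRing.Theory Num.Theory numFieldNormedType.Exports.
Local Open Scope ring_scope.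
Local Open Scope classical_set_scope.

(** Along [x + e v] everything is expanded to first order in [e], in
    Caratheodory's form [g e s = g 0 s + e q (e, s)] with [q] continuous at
    [e = 0], and the same is required of the derivatives in [s].  This is
    stable under ring operations, inverses, square roots and composition with a
    smooth Lagrangian, hence applies to kappa, tau, eta and [L], and it suffices
    to differentiate the action under the integral sign.

    In the Frenet frame [(T, N, B)], integrating by parts turns the first
    variation into [- int v . W'], where the components of [W] in the frame are
    the first three entries of upsilon.  So [- W'] is the Euler-Lagrange
    expression, and [W] is constant along an extremal: this is the conservation
    law of translations.  Moreover
    [x * W + E^tau T + (E^tau)' / kappa N + E^kappa B], with [*] the cross
    product, then has derivative zero: this is the law of rotations.  The
    tangential equation integrates to the formula for the multiplier because
    the sums in [lambda_sol] telescope. *)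

(** The deformed curve keeps nonzero speed and curvature, and its jet stays in [U], only for [e]
    small depending on [s]. Hence the expansions are stated near each [(0, s)], and uniformity in
    [s] is recovered from compactness of [[a, b]] when integrating. Families constant in [e], and
    the zero variation, make the same calculus deliver all smoothness in [s]: of kappa, tau and the
    Euler operators. A variation is only known to vanish off [[a, b]]. The boundary terms of the
    integrations by parts are therefore killed at the endpoints by continuity from outside, which is
    possible because [[a, b]] lies in the open set [I]. Two conventions of the statement leave
    traces. The frame computation is done with the multiplier [mu] of [eta - 1]; passing to
    [lam = mu + 2 tau E^tau] only rewrites the tangential entry of W. The matrix D in the lower row
    absorbs the minus sign of the fifth entry of upsilon, whose counterpart in the conserved moment
    has a plus sign. *)

Lemma near_derive1_eq (R : realType) (f g : R -> R) (s : R) :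
  (\forall t \near s, f t = g t) -> f^`() s = g^`() s.
Proof. by move=> fg; rewrite !derive1E; exact: near_eq_derive. Qed.

Lemma derivable_is_derive (R : realType) (f : R -> R) s :
  derivable f s 1 -> is_derive s 1 f (f^`() s).
Proof. by move=> df; rewrite derive1E; exact: derivableP. Qed.

Lemma is_derive_derive1 (R : realType) (f : R -> R) (s d : R) :
  is_derive s 1 f d -> f^`() s = d.
Proof. by case=> _ <-; rewrite derive1E. Qed.

Lemma is_derive_continuous (R : realType) (f : R -> R) (s d : R) :
  is_derive s 1 f d -> {for s, continuous f}.
Proof. by case=> /derivable1_diffP/differentiable_continuous. Qed.

Section Derive1.
Variables (R : realType) (f g : R -> R) (s : R).
Hypotheses (df : derivable f s 1) (dg : derivable g s 1).

Lemma derive1D : derive1 (fun t => f t + g t) s = derive1 f s + derive1 g s.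
Proof. by rewrite !derive1E; exact: deriveD. Qed.

Lemma derive1N : derive1 (fun t => - f t) s = - derive1 f s.
Proof. by rewrite !derive1E; exact: deriveN. Qed.

Lemma derive1M :
  derive1 (fun t => f t * g t) s = derive1 f s * g s + f s * derive1 g s.
Proof.
rewrite !derive1E; apply: (etrans (deriveM df dg)).
by rewrite addrC mulrC.
Qed.

End Derive1.

(** * First-order expansions *)

Section Expansions.
Variables (R : realType) (I : set R).
Hypothesis openI : open I.

(** At [e = 0] the expansion does not constrain [q] at all; the last clause ties [q] to [g1] on a
    whole neighbourhood of [s] and thereby makes [g1] continuous at [s]. *)
Definition expandable (g : R -> R -> R) (g1 : R -> R) (s : R) : Prop :=
  exists q : R * R -> R,
  [/\ {for s, continuous (g 0)}, {for (0, s), continuous q},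
      \forall p \near (0, s), g p.1 p.2 = g 0 p.2 + p.1 * q p &
      \forall t \near s, q (0, t) = g1 t].

(* [g1] is the derivative of [g] in the parameter at [0], in the sense of C^m on
   [I], and [g1^(k)] that of [g^(k)]: the exchange of the two derivatives is built in. *)
Fixpoint expands (m : nat) (g : R -> R -> R) (g1 : R -> R) : Prop :=
  (forall s, I s -> expandable g g1 s) /\
  if m is m'.+1 then
   [/\ forall s, I s -> \forall p \near (0 : R, s), derivable (g p.1) p.2 1,
       forall s, I s -> derivable g1 s 1 &
       expands m' (fun e => (g e)^`()) (g1^`())]
  else True.

Lemma cvg_line (a b : R) : (fun t : R => (a, t)) @ b --> (a, b).
Proof.
exact: (@cvg_pair _ _ _ _ (nbhs a) (nbhs b) _ _ _ (cst a) id (cvg_cst a) cvg_id).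
Qed.

Lemma near_nbhs_snd (P : R * R -> Prop) (p : R * R) :
  (\forall q \near p, P q) -> \forall t \near p.2, P (p.1, t).
Proof.
by case: p => a b Pp; exact: (cvg_line Pp).
Qed.

(** A neighbourhood is a neighbourhood of its nearby points. This lets an equality valid near
    [(0, s)] be differentiated in the second variable alone, with the first one frozen at a value
    other than 0. *)
Lemma near_slice (P : R * R -> Prop) (p : R * R) :
  (\forall q \near p, P q) ->
  \forall q \near p, \forall t \near q.2, P (q.1, t).
Proof.
move=> /near_join Pp; near=> q; apply: (@near_nbhs_snd P); near: q; exact: Pp.
Unshelve. all: by end_near. Qed.

Lemma near_line (P : R * R -> Prop) (s : R) :
  (\forall q \near (0 : R, s), P q) -> \forall t \near s, P (0, t).
Proof. exact: near_nbhs_snd. Qed.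

Lemma near_snd (P : R -> Prop) (s : R) :
  (\forall t \near s, P t) -> \forall q \near (0 : R, s), P q.2.
Proof. by move=> Ps; have : snd @ (0 : R, s) --> s by [exact: cvg_snd]; exact. Qed.

Lemma near_open s : I s -> \forall t \near s, I t.
Proof. by move=> Is; exact: open_nbhs_nbhs. Qed.

Lemma expandable_continuous0 g g1 s : expandable g g1 s -> {for s, continuous (g 0)}.
Proof. by case=> q []. Qed.

Lemma continuous_at_snd (T : topologicalType) (f : R -> T) s : {for s, continuous f} ->
  {for (0 : R, s), continuous (fun p : R * R => f p.2)}.
Proof. exact: (cvg_comp (fun p : R * R => p.2) f cvg_snd). Qed.

Lemma continuous_at_line (q : R * R -> R) s : {for (0, s), continuous q} ->
  {for s, continuous (fun t => q (0, t))}.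
Proof.
move=> qs; apply: (@continuous_comp _ _ _ (fun t : R => (0 : R, t)) q) => //.
exact: cvg_line.
Qed.

Lemma continuous_near_eq (T U : topologicalType) (f f' : T -> U) (x : T) :
  {for x, continuous f} -> (\forall t \near x, f t = f' t) ->
  {for x, continuous f'}.
Proof.
move=> fc ff'; rewrite /prop_for /continuous_at -(nbhs_singleton ff').
exact: cvg_trans (near_eq_cvg ff') fc.
Qed.

Lemma expandable_continuous g g1 s : expandable g g1 s ->
  {for (0, s), continuous (fun p => g p.1 p.2)}.
Proof.
case=> q [g0 qs gq _].
have : {for (0, s), continuous (fun p : R * R => g 0 p.2 + p.1 * q p)}.
  by apply: cvgD; [exact: continuous_at_snd|apply: cvgM; [exact: cvg_fst|]].
by move/continuous_near_eq; apply; near do apply/esym.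
Unshelve. all: by end_near. Qed.

Lemma expandable_continuous1 g g1 s : expandable g g1 s -> {for s, continuous g1}.
Proof.
case=> q [_ /continuous_at_line qs _ qg].
exact: (continuous_near_eq qs qg).
Qed.

Lemma expandable_eq g g1 h h1 s : expandable g g1 s ->
  (\forall p \near (0, s), g p.1 p.2 = h p.1 p.2) ->
  (\forall t \near s, g1 t = h1 t) -> expandable h h1 s.
Proof.
case=> q [g0 qs gq qg] gh gh1; exists q; split => //.
- exact: (continuous_near_eq g0 (near_line gh)).
- near=> p; have <- : g p.1 p.2 = h p.1 p.2 by near: p.
  have <- : g 0 p.2 = h 0 p.2.
    by near: p; apply: (near_snd (P := fun t => g 0 t = h 0 t)); exact: near_line gh.
  by near: p.
- by near=> t; rewrite (near qg t)//; near: t.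
Unshelve. all: by end_near. Qed.

Lemma expands_expandable m g g1 s : expands m g g1 -> I s -> expandable g g1 s.
Proof. by case: m => [|m] [+ _]; exact. Qed.

Lemma expandsW m g g1 : expands m.+1 g g1 -> expands m g g1.
Proof.
elim: m g g1 => [|m ih] g g1 [u [d d1 e]]; first by split.
by split=> //; split=> //; exact: ih.
Qed.

(** Equality is asked near [(0, s)] only, because the rules for derivatives in [s], to which this is
    applied, hold only where the functions are derivable, that is for small [e]. *)
Lemma expands_eq m g g1 h h1 : expands m g g1 ->
  (forall s, I s -> \forall p \near (0, s), g p.1 p.2 = h p.1 p.2) ->
  (forall s, I s -> g1 s = h1 s) -> expands m h h1.
Proof.
move=> + + gh1.
have gh1n s : I s -> \forall t \near s, g1 t = h1 t.
  by move=> Is; apply: filterS (near_open Is); exact: gh1.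
elim: m g g1 h h1 {gh1} gh1n => [|m ih] g g1 h h1 gh1 /= [u d] gh.
  by split=> // s Is; apply: expandable_eq (u _ Is) _ _; [exact: gh|exact: gh1].
case: d => d d1 e; split.
  by move=> s Is; apply: expandable_eq (u _ Is) _ _; [exact: gh|exact: gh1].
split.
- move=> s Is; near=> p; apply: (@near_eq_derivable _ _ _ (g p.1)).
    by near: p; exact: near_slice (gh _ Is).
  by near: p; exact: d.
- by move=> s Is; apply: near_eq_derivable (d1 _ Is); exact: gh1.
- apply: ih e _ => [s Is|s Is]; near=> p; apply: near_derive1_eq.
    by near: p; apply: (@near_join R s (fun t => g1 t = h1 t)); exact: gh1.
  by near: p; exact: near_slice (gh _ Is).
Unshelve. all: by end_near. Qed.

Lemma expands_eq_on m g g1 h h1 : expands m g g1 ->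
  (forall e s, I s -> g e s = h e s) ->
  (forall s, I s -> g1 s = h1 s) -> expands m h h1.
Proof.
move=> e gh; apply: expands_eq e _ => s Is.
by apply: filterS (near_snd (near_open Is)) => p; exact: gh.
Qed.

Lemma expandableD g g1 h h1 s : expandable g g1 s -> expandable h h1 s ->
  expandable (fun e t => g e t + h e t) (fun t => g1 t + h1 t) s.
Proof.
case=> q [g0 qs gq qg] [r [h0 rs hr rh]]; exists (fun p => q p + r p); split.
- exact: continuousD.
- exact: continuousD.
- near=> p; rewrite (near gq p)// (near hr p)//; ring.
- by near=> t; rewrite (near qg t)// (near rh t).
Unshelve. all: by end_near. Qed.

Lemma expandsD m g g1 h h1 : expands m g g1 -> expands m h h1 ->
  expands m (fun e t => g e t + h e t) (fun t => g1 t + h1 t).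
Proof.
elim: m g g1 h h1 => [|m ih] g g1 h h1 [ug dg] [uh dh]; split => //.
- by move=> s Is; apply: expandableD; [exact: ug|exact: uh].
- by move=> s Is; apply: expandableD; [exact: ug|exact: uh].
case: dg dh => [dg dg1 eg] [dh dh1 eh]; split=> [s Is|s Is|].
- by apply: filterS2 (dg _ Is) (dh _ Is) => p; exact: derivableD.
- by apply: derivableD; [exact: dg1|exact: dh1].
- apply: (expands_eq (ih _ _ _ _ eg eh)) => s Is.
    by apply: filterS2 (dg _ Is) (dh _ Is) => p dgp dhp; rewrite derive1D.
  by rewrite derive1D//; [exact: dg1|exact: dh1].
Unshelve. all: by end_near. Qed.

Lemma expandableM g g1 h h1 s : expandable g g1 s -> expandable h h1 s ->
  expandable (fun e t => g e t * h e t) (fun t => g1 t * h 0 t + g 0 t * h1 t) s.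
Proof.
move=> ug /[dup] uh [r [h0 rs hr rh]]; case: ug => [q [g0 qs gq qg]].
exists (fun p => q p * h p.1 p.2 + g 0 p.2 * r p); split.
- exact: continuousM.
- apply: continuousD; apply: continuousM => //; first exact: expandable_continuous uh.
  exact: continuous_at_snd.
- near=> p; have E1 : g p.1 p.2 = g 0 p.2 + p.1 * q p by near: p.
  have E2 : h p.1 p.2 = h 0 p.2 + p.1 * r p by near: p.
  by rewrite E1 E2; ring.
- by near=> t; rewrite /= (near qg t)// (near rh t).
Unshelve. all: by end_near. Qed.

Lemma expandsM m g g1 h h1 : expands m g g1 -> expands m h h1 ->
  expands m (fun e t => g e t * h e t) (fun t => g1 t * h 0 t + g 0 t * h1 t).
Proof.
elim: m g g1 h h1 => [|m ih] g g1 h h1 eg eh; split => //.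
- by move=> s Is; apply: expandableM; [exact: expands_expandable eg _|exact: expands_expandable eh _].
- by move=> s Is; apply: expandableM; [exact: expands_expandable eg _|exact: expands_expandable eh _].
(* The derivative of a product still contains the factors themselves, which are therefore needed at
   order [m] too. *)
have [eg' eh'] := (expandsW eg, expandsW eh).
case: eg eh => [_ [dg dg1 eg]] [_ [dh dh1 eh]].
have dg0 s : I s -> derivable (g 0) s 1 by move=> /dg/nbhs_singleton.
have dh0 s : I s -> derivable (h 0) s 1 by move=> /dh/nbhs_singleton.
split=> [s Is|s Is|].
- by apply: filterS2 (dg _ Is) (dh _ Is) => p; exact: derivableM.
- by apply: derivableD; apply: derivableM; auto.
- apply: (expands_eq (expandsD (ih _ _ _ _ eg eh') (ih _ _ _ _ eg' eh))) => s Is.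
    apply: filterS2 (dg _ Is) (dh _ Is) => p dgp dhp.
    by rewrite derive1M.
  rewrite derive1D; last 2 first.
  + by apply: derivableM; [exact: dg1|exact: dh0].
  + by apply: derivableM; [exact: dg0|exact: dh1].
  rewrite (derive1M (dg1 _ Is) (dh0 _ Is)) (derive1M (dg0 _ Is) (dh1 _ Is)).
  by rewrite addrACA.
Qed.

Lemma expandable_cst (f : R -> R) s : {for s, continuous f} ->
  expandable (fun=> f) (fun=> 0) s.
Proof.
move=> fs; exists (fun=> 0); split=> //; first exact: cvg_cst.
  by near=> p; rewrite mulr0 addr0.
by near=> p.
Unshelve. all: by end_near. Qed.

Lemma expands_cstS m (f : R -> R) : (forall s, I s -> derivable f s 1) ->
  expands m (fun=> derive1 f) (fun=> 0) -> expands m.+1 (fun=> f) (fun=> 0).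
Proof.
move=> df ef; split.
  move=> s Is; apply: expandable_cst.
  by apply/differentiable_continuous/derivable1_diffP; exact: df.
split=> [s Is|s Is|]; last 1 first.
- by apply: (expands_eq_on ef) => // s _; rewrite derive1_cst.
- apply: (near_snd (P := fun t => derivable f t 1)).
  by apply: filterS (near_open Is) => t; exact: df.
- exact: derivable_cst.
Qed.

Lemma expands_cst m (f : R -> R) : smooth_on I f ->
  expands m (fun=> f) (fun=> 0).
Proof.
elim: m f => [|m ih] f sf.
  split=> // s Is; apply: expandable_cst.
  by apply/differentiable_continuous/derivable1_diffP; exact: (sf 0%N).
apply: expands_cstS; first exact: (sf 0%N).
by apply: ih => k s Is; rewrite -derive1Sn; exact: sf.
Qed.

(** Through families constant in [e], each stability property of [expands] becomes a closure
    property of smooth functions. *)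
Lemma smooth_onP (f : R -> R) :
  (forall m, exists f1, expands m (fun=> f) f1) <-> smooth_on I f.
Proof.
split=> [ef k|sf m]; last by exists (fun=> 0); exact: expands_cst.
move=> s Is; have [f1] := ef k.+1; elim: k f f1 {ef} => [|k ih] f f1.
  by case=> _ [df _ _]; have /nbhs_singleton := df _ Is.
by rewrite derive1Sn; case=> _ [_ _]; exact: ih.
Qed.

(** Applied to the zero variation, the first half gives the smoothness of kappa, tau and the
    Lagrangian along the curve; the second half gives that of the first variations. *)
Lemma expands_smooth g g1 : (forall m, expands m g g1) ->
  smooth_on I (g 0) /\ smooth_on I g1.
Proof.
move=> egg1; split=> k s Is; have := egg1 k.+1; elim: k g g1 {egg1} => [|k ih] g g1.
- by case=> _ [dg _ _]; have /nbhs_singleton := dg _ Is.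
- by rewrite derive1Sn; case=> _ [_ _]; exact: (ih (fun e => (g e)^`())).
- by case=> _ [_ dg _]; exact: dg.
- by rewrite derive1Sn; case=> _ [_ _]; exact: ih.
Qed.

End Expansions.

(** * Linear operations, finite sums, inverses and square roots of expansions *)

Lemma derive1V (R : realType) (f : R -> R) (s : R) : f s != 0 ->
  derivable f s 1 ->
  derive1 (fun t => (f t)^-1) s = - (derive1 f s * ((f s)^-1 * (f s)^-1)).
Proof.
move=> fs df; rewrite !derive1E deriveV// /GRing.scale/= mulNr mulrC.
by rewrite expr2 invfM.
Qed.

Lemma derive1Z (R : realType) (c : R) (f : R -> R) (s : R) : derivable f s 1 ->
  derive1 (fun t => c * f t) s = c * derive1 f s.
Proof.
move=> df; have := derive1M (derivable_cst c s 1) df.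
by rewrite derive1_cst mul0r add0r.
Qed.

Lemma derive1_sqrt (R : realType) (f : R -> R) (s : R) : 0 < f s ->
  derivable f s 1 ->
  derivable (fun t => Num.sqrt (f t)) s 1 /\
  derive1 (fun t => Num.sqrt (f t)) s = derive1 f s * (2 * Num.sqrt (f s))^-1.
Proof.
move=> fs /derivable_is_derive df.
have dsq := is_derive1_sqrt fs.
have := @is_derive1_comp _ _ _ _ _ _ dsq df; case=> ? e; split => //.
by rewrite derive1E e mulrC.
Qed.

Lemma smooth_cst (R : realType) (I : set R) (c : R) : smooth_on I (fun=> c).
Proof.
have D1 (a : R) : derive1 (fun=> a) = (fun=> 0 : R).
  by apply/funext => t; rewrite derive1_cst.
move=> k; elim: k c => [|k ih] c s Is; first exact: derivable_cst.
by rewrite derive1Sn D1; exact: ih.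
Qed.

Arguments smooth_cst {R} I c.

Section Expansions.
Variables (R : realType) (I : set R).
Hypothesis openI : open I.
Notation expands := (expands I).

Lemma expandsZ m (c : R) g g1 : expands m g g1 ->
  expands m (fun e t => c * g e t) (fun t => c * g1 t).
Proof.
move=> eg; have := expandsM openI (expands_cst openI m (smooth_cst I c)) eg.
by move/(expands_eq_on openI); apply=> // s _; rewrite mul0r add0r.
Qed.

Lemma expandsN m g g1 : expands m g g1 ->
  expands m (fun e t => - g e t) (fun t => - g1 t).
Proof.
by move/(expandsZ (-1))/(expands_eq_on openI); apply=> *; rewrite mulN1r.
Qed.

Lemma expandsB m g g1 h h1 : expands m g g1 -> expands m h h1 ->
  expands m (fun e t => g e t - h e t) (fun t => g1 t - h1 t).
Proof. by move=> eg /expandsN; exact: expandsD. Qed.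

Lemma expands_sum m (T : Type) (r : seq T) (P : pred T) g g1 :
  (forall i, P i -> expands m (g i) (g1 i)) ->
  expands m (fun e t => \sum_(i <- r | P i) g i e t)
            (fun t => \sum_(i <- r | P i) g1 i t).
Proof.
move=> eg; elim: r => [|i r ih].
  by apply: (expands_eq_on openI (expands_cst openI m (smooth_cst I 0))) => *;
     rewrite big_nil.
case Pi : (P i); last first.
  by apply: (expands_eq_on openI ih) => *; rewrite big_cons Pi.
by apply: (expands_eq_on openI (expandsD openI (eg _ Pi) ih)) => *;
   rewrite big_cons Pi.
Qed.

Lemma near_neq0 (T : topologicalType) (f : T -> R) (x : T) :
  {for x, continuous f} -> f x != 0 -> \forall t \near x, f t != 0.
Proof.
move=> fx f0; apply: (fx [set y | y != 0]).
by apply: open_nbhs_nbhs; split => //; exact: open_neq.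
Qed.

(** From [1/a - 1/b = - (a - b) / (a b)], the quotient of the inverse is [- q] divided by the
    perturbed and the unperturbed value. *)
Lemma expandableV (g : R -> R -> R) g1 s : expandable g g1 s -> g 0 s != 0 ->
  expandable (fun e t => (g e t)^-1)
       (fun t => - (g1 t * ((g 0 t)^-1 * (g 0 t)^-1))) s.
Proof.
move=> /[dup] ug [q [g0 qs gq qg]] g0s.
have gc : {for (0, s), continuous (fun p : R * R => g p.1 p.2)} := expandable_continuous ug.
exists (fun p => - (q p * ((g p.1 p.2)^-1 * (g 0 p.2)^-1))); split.
- exact: continuousV.
- apply: cvgN; apply: cvgM => //; apply: cvgM; apply: cvgV => //.
  exact: (continuous_at_snd g0).
- have g0n : \forall p \near (0 : R, s), g 0 p.2 != 0.
    by apply: (near_snd (P := fun t => g 0 t != 0)); exact: near_neq0.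
  apply: filterS3 gq (near_neq0 gc g0s) g0n => p gp gp0 g0p0.
  have e : p.1 * q p = g p.1 p.2 - g 0 p.2 by rewrite gp; ring.
  rewrite [p.1 * _]mulrN mulrA e; move: gp0 g0p0.
  by move: (g p.1 p.2) (g 0 p.2) => a b a0 b0; field; apply/andP.
- by apply: filterS qg => t <-.
Qed.

(** The derivative is written with a product of two inverses rather than the inverse of a square, so
    that the induction hypothesis for the inverse itself applies to both factors. *)
Lemma expandsV m g g1 : expands m g g1 -> (forall s, I s -> g 0 s != 0) ->
  expands m (fun e t => (g e t)^-1)
            (fun t => - (g1 t * ((g 0 t)^-1 * (g 0 t)^-1))).
Proof.
elim: m g g1 => [|m ih] g g1 eg g0.
  by split=> // s Is; apply: expandableV (expands_expandable eg Is) (g0 _ Is).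
split.
  by move=> s Is; apply: expandableV (expands_expandable eg Is) (g0 _ Is).
have egw := expandsW eg.
have gn0 s : I s -> \forall p \near (0 : R, s), g p.1 p.2 != 0.
  move=> Is; have := near_neq0 (expandable_continuous (expands_expandable eg Is)); apply; exact: g0.
case: (eg) => _ [dg dg1 eg'].
have dg0 s : I s -> derivable (g 0) s 1 by move=> /dg/nbhs_singleton.
have dV s : I s -> derivable (fun t => (g 0 t)^-1) s 1.
  by move=> Is; apply: derivableV; [exact: g0|exact: dg0].
split=> [s Is|s Is|].
- by apply: filterS2 (dg _ Is) (gn0 _ Is) => p *; exact: derivableV.
- by apply: derivableN; apply: derivableM; [exact: dg1|apply: derivableM; exact: dV].
- have eV := ih _ _ egw g0.
  apply: (expands_eq openI
    (expandsN (expandsM openI eg' (expandsM openI eV eV)))) => s Is.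
    by apply: filterS2 (dg _ Is) (gn0 _ Is) => p ? ?; rewrite derive1V.
  have dVV : derivable (fun t => (g 0 t)^-1 * (g 0 t)^-1) s 1.
    by apply: derivableM; exact: dV.
  rewrite (derive1N (derivableM (dg1 _ Is) dVV)) (derive1M (dg1 _ Is) dVV).
  rewrite (derive1M (dV _ Is) (dV _ Is)) (derive1V (g0 _ Is) (dg0 _ Is)).
  move: (derive1 (g 0) s) (derive1 g1 s) (g1 s) => /= a b c.
  move: (_^-1) => d; ring.
Qed.

(** The difference of the roots is rationalized: [sqrt a - sqrt b = (a - b) / (sqrt a + sqrt b)],
    whose denominator tends to twice the unperturbed root. *)
Lemma expandable_sqrt (g : R -> R -> R) g1 s : expandable g g1 s -> 0 < g 0 s ->
  expandable (fun e t => Num.sqrt (g e t))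
       (fun t => g1 t * (2 * Num.sqrt (g 0 t))^-1) s.
Proof.
move=> /[dup] ug [q [g0 qs gq qg]] g0s.
have gc : {for (0, s), continuous (fun p : R * R => g p.1 p.2)} := expandable_continuous ug.
have g0c : {for (0, s), continuous (fun p : R * R => g 0 p.2)}.
  exact: (continuous_at_snd g0).
have sc (f : R * R -> R) : {for (0, s), continuous f} ->
    {for (0, s), continuous (fun p => Num.sqrt (f p))}.
  by move=> fc; exact: (cvg_comp f (@Num.sqrt R) fc (@sqrt_continuous R _)).
have g0p : \forall p \near (0 : R, s), 0 < g 0 p.2.
  by apply: (g0c [set y | 0 < y]); exact: lt_nbhsr.
exists (fun p => q p * (Num.sqrt (g p.1 p.2) + Num.sqrt (g 0 p.2))^-1); split.
- exact: (cvg_comp (g 0) (@Num.sqrt R) g0 (@sqrt_continuous R _)).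
- apply: cvgM => //; apply: cvgV; first by rewrite gt_eqF// addr_gt0// sqrtr_gt0.
  by apply: cvgD; exact: sc.
- have gp0 : \forall p \near (0 : R, s), 0 < g p.1 p.2.
    by apply: (gc [set y | 0 < y]); exact: lt_nbhsr.
  apply: filterS3 gq g0p gp0 => p gp g0p0 gp0.
  have := sqr_sqrtr (ltW gp0); have := sqr_sqrtr (ltW g0p0).
  have : 0 < Num.sqrt (g p.1 p.2) by rewrite sqrtr_gt0.
  have : 0 < Num.sqrt (g 0 p.2) by rewrite sqrtr_gt0.
  move: (Num.sqrt (g p.1 p.2)) (Num.sqrt (g 0 p.2)) => a b b0 a0 Eb Ea.
  have e : p.1 * q p = (a - b) * (a + b).
    by rewrite -[LHS](addKr (g 0 p.2)) -gp -Ea -Eb; ring.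
  by rewrite mulrA e mulfK; [ring|rewrite gt_eqF// addr_gt0].
- near=> t; have -> : q (0, t) = g1 t by near: t.
  by rewrite /= -mulr2n mulr_natl.
Unshelve. all: by end_near. Qed.

Lemma expands_sqrt m g g1 : expands m g g1 -> (forall s, I s -> 0 < g 0 s) ->
  expands m (fun e t => Num.sqrt (g e t))
            (fun t => g1 t * (2 * Num.sqrt (g 0 t))^-1).
Proof.
elim: m g g1 => [|m ih] g g1 eg g0.
  by split=> // s Is; apply: expandable_sqrt (expands_expandable eg Is) (g0 _ Is).
split.
  by move=> s Is; apply: expandable_sqrt (expands_expandable eg Is) (g0 _ Is).
have egw := expandsW eg.
have gp0 s : I s -> \forall p \near (0 : R, s), 0 < g p.1 p.2.
  move=> Is; have := expandable_continuous (expands_expandable eg Is).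
  by move/(_ [set y | 0 < y]); apply; apply: lt_nbhsr; exact: g0.
case: (eg) => _ [dg dg1 eg'].
have dg0 s : I s -> derivable (g 0) s 1 by move=> /dg/nbhs_singleton.
have s0 s : I s -> 2 * Num.sqrt (g 0 s) != 0.
  by move=> Is; rewrite gt_eqF// mulr_gt0// sqrtr_gt0 g0.
have dS s : I s -> derivable (fun t => Num.sqrt (g 0 t)) s 1.
  by move=> Is; exact: (@derive1_sqrt R (g 0) s (g0 _ Is) (dg0 _ Is)).1.
have d2S s : I s -> derivable (fun t => 2 * Num.sqrt (g 0 t)) s 1.
  by move=> Is; apply: derivableM (dS _ Is); exact: derivable_cst.
have dV s : I s -> derivable (fun t => (2 * Num.sqrt (g 0 t))^-1) s 1.
  by move=> Is; apply: derivableV; [exact: s0|exact: d2S].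
split=> [s Is|s Is|].
- by apply: filterS2 (dg _ Is) (gp0 _ Is) => p dp p0; exact: (@derive1_sqrt R (g p.1) p.2 p0 dp).1.
- by apply: derivableM; [exact: dg1|exact: dV].
- have eS := expandsZ 2 (ih _ _ egw g0).
  have := expandsM openI eg' (expandsV eS s0).
  move/(expands_eq openI); apply=> s Is.
    by apply: filterS2 (dg _ Is) (gp0 _ Is) => p dp p0; rewrite (@derive1_sqrt R (g p.1) p.2 p0 dp).2.
  rewrite derive1M//; [|exact: dg1|exact: dV].
  have E1 := @derive1V R (fun t => 2 * Num.sqrt (g 0 t)) s (s0 _ Is) (d2S _ Is).
  have E2 := @derive1Z R 2 (fun t => Num.sqrt (g 0 t)) s (dS _ Is).
  have E3 := (@derive1_sqrt R (g 0) s (g0 _ Is) (dg0 _ Is)).2.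
  rewrite {}E1 {}E2 {}E3.
  move: (derive1 (g 0) s) (derive1 g1 s) (g1 s) => /= a b c.
  by move: (_^-1) => d; ring.
Qed.

End Expansions.

(** * Mean values and symmetry of second derivatives *)

(** [X] and [Y] are mixed derivatives at intermediate points that represent the same second
    difference, hence coincide after division by [t ^+ 2]. *)
Lemma dist_of_second_difference (R : realType) (t e x y X Y a b c d : R) :
  0 < t -> a - b - (c - d) = t * (t * X) -> a - c - (b - d) = t * (t * Y) ->
  `|x - X| < e / 2 -> `|y - Y| < e / 2 -> `|x - y| <= e.
Proof.
move=> t0 EX EY; have -> : X = Y.
  have tn0 : t != 0 by rewrite gt_eqF.
  by apply: (mulfI tn0); apply: (mulfI tn0); rewrite -EX -EY; ring.
rewrite !ltr_norml ler_norml => /andP[? ?] /andP[? ?].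
by apply/andP; split; lra.
Qed.

Section Normed.
Variables (R : realType) (V : normedModType R).
Implicit Types (F G : V -> R) (p u v h : V).

Lemma is_derive_segment F p h (t : R) : differentiable F (p + t *: h) ->
  is_derive t 1 (fun x : R => F (p + x *: h)) ('D_h F (p + t *: h)).
Proof.
move=> dF; pose l (x : R) := p + x *: h.
have dsc : differentiable (fun x : R => x *: h) t.
  by apply: (@differentiableZl R R V id h t); exact/derivable1_diffP.
have dl : differentiable l t by exact: (differentiableD _ dsc).
have dl1 : 'd l t 1 = h.
  rewrite -deriveE// deriveD; last by exact: diff_derivable.
    rewrite derive_cst add0r deriveE// (@diffZl R R V id h t); last exact/derivable1_diffP.
    by rewrite diff_val scale1r.
  exact: derivable_cst.
have dc : differentiable (F \o l) t by exact: differentiable_comp.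
apply: DeriveDef; first exact/derivable1_diffP.
by rewrite (_ : (fun _ => _) = F \o l)// deriveE// diff_comp//= dl1 deriveE.
Qed.

Lemma segment_mean_value F p h :
  (forall t : R, 0 <= t <= 1 -> differentiable F (p + t *: h)) ->
  exists2 t : R, 0 <= t <= 1 & F (p + h) - F p = 'D_h F (p + t *: h).
Proof.
move=> dF.
have [||t t01] := @MVT_segment R (fun x => F (p + x *: h))
    (fun x => 'D_h F (p + x *: h)) 0 1 ler01.
- move=> x; rewrite in_itv/= => /andP[x0 x1]; apply: is_derive_segment.
  by apply: dF; rewrite !ltW.
- apply: derivable_within_continuous => x; rewrite in_itv/= => x01.
  by have [] := is_derive_segment (dF _ x01).
by rewrite subr0 mulr1 scale1r scale0r addr0 => E; exists t.
Qed.

Lemma deriveZdir F q h (t : R) : differentiable F q ->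
  'D_(t *: h) F q = t * 'D_h F q.
Proof. by move=> dF; rewrite !deriveE// linearZ. Qed.

(** The mean value theorem is used twice: along [t *: u] for the increment of [F] under translation
    by [t *: v], then along [t *: v] for ['D_u F]. *)
Lemma second_difference F u v p (t : R) :
  (forall a b : R, 0 <= a <= 1 -> 0 <= b <= 1 ->
    differentiable F (p + a *: (t *: u) + b *: (t *: v)) /\
    differentiable ('D_u F) (p + a *: (t *: u) + b *: (t *: v))) ->
  exists a b : R, [/\ 0 <= a <= 1, 0 <= b <= 1 &
    F (p + t *: u + t *: v) - F (p + t *: u) - (F (p + t *: v) - F p) =
    t * (t * 'D_v ('D_u F) (p + a *: (t *: u) + b *: (t *: v)))].
Proof.
move=> dF.
have i0 : 0 <= (0 : R) <= 1 by rewrite lexx ler01.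
have i1 : 0 <= (1 : R) <= 1 by rewrite lexx ler01.
pose sh (q : V) := q + t *: v.
have ds (q : V) : differentiable sh q /\ 'd sh q = id :> (V -> V).
  split; first exact: differentiableD.
  rewrite diffD// diff_cst; apply/funext => z /=.
  by rewrite [LHS]addr0 diff_val.
have dFs q : differentiable F (q + t *: v) ->
    differentiable (F \o sh) q /\ 'D_u (F \o sh) q = 'D_u F (q + t *: v).
  move=> dq; have dc : differentiable (F \o sh) q.
    by apply: differentiable_comp => //; case: (ds q).
  by split=> //; rewrite !deriveE// diff_comp//= ?(ds q).2//; case: (ds q).
have dF0 (a : R) : 0 <= a <= 1 -> differentiable F (p + a *: (t *: u)).
  by move=> a01; have := (dF a 0 a01 i0).1; rewrite scale0r addr0.
have dF1 (a : R) : 0 <= a <= 1 -> differentiable F (p + a *: (t *: u) + t *: v).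
  by move=> a01; have := (dF a 1 a01 i1).1; rewrite scale1r.
have dB a : 0 <= a <= 1 -> differentiable (fun q => (F \o sh) q - F q) (p + a *: (t *: u)).
  by move=> a01; apply: differentiableB; [exact: (dFs _ (dF1 _ a01)).1|exact: dF0].
have [a a01 Ea] := segment_mean_value dB.
have [|b b01 Eb] := @segment_mean_value ('D_u F) (p + a *: (t *: u)) (t *: v).
  by move=> b b01; exact: (dF _ _ _ _).2.
exists a, b; split=> //; rewrite -(deriveZdir _ _ (dF _ _ a01 b01).2) -Eb.
rewrite [LHS]Ea deriveZdir; last exact: dB.
rewrite deriveB; first by rewrite (dFs _ (dF1 _ a01)).2.
- by apply: diff_derivable; exact: (dFs _ (dF1 _ a01)).1.
- by apply: diff_derivable; exact: dF0.
Qed.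

(** The second difference over a small parallelogram is symmetric in [u] and [v], and
    [second_difference] equates it, up to [t ^+ 2], with each of the two mixed derivatives at some
    point of the parallelogram; continuity brings both points back to [p]. *)
Lemma Schwarz (U : set V) F u v p : open U -> U p ->
  (forall q, U q -> [/\ differentiable F q, differentiable ('D_u F) q &
    differentiable ('D_v F) q]) ->
  {for p, continuous ('D_v ('D_u F))} ->
  {for p, continuous ('D_u ('D_v F))} ->
  'D_v ('D_u F) p = 'D_u ('D_v F) p.
Proof.
move=> openU Up dF /cvgrPdist_lt cvu /cvgrPdist_lt cuv.
apply/eqP; rewrite -subr_eq0 -normr_le0; apply/ler_addgt0Pl => e e0; rewrite addr0.
have e20 : 0 < e / 2 by rewrite divr_gt0.
have [r r0 rP] : exists2 r : R, 0 < r & forall q, `|p - q| < r ->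
    [/\ U q, `|'D_v ('D_u F) p - 'D_v ('D_u F) q| < e / 2 &
             `|'D_u ('D_v F) p - 'D_u ('D_v F) q| < e / 2].
  have : \forall q \near p, [/\ U q,
      `|'D_v ('D_u F) p - 'D_v ('D_u F) q| < e / 2 &
      `|'D_u ('D_v F) p - 'D_u ('D_v F) q| < e / 2].
    apply: filterS3 (open_nbhs_nbhs (conj openU Up)) (cvu _ e20) (cuv _ e20).
    move=> q h1 h2 h3; exact: And3 h1 h2 h3.
  move=> /nbhs_ballP[r r0 rU].
  by exists r => // q pq; apply: rU; rewrite -ball_normE.
(* The parallelogram with sides [t *: u] and [t *: v] then fits in the ball of radius [r]; the
   summand 1 covers [u = v = 0]. *)
pose t := r / (`|u| + `|v| + 1).
have d0 : 0 < `|u| + `|v| + 1 by rewrite ltr_wpDl// addr_ge0.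
have t0 : 0 < t by rewrite divr_gt0.
have tr : t * (`|u| + `|v|) < r.
  by rewrite /t mulrAC ltr_pdivrMr// ltr_pM2l// ltrDl.
clearbody t.
have near_p (a b : R) : 0 <= a <= 1 -> 0 <= b <= 1 ->
    `|p - (p + a *: (t *: u) + b *: (t *: v))| < r.
  move=> /andP[a0 a1] /andP[b0 b1].
  rewrite -addrA opprD addNKr normrN.
  apply: (@le_lt_trans _ _ (t * `|u| + t * `|v|)).
    rewrite (le_trans (ler_normD _ _))// !normrZ.
    rewrite (ger0_norm a0) (ger0_norm b0) (ger0_norm (ltW t0)).
    by rewrite lerD// ler_piMl// mulr_ge0// (ltW t0).
  by rewrite -mulrDr.
have dFp (w : V) : `|p - w| < r ->
    [/\ differentiable F w, differentiable ('D_u F) w & differentiable ('D_v F) w].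
  by move=> /rP[/dF].
have [a [b [a01 b01 E]]] := @second_difference F u v p t (fun a b a01 b01 =>
  let: And3 h1 h2 _ := dFp _ (near_p a b a01 b01) in conj h1 h2).
have near_p' (c d : R) : 0 <= c <= 1 -> 0 <= d <= 1 ->
    `|p - (p + c *: (t *: v) + d *: (t *: u))| < r.
  by move=> ? ?; rewrite addrAC; exact: near_p.
have [c [d [c01 d01 E']]] := @second_difference F v u p t (fun c d c01 d01 =>
  let: And3 h1 _ h2 := dFp _ (near_p' c d c01 d01) in conj h1 h2).
rewrite (addrAC p) in E'.
have [_ h1 _] := rP _ (near_p _ _ a01 b01).
have [_ _ h2] := rP _ (near_p' _ _ c01 d01).
exact: (dist_of_second_difference t0 E E' h1 h2).
Qed.

End Normed.

(** * Derivatives and limits of finite sums, entrywise limits of matrices *)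

Lemma derivable_big_sum (R : realType) (T : Type) (r : seq T) (P : pred T)
    (f : T -> R -> R) (s : R) : (forall i, P i -> derivable (f i) s 1) ->
  derivable (fun t => \sum_(i <- r | P i) f i t) s 1.
Proof.
move=> df; elim: r => [|i r ih].
  by under eq_fun do rewrite big_nil; exact: derivable_cst.
under eq_fun do rewrite big_cons.
by case Pi : (P i); [apply: derivableD; [exact: df|exact: ih]|exact: ih].
Qed.

Lemma derive1_sum (R : realType) (T : Type) (r : seq T) (P : pred T)
    (f : T -> R -> R) (s : R) : (forall i, P i -> derivable (f i) s 1) ->
  derive1 (fun t => \sum_(i <- r | P i) f i t) s =
  \sum_(i <- r | P i) derive1 (f i) s.
Proof.
move=> df; elim: r => [|i r ih].
  by under eq_fun do rewrite big_nil; rewrite derive1_cst big_nil.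
under eq_fun do rewrite big_cons.
rewrite big_cons; case Pi : (P i) => //; rewrite -ih derive1D//; first exact: df.
exact: derivable_big_sum.
Qed.

Lemma cvg_bigsum (R : realType) (S T : Type) (F : set_system T) (r : seq S)
    (P : pred S) (f : S -> T -> R) (l : S -> R) : Filter F ->
  (forall i, P i -> f i x @[x --> F] --> l i) ->
  \sum_(i <- r | P i) f i x @[x --> F] --> \sum_(i <- r | P i) l i.
Proof.
move=> FF fl; elim: r => [|i r ih].
  by under eq_fun do rewrite big_nil; rewrite big_nil; exact: cvg_cst.
under eq_fun do rewrite big_cons; rewrite big_cons.
by case Pi : (P i); [apply: cvgD; [exact: fl|exact: ih]|exact: ih].
Qed.

Lemma near_forall (T : topologicalType) (J : finType) (P : J -> T -> Prop)
    (x : T) : (forall j, \forall t \near x, P j t) ->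
  \forall t \near x, forall j, P j t.
Proof. exact: (@filter_forall _ _ P (nbhs x) (nbhs_filter x)). Qed.

Lemma mx_cvgP (R : realType) (T : Type) (F : set_system T) (m n : nat)
    (f : T -> 'M[R]_(m.+1, n.+1)) (l : 'M[R]_(m.+1, n.+1)) : Filter F ->
  (forall i j, f x i j @[x --> F] --> l i j) -> f @ F --> l.
Proof.
move=> FF fl; apply/cvgrPdist_lt => /= e e0.
have : \forall x \near F, forall ij : 'I_m.+1 * 'I_n.+1,
    `|l ij.1 ij.2 - f x ij.1 ij.2| < e.
  by apply: filter_forall => ij; exact: ((cvgrPdist_lt _ _).1 (fl _ _)).
apply: filterS => x fx; rewrite /Num.Def.normr/= mx_normrE.
by apply: bigmax_lt => // ij _; rewrite !mxE; exact: fx.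
Qed.

(** * Smooth Lagrangians composed with expansions *)

Section Lagrangian.
Variables (R : realType) (n : nat) (U : set 'M[R]_(2, n.+1)).
Hypothesis openU : open U.
Notation jets := 'M[R]_(2, n.+1).
Notation idx := ('I_2 * 'I_n.+1)%type.
Implicit Types (F : jets -> R) (h : jets) (a b : idx).

Definition dpartial a F : jets -> R := partial a.1 a.2 F.

Lemma smooth_differentiable F p : smooth_lagrangian U F -> U p ->
  differentiable F p.
Proof. by move=> sF; exact: (sF [::]). Qed.

Lemma smooth_dpartial F a : smooth_lagrangian U F -> smooth_lagrangian U (dpartial a F).
Proof.
move=> sF l p Up; have := sF (rcons l a) p Up.
by rewrite foldr_rcons.
Qed.

Lemma dpartialC F a b p : smooth_lagrangian U F -> U p ->
  dpartial a (dpartial b F) p = dpartial b (dpartial a F) p.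
Proof.
move=> sF Up; have sab c d := smooth_dpartial c (smooth_dpartial d sF).
apply: (Schwarz openU Up).
- move=> q Uq; split; first exact: smooth_differentiable.
    exact: (smooth_differentiable (smooth_dpartial b sF)).
  exact: (smooth_differentiable (smooth_dpartial a sF)).
- exact: (differentiable_continuous (smooth_differentiable (sab a b) Up)).
- exact: (differentiable_continuous (smooth_differentiable (sab b a) Up)).
Qed.

Lemma derive_dpartial F p h : differentiable F p ->
  'D_h F p = \sum_a h a.1 a.2 * dpartial a F p.
Proof.
move=> dF; rewrite deriveE// {1}(matrix_sum_delta h) pair_big/= linear_sum.
by apply: eq_bigr => a _; rewrite linearZ /dpartial /partial deriveE.
Qed.

Lemma derivable_curve F (P : R -> jets) s : differentiable F (P s) ->
  (forall a, derivable (fun t => P t a.1 a.2) s 1) ->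
  derivable (fun t => F (P t)) s 1 /\
  derive1 (fun t => F (P t)) s =
  \sum_a derive1 (fun t => P t a.1 a.2) s * dpartial a F (P s).
Proof.
move=> dF dP.
have dPs : derivable P s 1 by apply/derivable_mxP => i j; exact: (dP (i, j)).
have /derivable1_diffP dPs' := dPs.
have dc : differentiable (F \o P) s by exact: differentiable_comp.
split; first exact/derivable1_diffP.
rewrite derive1E (_ : (fun _ => _) = F \o P)// deriveE// diff_comp//=.
rewrite -[X in 'd F _ X]deriveE// -deriveE// derive_dpartial//.
by apply: eq_bigr => a _; rewrite derive1E derive_mx// mxE.
Qed.

Section Composition.
Variables (I : set R) (g : idx -> R -> R -> R) (gv : idx -> R -> R).
Hypothesis openI : open I.

Definition jetmx (e t : R) : jets := \matrix_(j, k) g (j, k) e t.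

Lemma jetmxE e t a : jetmx e t a.1 a.2 = g a e t.
Proof. by rewrite mxE; case: a. Qed.

(** The mean value theorem on the segment from the unperturbed to the perturbed jet produces the
    quotient, with partial derivatives taken at an intermediate point [W]. The position of [W] on
    the segment is chosen without any regularity; [W] is nevertheless continuous at [(0, s)] because
    the segment shrinks to a point. *)
Lemma expandable_comp F s : smooth_lagrangian U F -> U (jetmx 0 s) ->
  (forall a, expandable (g a) (gv a) s) ->
  expandable (fun e t => F (jetmx e t))
       (fun t => \sum_a gv a t * dpartial a F (jetmx 0 t)) s.
Proof.
move=> sF Us ug.
pose q a := sval (cid (ug a)).
have qP a : [/\ {for s, continuous (g a 0)}, {for (0, s), continuous (q a)},
  \forall p \near (0, s), g a p.1 p.2 = g a 0 p.2 + p.1 * q a p &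
  \forall t \near s, q a (0, t) = gv a t] := svalP (cid (ug a)).
pose Q p : jets := \matrix_(j, k) q (j, k) p.
have QE p a : Q p a.1 a.2 = q a p by rewrite mxE; case: a.
have jc : {for s, continuous (jetmx 0)}.
  apply: mx_cvgP => j k; rewrite mxE; under eq_fun do rewrite mxE.
  by have [] := qP (j, k).
have jc2 : {for (0 : R, s), continuous (fun p : R * R => jetmx 0 p.2)}.
  exact: (continuous_at_snd jc).
have Qc : {for (0 : R, s), continuous Q}.
  apply: mx_cvgP => j k; rewrite mxE; under eq_fun do rewrite mxE.
  by have [] := qP (j, k).
have jq : \forall p \near (0 : R, s), jetmx p.1 p.2 = jetmx 0 p.2 + p.1 *: Q p.
  have : \forall p \near (0 : R, s), forall a, g a p.1 p.2 = g a 0 p.2 + p.1 * q a p.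
    apply: (@near_forall _ idx (fun a p => g a p.1 p.2 = g a 0 p.2 + p.1 * q a p)).
    by move=> a; have [] := qP a.
  by apply: filterS => p gp; apply/matrixP => j k; rewrite !mxE gp.
pose h (p : R * R) : jets := p.1 *: Q p.
have hc : h @ (0 : R, s) --> (0 : jets).
  rewrite -(scale0r (Q (0, s))); apply: cvgZ => //; exact: cvg_fst.
have [r r0 rU] : exists2 r : R, 0 < r & forall p, `|jetmx 0 s - p| < r -> U p.
  have /nbhs_ballP[r r0 rU] : nbhs (jetmx 0 s) U by exact: open_nbhs_nbhs.
  by exists r => // p pq; apply: rU; rewrite -ball_normE.
have r20 : 0 < r / 2 by rewrite divr_gt0.
have segU : \forall p \near (0 : R, s), forall t : R, 0 <= t <= 1 ->
    U (jetmx 0 p.2 + t *: h p).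
  apply: filterS2 ((cvgrPdist_lt _ _).1 jc2 _ r20) ((cvgrPdist_lt _ _).1 hc _ r20).
  move=> p jp hp t /andP[t0 t1]; apply: rU; rewrite opprD addrA.
  rewrite (le_lt_trans (ler_normB _ _))// (splitr r) ltrD//.
  rewrite normrZ ger0_norm// (le_lt_trans _ hp)// sub0r normrN.
  by rewrite ler_piMl.
(* The parameter is chosen for every [p], with default 0 when the segment leaves [U]; the bounds on
   it hold in all cases and the mean value formula only where [segU] applies. *)
have /choice[th thP] : forall p, exists t : R, 0 <= t <= 1 /\
    ((forall t : R, 0 <= t <= 1 -> U (jetmx 0 p.2 + t *: h p)) ->
     F (jetmx 0 p.2 + h p) - F (jetmx 0 p.2) = 'D_(h p) F (jetmx 0 p.2 + t *: h p)).
  move=> p; have [pU|npU] :=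
    pselect (forall t : R, 0 <= t <= 1 -> U (jetmx 0 p.2 + t *: h p)); last first.
    by exists 0; rewrite lexx ler01.
  have [|t t01 E] := @segment_mean_value R _ F (jetmx 0 p.2) (h p).
    by move=> t t01; exact: (smooth_differentiable sF (pU _ t01)).
  by exists t.
pose W p := jetmx 0 p.2 + th p *: h p.
have W0 t : W (0, t) = jetmx 0 t by rewrite /W /h scale0r scaler0 addr0.
have Wc : W @ (0 : R, s) --> jetmx 0 s.
  rewrite -[jetmx 0 s]addr0; apply: (cvgD jc2); apply/cvgrPdist_lt => e e0.
  apply: filterS ((cvgrPdist_lt _ _).1 hc _ e0) => p; rewrite !sub0r !normrN.
  have [/andP[t0 t1] _] := thP p.
  by apply: le_lt_trans; rewrite normrZ ger0_norm// ler_piMl.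
exists (fun p => \sum_a q a p * dpartial a F (W p)); split.
- apply: (cvg_comp (jetmx 0) F jc).
  exact: (differentiable_continuous (smooth_differentiable sF Us)).
- apply: cvg_bigsum => a _; apply: cvgM; first by have [] := qP a.
  rewrite W0; apply: (cvg_comp W _ Wc).
  exact: (differentiable_continuous (smooth_differentiable (smooth_dpartial a sF) Us)).
- apply: filterS2 jq segU => p jp Up; rewrite jp.
  have := (thP p).2 Up => /(canRL (subrK _)) ->.
  rewrite derive_dpartial; last by apply: smooth_differentiable (Up _ (thP p).1).
  rewrite addrC mulr_sumr; congr (_ + _); apply: eq_bigr => a _.
  by rewrite mxE QE mulrA.
- have : \forall t \near s, forall a, q a (0, t) = gv a t.
    apply: (@near_forall _ idx (fun a t => q a (0, t) = gv a t)).
    by move=> a; have [] := qP a.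
  by apply: filterS => t qt; apply: eq_bigr => a _; rewrite W0 qt.
Qed.

(** The induction ranges over all smooth [F], since the derivative in [s] brings in the partial
    derivatives of [F]. Differentiating in [e] after [s] or in [s] after [e] yields second partial
    derivatives in opposite orders, so symmetry closes the induction step. *)
Lemma expands_comp m F : smooth_lagrangian U F ->
  (forall s, I s -> U (jetmx 0 s)) -> (forall a, expands I m (g a) (gv a)) ->
  expands I m (fun e t => F (jetmx e t))
              (fun t => \sum_a gv a t * dpartial a F (jetmx 0 t)).
Proof.
move=> + Uj; elim: m F => [|m ih] F sF eg.
  by split=> // s Is; apply: expandable_comp => // [|a]; [exact: Uj|exact: expands_expandable (eg a) Is].
have egw a : expands I m (g a) (gv a) := expandsW (eg a).
have jfun e a : (fun t => jetmx e t a.1 a.2) = g a e.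
  by apply/funext => t; rewrite jetmxE.
have nU s : I s -> \forall p \near (0 : R, s), U (jetmx p.1 p.2).
  move=> Is; have : {for (0 : R, s), continuous (fun p : R * R => jetmx p.1 p.2)}.
    apply: mx_cvgP => j k; rewrite mxE; under eq_fun do rewrite mxE.
    exact: expandable_continuous (expands_expandable (eg (j, k)) Is).
  by apply; apply: open_nbhs_nbhs; split => //; exact: Uj.
have dg a s : I s -> \forall p \near (0 : R, s), derivable (g a p.1) p.2 1.
  by case: (eg a) => _ [+ _ _]; exact.
have dg0 a s : I s -> derivable (g a 0) s 1 by move=> /(dg a)/nbhs_singleton.
have dgv a s : I s -> derivable (gv a) s 1.
  by case: (eg a) => _ [_ + _]; exact.
have eg' a : expands I m (fun e => derive1 (g a e)) (derive1 (gv a)).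
  by case: (eg a) => _ [_ _].
have curve F' e s : smooth_lagrangian U F' -> U (jetmx e s) ->
    (forall a, derivable (g a e) s 1) ->
    derivable (fun t => F' (jetmx e t)) s 1 /\
    derive1 (fun t => F' (jetmx e t)) s =
    \sum_a derive1 (g a e) s * dpartial a F' (jetmx e s).
  move=> sF' Us da; have [|d dE] := @derivable_curve F' (jetmx e) s
    (smooth_differentiable sF' Us); first by move=> a; rewrite jfun.
  by split=> //; rewrite dE; apply: eq_bigr => a _; rewrite jfun.
have nd s : I s -> \forall p \near (0 : R, s),
    U (jetmx p.1 p.2) /\ forall a, derivable (g a p.1) p.2 1.
  move=> Is; have : \forall p \near (0 : R, s), forall a, derivable (g a p.1) p.2 1.
    apply: (@near_forall _ idx (fun a p => derivable (g a p.1) p.2 1)).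
    by move=> a; exact: dg.
  by apply: filterS2 (nU _ Is) => p.
have cF a s : I s -> derivable (fun t => dpartial a F (jetmx 0 t)) s 1 /\
    derive1 (fun t => dpartial a F (jetmx 0 t)) s =
    \sum_b derive1 (g b 0) s * dpartial b (dpartial a F) (jetmx 0 s).
  by move=> Is; apply: curve; [exact: smooth_dpartial|exact: Uj|move=> b; exact: dg0].
have dvF a s : I s -> derivable (fun t => gv a t * dpartial a F (jetmx 0 t)) s 1.
  by move=> Is; apply: derivableM; [exact: dgv|exact: (cF a s Is).1].
split.
  by move=> s Is; apply: expandable_comp => // [|a]; [exact: Uj|exact: expands_expandable (eg a) Is].
split=> [s Is|s Is|].
- by apply: filterS (nd _ Is) => p [Up dp]; exact: (curve _ _ _ sF Up dp).1.
- by apply: derivable_big_sum => a _; exact: dvF.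
- have es := @expands_sum R I openI m _ (index_enum _) predT _ _ (fun a _ =>
    expandsM openI (eg' a) (ih _ (smooth_dpartial a sF) egw)).
  apply: (expands_eq openI es) => s Is.
    by apply: filterS (nd _ Is) => p [Up dp]; rewrite (curve _ _ _ sF Up dp).2.
  rewrite derive1_sum; last by move=> a _; exact: dvF.
  under [RHS]eq_bigr => a _ do
    rewrite (derive1M (dgv a _ Is) (cF a s Is).1) (cF a s Is).2 mulr_sumr.
  rewrite /= !big_split/=; congr (_ + _).
  under eq_bigr do rewrite mulr_sumr.
  rewrite exchange_big/=; apply: eq_bigr => a _; apply: eq_bigr => b _.
  by rewrite (dpartialC a b sF (Uj _ Is)) mulrCA.
Qed.

End Composition.
End Lagrangian.

(** * Integrals *)

Section Integrable.
Context d (T : measurableType d) (R : realType) (mu : {measure set T -> \bar R}).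
Variables (D : set T) (mD : measurable D).

Lemma integrable_EFinB (f g : T -> R) :
  mu.-integrable D (EFin \o f) -> mu.-integrable D (EFin \o g) ->
  mu.-integrable D (EFin \o (fun s => f s - g s)).
Proof.
move=> fi gi; have := integrableB mD fi gi.
by rewrite (_ : (_ \- _)%E = EFin \o (fun s => f s - g s)).
Qed.

Lemma integrable_EFinZ (c : R) (f : T -> R) :
  mu.-integrable D (EFin \o f) -> mu.-integrable D (EFin \o (fun s => c * f s)).
Proof.
move=> fi; have := integrableZl mD c fi.
by rewrite (_ : (fun _ => _)%E = EFin \o (fun s => c * f s)).
Qed.

End Integrable.

Section Integrals.
Variable R : realType.
Notation mu := (@lebesgue_measure R).

(** Tube lemma: the only place where local statements in [s] become uniform, by compactness of the
    segment. *)
Lemma near_uniform (P : R -> R -> Prop) (a b : R) :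
  (forall s, a <= s <= b -> \forall p \near (0 : R, s), P p.1 p.2) ->
  \forall e \near (0 : R), forall s, a <= s <= b -> P e s.
Proof.
move=> nP; have /compact_near_coveringP nc := @segment_compact R a b.
have : \forall e \near (0 : R), `[a, b] `<=` P e.
  refine (nc R (nbhs (0 : R)) P (nbhs_filter (0 : R)) _) => x.
  rewrite /= in_itv/= => /nP [[A B] /= [A0 Bx] AB].
  by exists (B, A) => // -[s e] [/= Bs Ae]; exact: (AB (e, s)).
by apply: filterS => e Pe s ab; apply: Pe; rewrite /= in_itv.
Qed.

Lemma integrable_continuous (f : R -> R) (a b : R) :
  (forall s, a <= s <= b -> {for s, continuous f}) ->
  mu.-integrable `[a, b] (EFin \o f).
Proof.
move=> cf; apply: continuous_compact_integrable; first exact: segment_compact.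
apply: continuous_in_subspaceT => x; rewrite inE/= in_itv/=; exact: cf.
Qed.

Lemma FTC2_point (f F : R -> R) (a b : R) : a < b ->
  (forall s, a <= s <= b -> {for s, continuous f}) ->
  (forall s, a <= s <= b -> is_derive s 1 F (f s)) ->
  (\int[mu]_(s in `[a, b]) f s = F b - F a)%R.
Proof.
move=> ab cf dF; rewrite /Rintegral (continuous_FTC2 (F := F) ab).
- by [].
- by apply: continuous_in_subspaceT => x; rewrite inE/= in_itv/=; exact: cf.
- have cF s : a <= s <= b -> {for s, continuous F}.
    by move=> /dF; exact: is_derive_continuous.
  split.
  + by move=> x; rewrite in_itv/= => /andP[? ?]; have [] := dF x; rewrite ?ltW.
  + by apply: cvg_at_right_filter; apply: cF; rewrite lexx ltW.
  + by apply: cvg_at_left_filter; apply: cF; rewrite lexx ltW.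
- move=> x; rewrite in_itv/= => /andP[? ?].
  by apply: is_derive_derive1; apply: dF; rewrite !ltW.
Qed.

(** The remainder [f e s - f 0 s - e * f1 s] equals [e * (q (e, s) - q (0, s))], which is uniformly
    [o(e)] on the segment. Order 1 of the expansion is requested because derivability of [f e] in
    [s] gives its continuity, hence its integrability, for small [e]. *)
Lemma is_derive_integral (I : set R) (f : R -> R -> R) (f1 : R -> R) (a b : R) :
  a < b -> `[a, b] `<=` I -> expands I 1 f f1 ->
  is_derive (0 : R) 1 (fun e => (\int[mu]_(s in `[a, b]) f e s)%R)
                      (\int[mu]_(s in `[a, b]) f1 s)%R.
Proof.
move=> ab abI ef.
have abI' s : a <= s <= b -> I s by move=> ?; apply: abI; rewrite /= in_itv.
have i1 : mu.-integrable `[a, b] (EFin \o f1).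
  by apply: integrable_continuous => s /abI' Is; exact: expandable_continuous1 (expands_expandable ef Is).
have i0 : mu.-integrable `[a, b] (EFin \o f 0).
  by apply: integrable_continuous => s /abI' Is; exact: expandable_continuous0 (expands_expandable ef Is).
have ie : \forall e \near (0 : R), mu.-integrable `[a, b] (EFin \o f e).
  have : \forall e \near (0 : R), forall s, a <= s <= b -> derivable (f e) s 1.
    by apply: near_uniform => s /abI' Is; case: ef => _ [+ _ _]; exact.
  apply: filterS => e de; apply: integrable_continuous => s /de.
  by move=> /derivable1_diffP/differentiable_continuous.
have cv : (fun h : R => h^-1 *: ((\int[mu]_(s in `[a, b]) f (h *: (1 : R) + 0) s)%R
      - (\int[mu]_(s in `[a, b]) f 0 s)%R)) @ 0^' --> (\int[mu]_(s in `[a, b]) f1 s)%R.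
  apply/cvgrPdist_le => eps eps0.
  (* A pointwise error [eta] integrates to [eps] over [[a, b]]. *)
  pose eta := eps / (b - a).
  have ba0 : 0 < b - a by rewrite subr_gt0.
  have eta0 : 0 < eta by rewrite divr_gt0.
  have un : \forall e \near (0 : R), forall s, a <= s <= b ->
      `|f e s - f 0 s - e * f1 s| <= eta * `|e|.
    apply: (near_uniform (P := fun e s => `|f e s - f 0 s - e * f1 s| <= eta * `|e|)).
    move=> s /abI' Is; have [q [_ qc fq qf]] := expands_expandable ef Is.
    have qf1 : \forall p \near (0 : R, s), q (0, p.2) = f1 p.2.
      exact: (near_snd (P := fun t => q (0, t) = f1 t)).
    (* [q] is continuous at [(0, s)] only, so nearby values are compared through [q (0, s)], at a
       cost of [eta / 2] each. *)
    have q0 : \forall p \near (0 : R, s), `|q p - q (0, p.2)| < eta.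
      have e20 : 0 < eta / 2 by rewrite divr_gt0.
      have qc0 := continuous_at_line qc.
      have q2 : \forall p \near (0 : R, s), `|q (0, s) - q (0, p.2)| < eta / 2.
        apply: (near_snd (P := fun t => `|q (0, s) - q (0, t)| < eta / 2)).
        exact: ((cvgrPdist_lt _ _).1 qc0 _ e20).
      apply: filterS2 ((cvgrPdist_lt _ _).1 qc _ e20) q2 => p h1 h2.
      rewrite -(subrKA (q (0, s))) (le_lt_trans (ler_normD _ _))//.
      by rewrite (splitr eta) ltrD// distrC.
    apply: filterS3 fq qf1 q0 => p Ep q1 h.
    rewrite Ep -q1 (_ : _ - _ = p.1 * (q p - q (0, p.2))); last by ring.
    by rewrite normrM mulrC ler_wpM2r// ltW.
  near=> h; have h0 : h != 0 by near: h; exact: nbhs_dnbhs_neq.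
  have ih : mu.-integrable `[a, b] (EFin \o f h).
    by near: h; exact: nbhs_dnbhs.
  have uh : forall s, a <= s <= b -> `|f h s - f 0 s - h * f1 s| <= eta * `|h|.
    by near: h; exact: nbhs_dnbhs.
  rewrite /GRing.scale/= mulr1 addr0.
  have i01 : mu.-integrable `[a, b] (EFin \o (fun s => f h s - f 0 s)).
    exact: integrable_EFinB.
  have ih1 : mu.-integrable `[a, b] (EFin \o (fun s => h * f1 s)).
    exact: integrable_EFinZ.
  rewrite -RintegralB// -[X in X - _](mulKf h0) -mulrBr normrM normfV.
  rewrite ler_pdivrMl ?normr_gt0// -RintegralZl// distrC -RintegralB//.
  apply: (le_trans (le_normr_Rintegral _ _)) => //; first exact: integrable_EFinB.
  apply: (@le_trans _ _ (\int[mu]_(s in `[a, b]) (eta * `|h|))%R).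
    apply: le_Rintegral => //.
    - exact/integrable_norm/integrable_EFinB.
    - by apply: integrable_continuous => s _; exact: cvg_cst.
  rewrite Rintegral_cst//= lebesgue_measure_itv/= lte_fin ab -EFinB/=.
  by rewrite /eta mulrAC divfK ?gt_eqF// mulrC.
apply: DeriveDef; first exact: cvgP cv.
exact: cvg_lim cv.
Unshelve. all: by end_near. Qed.

End Integrals.

(** * Smooth functions on an open set of the line *)

Section Smooth.
Variables (R : realType) (I : set R).
Hypothesis openI : open I.
Implicit Types f g : R -> R.

Lemma smooth_on_ext f g : (forall s, I s -> f s = g s) -> smooth_on I f ->
  smooth_on I g.
Proof.
move=> fg sf; apply/(smooth_onP openI) => m; exists (fun=> 0).
by apply: (expands_eq_on openI (expands_cst openI m sf)).
Qed.

Lemma smooth_onD f g : smooth_on I f -> smooth_on I g ->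
  smooth_on I (fun t => f t + g t).
Proof.
move=> sf sg; apply/(smooth_onP openI) => m; eexists.
exact: (expandsD openI (expands_cst openI m sf) (expands_cst openI m sg)).
Qed.

Lemma smooth_onM f g : smooth_on I f -> smooth_on I g ->
  smooth_on I (fun t => f t * g t).
Proof.
move=> sf sg; apply/(smooth_onP openI) => m; eexists.
exact: (expandsM openI (expands_cst openI m sf) (expands_cst openI m sg)).
Qed.

Lemma smooth_onN f : smooth_on I f -> smooth_on I (fun t => - f t).
Proof.
move=> sf; apply/(smooth_onP openI) => m; eexists.
exact: (expandsN openI (expands_cst openI m sf)).
Qed.

Lemma smooth_onB f g : smooth_on I f -> smooth_on I g ->
  smooth_on I (fun t => f t - g t).
Proof. by move=> sf sg; exact: (smooth_onD sf (smooth_onN sg)). Qed.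

Lemma smooth_onV f : smooth_on I f -> (forall s, I s -> f s != 0) ->
  smooth_on I (fun t => (f t)^-1).
Proof.
move=> sf f0; apply/(smooth_onP openI) => m; eexists.
exact: (expandsV openI (expands_cst openI m sf)).
Qed.

Lemma smooth_on_sum (T : Type) (r : seq T) (P : pred T) (F : T -> R -> R) :
  (forall i, P i -> smooth_on I (F i)) ->
  smooth_on I (fun t => \sum_(i <- r | P i) F i t).
Proof.
move=> sF; apply/(smooth_onP openI) => m; eexists.
by apply: (expands_sum openI) => i Pi; exact: (expands_cst openI m (sF _ Pi)).
Qed.

Lemma smooth_on_Ds f k : smooth_on I f -> smooth_on I (Ds k f).
Proof.
by move=> sf j s Is; rewrite /derive1n -iterD; exact: sf.
Qed.

Lemma smooth_on_derive1 f : smooth_on I f -> smooth_on I (derive1 f).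
Proof. exact: (@smooth_on_Ds f 1). Qed.

Lemma smooth_on_derivable f s : smooth_on I f -> I s -> derivable f s 1.
Proof. by move=> sf; exact: (sf 0%N). Qed.

Lemma smooth_on_continuous f s : smooth_on I f -> I s -> {for s, continuous f}.
Proof.
by move=> sf Is; apply/differentiable_continuous/derivable1_diffP; exact: smooth_on_derivable.
Qed.

Lemma Ds_eq_on (J : set R) f g k : open J -> (forall s, J s -> f s = g s) ->
  forall s, J s -> Ds k f s = Ds k g s.
Proof.
move=> oJ; elim: k f g => [|k ih] f g fg s Js; first exact: fg.
rewrite !derive1Sn; apply: ih => // t Jt; apply: near_derive1_eq.
by apply: filterS (open_nbhs_nbhs (conj oJ Jt)).
Qed.

End Smooth.

(** * Bump functions *)

Section Bump.
Variable R : realType.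

(* The functions [u^-k exp (- 1 / u)] extended by [0]: the span of the family is
   closed under derivation. *)
Definition exp_flat (k : nat) (u : R) : R :=
  if 0 < u then (u^-1) ^+ k * expR (- u^-1) else 0.

Lemma exp_flat_ge0 k u : 0 <= exp_flat k u.
Proof.
rewrite /exp_flat; case: ifP => // u0.
by rewrite mulr_ge0 ?expR_ge0// exprn_ge0// invr_ge0 ltW.
Qed.

(** With [x = u^-1], a single term of the exponential series suffices: [expR x] dominates
    [x ^+ k.+1] divided by the factorial of [k.+1]. *)
Lemma exp_flat_le (k : nat) (u : R) : 0 < u -> exp_flat k u <= (k.+1)`!%:R * u.
Proof.
move=> u0; rewrite /exp_flat u0 expRN; set x := u^-1.
have x0 : 0 < x by rewrite invr_gt0.
have -> : u = x^-1 by rewrite invrK.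
have := expR_ge1Dxn k (ltW x0).
have f0 : 0 < (k.+1)`!%:R :> R by rewrite ltr0n fact_gt0.
move: ((k.+1)`!%:R : R) f0 => F F0 h.
rewrite ler_pdivrMr ?expR_gt0// mulrAC ler_pdivlMr// -exprSr.
rewrite mulrC -ler_pdivrMr//; apply: le_trans h.
by rewrite lerDr.
Qed.

Lemma is_derive_exp_flat (k : nat) (u : R) :
  is_derive u 1 (exp_flat k) (exp_flat k.+2 u - k%:R * exp_flat k.+1 u).
Proof.
have [u0|u0|->] := ltgtP u 0.
- have E t : t < 0 -> forall j, exp_flat j t = 0 by move=> t0 j; rewrite /exp_flat ltNge (ltW t0).
  rewrite !E// mulr0 subr0.
  apply: (@near_eq_is_derive _ _ _ (fun=> 0 : R)).
  by near=> t; rewrite E//; near: t; exact: lt_nbhsl.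
- pose f (t : R) := (t^-1) ^+ k * expR (- t^-1).
  apply: (@near_eq_is_derive _ _ _ f).
    near=> t; have t0 : 0 < t by near: t; exact: lt_nbhsr.
    by rewrite /exp_flat t0.
  have un0 : u != 0 by rewrite gt_eqF.
  have dV : is_derive u 1 (fun t : R => t^-1) (- u ^- 2 *: 1).
    exact: (is_deriveV un0 (is_derive_id u 1)).
  have dX := is_deriveX k dV.
  have dE : is_derive u 1 (fun t => expR (- t^-1)) (expR (- u^-1) * - (- u ^- 2 *: 1)).
    exact: (is_derive1_comp (is_derive_expR _) (is_deriveN dV)).
  have fE : f = (fun t : R => t^-1) ^+ k * (fun t => expR (- t^-1)).
    by apply/funext => t; rewrite /f [RHS]/GRing.mul/= exprfctE.
  rewrite fE; apply: (is_derive_eq (is_deriveM dX dE)).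
  rewrite /exp_flat u0 /GRing.scale/= mulr1 /cst.
  rewrite exprfctE exprVn -!exprVn; move: (u^-1) (expR _) => y z.
  case: k {f dX fE} => [|k]; first by ring.
  by rewrite /= !exprS; move: (y ^+ k) (k.+1%:R : R) => w c; ring.
- have E0 j : exp_flat j 0 = 0 by rewrite /exp_flat ltxx.
  rewrite !E0 mulr0 subr0.
  have cv : (fun h : R => h^-1 *: (exp_flat k (h *: (1 : R) + 0) - exp_flat k 0)) @ 0^' --> (0 : R).
    (* Dividing by [h] raises the index by one, so the difference quotient at 0 is [exp_flat k.+1 h]
       for [h > 0]; [C] is the constant of [exp_flat_le] at that index. *)
    apply/cvgrPdist_le => e e0; pose C : R := (k.+2)`!%:R.
    have C0 : 0 < C by rewrite ltr0n fact_gt0.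
    near=> h; have h0 : h != 0 by near: h; exact: nbhs_dnbhs_neq.
    have hC : `|h| <= e / C.
      by near: h; apply: dnbhs0_le; rewrite divr_gt0.
    rewrite /GRing.scale/= mulr1 addr0 E0 subr0 sub0r normrN.
    have [hp|hp] := ltP 0 h; last by rewrite /exp_flat ltNge hp/= mulr0 normr0 ltW.
    rewrite ger0_norm; last by rewrite mulr_ge0 ?exp_flat_ge0// invr_ge0 ltW.
    have -> : h^-1 * exp_flat k h = exp_flat k.+1 h by rewrite /exp_flat hp exprS mulrA.
    rewrite (le_trans (exp_flat_le _ hp))// -ler_pdivlMl// mulrC.
    by rewrite -[h]gtr0_norm.
  apply: DeriveDef; first exact: cvgP cv.
  exact: cvg_lim cv.
Unshelve. all: by end_near. Qed.

(** Derivation raises the index, so the induction on the order treats all [k] at once. *)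
Lemma smooth_exp_flat (c d : R) k : smooth_on setT (fun t => exp_flat k (c * t + d)).
Proof.
apply/(smooth_onP openT) => m; exists (fun=> 0).
have dl (t : R) : is_derive t 1 (fun t : R => c * t + d) c.
  have := is_deriveD (is_deriveZ c (is_derive_id t (1 : R))) (is_derive_cst d t 1).
  by rewrite addr0 /GRing.scale/= mulr1.
have df (j : nat) (t : R) : is_derive t 1 (fun t => exp_flat j (c * t + d))
    ((exp_flat j.+2 (c * t + d) - j%:R * exp_flat j.+1 (c * t + d)) * c).
  exact: (@is_derive1_comp R (exp_flat j) (fun t => c * t + d) t _ _ (is_derive_exp_flat j (c * t + d)) (dl t)).
elim: m k => [|m ih] k.
  by split=> // s _; apply: expandable_cst; exact: is_derive_continuous (df k s).
apply: (expands_cstS openT) => [s _|]; first by case: (df k s).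
have := expandsZ openT c (expandsB openT (ih k.+2) (expandsZ openT k%:R (ih k.+1))).
move/(expands_eq_on openT); apply => [_ s _|s _].
  by rewrite (is_derive_derive1 (df k s)) mulrC.
by rewrite mulr0 subr0 mulr0.
Qed.

Lemma exp_flat_gt0 k u : 0 < u -> 0 < exp_flat k u.
Proof.
by move=> u0; rewrite /exp_flat u0 mulr_gt0 ?expR_gt0// exprn_gt0// invr_gt0.
Qed.

Lemma exp_flat_le0 k u : u <= 0 -> exp_flat k u = 0.
Proof. by move=> u0; rewrite /exp_flat ltNge u0. Qed.

(** The arguments [t - a] and [b - t] are spelled with coefficients 1 and -1 so that both factors
    are literally instances of [smooth_exp_flat]. *)
Definition bump_fun (a b t : R) : R := exp_flat 0 (1 * t + - a) * exp_flat 0 (-1 * t + b).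

Lemma smooth_bump_fun a b : smooth_on setT (bump_fun a b).
Proof.
have h := smooth_onM openT (@smooth_exp_flat 1 (- a) 0%N) (@smooth_exp_flat (-1) b 0%N).
exact: h.
Qed.

Lemma bump_fun_ge0 a b t : 0 <= bump_fun a b t.
Proof. by rewrite mulr_ge0 ?exp_flat_ge0. Qed.

Lemma bump_fun_gt0 a b t : a < t < b -> 0 < bump_fun a b t.
Proof.
move=> /andP[at' tb]; rewrite mulr_gt0// exp_flat_gt0//; last by rewrite mulN1r addrC subr_gt0.
by rewrite mul1r subr_gt0.
Qed.

Lemma bump_fun_out a b t : ~~ (a <= t <= b) -> bump_fun a b t = 0.
Proof.
rewrite negb_and -!ltNge /bump_fun mul1r mulN1r => /orP[ta|bt].
  by rewrite exp_flat_le0 ?mul0r// subr_le0 ltW.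
by rewrite [X in _ * X]exp_flat_le0 ?mulr0// addrC subr_le0 ltW.
Qed.

End Bump.

(** By continuity [f] exceeds [f s / 2] on a segment around [s], and nonnegativity allows the
    integral to be bounded below by that over this segment. *)
Lemma Rintegral_gt0 (R : realType) (f : R -> R) (a b s : R) : a < s < b ->
  (forall t, a <= t <= b -> {for t, continuous f}) ->
  (forall t, a <= t <= b -> 0 <= f t) -> 0 < f s ->
  0 < \int[@lebesgue_measure R]_(t in `[a, b]) f t.
Proof.
move=> /andP[as' sb] cf f0 fs; have s_ab : a <= s <= b by rewrite !ltW.
have : \forall t \near s, [/\ f s / 2 < f t, a < t & t < b].
  have h : \forall t \near s, f s / 2 < f t.
    apply: (cf _ s_ab [set y | f s / 2 < y]); apply: lt_nbhsr.
    by rewrite ltr_pdivrMr// ltr_pMr// ltr1n.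
  by apply: filterS3 h (lt_nbhsr as') (lt_nbhsl sb) => t h1 h2 h3; exact: And3 h1 h2 h3.
move=> /nbhs_ballP[r /= r0 rP].
(* Half the radius keeps the closed segment inside the open ball. *)
pose c := s - r / 2; pose d := s + r / 2.
have cd : c < d by rewrite /c /d; lra.
have cdP t : c <= t <= d -> [/\ f s / 2 < f t, a < t & t < b].
  move=> /andP[ct td]; apply: rP; rewrite -ball_normE/=.
  by rewrite ltr_norml; apply/andP; split; move: ct td; rewrite /c /d; lra.
have cdab t : c <= t <= d -> a <= t <= b by move=> /cdP[_ ? ?]; rewrite !ltW.
have ifab := integrable_continuous cf.
have ifcd : (@lebesgue_measure R).-integrable `[c, d] (EFin \o f).
  by apply: integrable_continuous => t /cdab; exact: cf.
apply: (@lt_le_trans _ _ (\int[@lebesgue_measure R]_(t in `[c, d]) (f s / 2))).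
  rewrite Rintegral_cst//= lebesgue_measure_itv/= lte_fin cd -EFinB/=.
  by rewrite mulr_gt0 ?subr_gt0// divr_gt0.
apply: (@le_trans _ _ (\int[@lebesgue_measure R]_(t in `[c, d]) f t)).
  apply: le_Rintegral => //.
    by apply: integrable_continuous => t _; exact: cvg_cst.
  by move=> t; rewrite /= in_itv/= => /cdP[/ltW].
rewrite /Rintegral fine_le//; [exact: integrable_fin_num|exact: integrable_fin_num|].
apply: ge0_subset_integral => //.
- exact: (measurable_int _ ifab).
Qed.

(** * Vectors of dimension three *)

Section Vectors.
Variable R : realType.
Implicit Types (u v w : 'cV[R]_3) (a b c k : R).

Lemma ord3P (i : 'I_3) : [\/ i = inord 0, i = inord 1 | i = inord 2].
Proof.
by case: i => [[|[|[|//]]] ?]; [apply: Or31|apply: Or32|apply: Or33];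
  apply/val_inj; rewrite /= inordK.
Qed.

Lemma cxV a b c : cx (vec3 a b c) = a. Proof. by rewrite /cx mxE inordK. Qed.
Lemma cyV a b c : cy (vec3 a b c) = b. Proof. by rewrite /cy mxE inordK. Qed.
Lemma czV a b c : cz (vec3 a b c) = c. Proof. by rewrite /cz mxE inordK. Qed.
Lemma cxD u v : cx (u + v) = cx u + cx v. Proof. exact: mxE. Qed.
Lemma cyD u v : cy (u + v) = cy u + cy v. Proof. exact: mxE. Qed.
Lemma czD u v : cz (u + v) = cz u + cz v. Proof. exact: mxE. Qed.
Lemma cxN u : cx (- u) = - cx u. Proof. exact: mxE. Qed.
Lemma cyN u : cy (- u) = - cy u. Proof. exact: mxE. Qed.
Lemma czN u : cz (- u) = - cz u. Proof. exact: mxE. Qed.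
Lemma cxZ k u : cx (k *: u) = k * cx u. Proof. exact: mxE. Qed.
Lemma cyZ k u : cy (k *: u) = k * cy u. Proof. exact: mxE. Qed.
Lemma czZ k u : cz (k *: u) = k * cz u. Proof. exact: mxE. Qed.

Definition coordE := (cxV, cyV, czV, cxD, cyD, czD, cxN, cyN, czN, cxZ, cyZ, czZ).

Lemma vec_eq u v : cx u = cx v -> cy u = cy v -> cz u = cz v -> u = v.
Proof.
move=> x y z; apply/matrixP => i j; rewrite [j]ord1.
by case: (ord3P i) => ->.
Qed.

Lemma dotE u v : dot u v = cx u * cx v + cy u * cy v + cz u * cz v.
Proof.
rewrite /dot !big_ord_recl big_ord0 addr0 addrA /cx /cy /cz.
by congr (_ * _ + _ * _ + _ * _); congr (_ _ 0); apply/val_inj; rewrite /= inordK.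
Qed.

Lemma dotC u v : dot u v = dot v u.
Proof. by rewrite !dotE; ring. Qed.

Lemma dotDl u v w : dot (u + v) w = dot u w + dot v w.
Proof. by rewrite !dotE !coordE; ring. Qed.

Lemma dotDr u v w : dot w (u + v) = dot w u + dot w v.
Proof. by rewrite !dotE !coordE; ring. Qed.

Lemma dotZl k u v : dot (k *: u) v = k * dot u v.
Proof. by rewrite !dotE !coordE; ring. Qed.

Lemma dotZr k u v : dot u (k *: v) = k * dot u v.
Proof. by rewrite !dotE !coordE; ring. Qed.

Lemma dotNr u v : dot u (- v) = - dot u v.
Proof. by rewrite !dotE !coordE; ring. Qed.

Lemma dotxx_ge0 u : 0 <= dot u u.
Proof. by rewrite dotE !addr_ge0// -expr2 sqr_ge0. Qed.

Lemma crossZr k u v : cross u (k *: v) = k *: cross u v.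
Proof. by apply: vec_eq; rewrite !coordE; ring. Qed.

Lemma dot_cross_cross u v w (z : 'cV[R]_3) :
  dot (cross u v) (cross w z) = dot u w * dot v z - dot u z * dot v w.
Proof. by rewrite !dotE !coordE; ring. Qed.

Lemma dot_cross_l u v : dot u (cross u v) = 0.
Proof. by rewrite !dotE !coordE; ring. Qed.

Lemma dot_cross_r u v : dot u (cross v u) = 0.
Proof. by rewrite !dotE !coordE; ring. Qed.

Lemma dot_crossC u v w : dot u (cross v w) = - dot v (cross u w).
Proof. by rewrite !dotE !coordE; ring. Qed.

Lemma dot_cross_rot u v w : dot u (cross v w) = dot v (cross w u).
Proof. by rewrite !dotE !coordE; ring. Qed.

Lemma cross_crossr u v w : cross u (cross v w) = dot u w *: v - dot u v *: w.
Proof. by apply: vec_eq; rewrite !dotE !coordE; ring. Qed.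

(** The coordinates of [w] in the basis [u], [v], [c], cleared of denominators: the coefficients of
    [u] and [v] come from the adjugate of their Gram matrix, whose determinant is [dot c c]. *)
Lemma cross_frame_expansion u v w : let c := cross u v in
  dot c c *: w = dot w c *: c
    + (dot v v * dot w u - dot v u * dot w v) *: u
    + (dot u u * dot w v - dot u v * dot w u) *: v.
Proof. by apply: vec_eq; rewrite !dotE !coordE; ring. Qed.

(** Entrywise, so that the Leibniz rules for the dot and cross products reduce to scalar ones. *)
Definition vec_is_derive (u : R -> 'cV[R]_3) (s : R) (u' : 'cV[R]_3) : Prop :=
  forall i, is_derive s 1 (fun t => u t i 0) (u' i 0).

Lemma is_derive_dot (u w : R -> 'cV[R]_3) s u' w' : vec_is_derive u s u' -> vec_is_derive w s w' ->
  is_derive s 1 (fun t => dot (u t) (w t)) (dot u' (w s) + dot (u s) w').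
Proof.
move=> du dw; rewrite (_ : (fun t => _) =
  (fun t => \sum_(i < 3) u t i 0 * w t i 0)); last by [].
have dM i : is_derive s 1 (fun t => u t i 0 * w t i 0)
    (u' i 0 * w s i 0 + u s i 0 * w' i 0).
  by apply: is_derive_eq (is_deriveM (du i) (dw i)) _; rewrite /GRing.scale/=; ring.
apply: DeriveDef.
  by apply: derivable_big_sum => i _; case: (dM i).
rewrite -derive1E derive1_sum; last by move=> i _; case: (dM i).
by rewrite -big_split; apply: eq_bigr => i _; exact: is_derive_derive1.
Qed.

Lemma vec_is_derive_scale (f : R -> R) (u : R -> 'cV[R]_3) (s f' : R) u' :
  is_derive s 1 f f' -> vec_is_derive u s u' ->
  vec_is_derive (fun t => f t *: u t) s (f' *: u s + f s *: u').
Proof.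
move=> df du i; rewrite !mxE.
rewrite (_ : (fun t => _) = (fun t => f t * u t i 0)); last first.
  by apply/funext => t; rewrite mxE.
by apply: is_derive_eq (is_deriveM df (du i)) _; rewrite /GRing.scale/=; ring.
Qed.

Lemma vec_is_derive_add (u w : R -> 'cV[R]_3) s u' w' :
  vec_is_derive u s u' -> vec_is_derive w s w' -> vec_is_derive (fun t => u t + w t) s (u' + w').
Proof.
move=> du dw i; rewrite !mxE.
rewrite (_ : (fun t => _) = (fun t => u t i 0 + w t i 0)); last first.
  by apply/funext => t; rewrite mxE.
exact: is_deriveD.
Qed.

Lemma vec_is_derive_cross (u w : R -> 'cV[R]_3) s u' w' : vec_is_derive u s u' -> vec_is_derive w s w' ->
  vec_is_derive (fun t => cross (u t) (w t)) s (cross u' (w s) + cross (u s) w').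
Proof.
move=> du dw i.
have dM (j k : 'I_3) : is_derive s 1 (fun t => u t j 0 * w t k 0)
    (u' j 0 * w s k 0 + u s j 0 * w' k 0).
  by apply: is_derive_eq (is_deriveM (du j) (dw k)) _; rewrite /GRing.scale/=; ring.
have dB (j k j' k' : 'I_3) : is_derive s 1 (fun t => u t j 0 * w t k 0 - u t j' 0 * w t k' 0)
   (u' j 0 * w s k 0 - u' j' 0 * w s k' 0 + (u s j 0 * w' k 0 - u s j' 0 * w' k' 0)).
  by apply: is_derive_eq (is_deriveB (dM j k) (dM j' k')) _; ring.
case: (ord3P i) => ->.
- rewrite [X in is_derive _ _ _ X]mxE -!/(cx _) !coordE.
  by under eq_fun do rewrite -/(cx _) cxV; exact: dB.
- rewrite [X in is_derive _ _ _ X]mxE -!/(cy _) !coordE.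
  by under eq_fun do rewrite -/(cy _) cyV; exact: dB.
- rewrite [X in is_derive _ _ _ X]mxE -!/(cz _) !coordE.
  by under eq_fun do rewrite -/(cz _) czV; exact: dB.
Qed.

Lemma vec_is_derive_eq (u : R -> 'cV[R]_3) s u' w' : vec_is_derive u s u' -> u' = w' -> vec_is_derive u s w'.
Proof. by move=> du <-. Qed.

End Vectors.

(** * Smooth curves in space and expansions of vector-valued families *)

Section VectorSmooth.
Variables (R : realType) (I : set R).
Hypothesis openI : open I.
Implicit Types (x v : R -> 'cV[R]_3).

Lemma derivable_coord x s :
  derivable x s 1 <-> forall i, derivable (fun t => x t i 0) s 1.
Proof.
split=> [/derivable_mxP dx i|dx]; first exact: dx.
by apply/derivable_mxP => i j; rewrite [j]ord1; exact: dx.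
Qed.

Lemma derive1_coord x s i : derivable x s 1 ->
  derive1 x s i 0 = derive1 (fun t => x t i 0) s.
Proof. by move=> dx; rewrite !derive1E derive_mx// mxE. Qed.

Lemma Ds_coord_near x k : (forall s, I s -> derivable (Ds k x) s 1) ->
  (forall s, I s -> forall i, Ds k x s i 0 = Ds k (fun t => x t i 0) s) ->
  forall s, I s -> forall i, Ds k.+1 x s i 0 = Ds k.+1 (fun t => x t i 0) s.
Proof.
move=> dx xE s Is i; rewrite /= derive1_coord; last exact: dx.
by apply: near_derive1_eq; apply: filterS (near_open openI Is) => t It; exact: xE.
Qed.

Lemma Ds_coord x k s i : smooth_on I x -> I s ->
  Ds k x s i 0 = Ds k (fun t => x t i 0) s.
Proof.
move=> sx; elim: k s i => [//|k ih] s i Is.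
apply: Ds_coord_near => // [t It|t It j]; [exact: sx|exact: ih].
Qed.

Lemma smooth_coord x i : smooth_on I x -> smooth_on I (fun t => x t i 0).
Proof.
move=> sx k s Is; have := (derivable_coord (Ds k x) s).1 (sx k s Is) i.
apply: near_eq_derivable; apply: filterS (near_open openI Is) => t It.
exact: Ds_coord.
Qed.

(** Derivability of [Ds k x] is read off its entries once these are known to be the derivatives of
    the entries of [x]; that knowledge at the next order needs derivability at order [k], so the two
    facts are obtained alternately. *)
Lemma smooth_vec x : (forall i, smooth_on I (fun t => x t i 0)) -> smooth_on I x.
Proof.
move=> sx; have step k : (forall s, I s -> forall i, Ds k x s i 0 = Ds k (fun t => x t i 0) s) ->
    forall s, I s -> derivable (Ds k x) s 1.
  move=> E s Is; apply/derivable_coord => i.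
  apply: near_eq_derivable (sx i k s Is).
  by apply: filterS (near_open openI Is) => t It; rewrite E.
have E k : forall s, I s -> forall i, Ds k x s i 0 = Ds k (fun t => x t i 0) s.
  elim: k => [|k ih] s Is i; first by [].
  exact: (Ds_coord_near (step _ ih) ih).
move=> k s Is; exact: (step k (E k)).
Qed.

Lemma vec_is_derive_Ds x k s : smooth_on I x -> I s -> vec_is_derive (Ds k x) s (Ds k.+1 x s).
Proof.
move=> sx Is i; have dx := sx k s Is.
rewrite /= derive1_coord//; apply: derivable_is_derive.
exact: ((derivable_coord _ _).1 dx).
Qed.

Lemma smooth_dot x v : smooth_on I x -> smooth_on I v ->
  smooth_on I (fun t => dot (x t) (v t)).
Proof.
move=> sx sv; apply: smooth_on_sum => // i _.
have h := smooth_onM openI (@smooth_coord _ i sx) (@smooth_coord _ i sv).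
exact: h.
Qed.

Lemma smooth_scale (f : R -> R) x : smooth_on I f -> smooth_on I x ->
  smooth_on I (fun t => f t *: x t).
Proof.
move=> sf sx; apply: smooth_vec => i.
apply: (smooth_on_ext openI (f := fun t => f t * x t i 0)) => [s _|].
  by rewrite mxE.
have h := smooth_onM openI sf (@smooth_coord _ i sx).
exact: h.
Qed.

Lemma smooth_add x v : smooth_on I x -> smooth_on I v ->
  smooth_on I (fun t => x t + v t).
Proof.
move=> sx sv; apply: smooth_vec => i.
apply: (smooth_on_ext openI (f := fun t => x t i 0 + v t i 0)) => [s _|].
  by rewrite mxE.
have h := smooth_onD openI (@smooth_coord _ i sx) (@smooth_coord _ i sv).
exact: h.
Qed.

Lemma smooth_cross x v : smooth_on I x -> smooth_on I v ->
  smooth_on I (fun t => cross (x t) (v t)).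
Proof.
move=> sx sv; apply: smooth_vec => i.
have sM j k j' k' : smooth_on I (fun t => x t j 0 * v t k 0 - x t j' 0 * v t k' 0).
  have h := smooth_onB openI
    (smooth_onM openI (@smooth_coord _ j sx) (@smooth_coord _ k sv))
    (smooth_onM openI (@smooth_coord _ j' sx) (@smooth_coord _ k' sv)).
exact: h.
case: (ord3P i) => ->.
- by apply: (smooth_on_ext openI _ (sM _ _ _ _)) => s _; rewrite -[RHS]/(cx _) cxV.
- by apply: (smooth_on_ext openI _ (sM _ _ _ _)) => s _; rewrite -[RHS]/(cy _) cyV.
- by apply: (smooth_on_ext openI _ (sM _ _ _ _)) => s _; rewrite -[RHS]/(cz _) czV.
Qed.

Lemma smooth_vec_Ds x k : smooth_on I x -> smooth_on I (Ds k x).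
Proof. by move=> sx j s Is; rewrite /derive1n -iterD; exact: sx. Qed.

Definition vec_expands m (u : R -> R -> 'cV[R]_3) (u1 : R -> 'cV[R]_3) :=
  forall i, expands I m (fun e t => u e t i 0) (fun t => u1 t i 0).

Lemma vec_expands_dot m u u1 w w1 : vec_expands m u u1 -> vec_expands m w w1 ->
  expands I m (fun e t => dot (u e t) (w e t))
    (fun t => dot (u1 t) (w 0 t) + dot (u 0 t) (w1 t)).
Proof.
move=> eu ew.
have := @expands_sum R I openI m _ (index_enum 'I_3) predT _ _
   (fun i _ => expandsM openI (eu i) (ew i)).
by move/(expands_eq_on openI); apply=> // s _; rewrite big_split.
Qed.

Lemma vec_expands_cross m u u1 w w1 : vec_expands m u u1 -> vec_expands m w w1 ->
  vec_expands m (fun e t => cross (u e t) (w e t))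
    (fun t => cross (u1 t) (w 0 t) + cross (u 0 t) (w1 t)).
Proof.
move=> eu ew i.
have eB j k j' k' := expandsB openI (expandsM openI (eu j) (ew k))
   (expandsM openI (eu j') (ew k')).
case: (ord3P i) => ->.
- apply: (expands_eq_on openI (eB _ _ _ _)) => [e s _|s _].
    by rewrite -[RHS]/(cx _) cxV.
  by rewrite -[RHS]/(cx _) !coordE /cx /cy /cz; ring.
- apply: (expands_eq_on openI (eB _ _ _ _)) => [e s _|s _].
    by rewrite -[RHS]/(cy _) cyV.
  by rewrite -[RHS]/(cy _) !coordE /cx /cy /cz; ring.
- apply: (expands_eq_on openI (eB _ _ _ _)) => [e s _|s _].
    by rewrite -[RHS]/(cz _) czV.
  by rewrite -[RHS]/(cz _) !coordE /cx /cy /cz; ring.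
Qed.

(** The parameter itself as a family constant in [s]: with products and sums it makes [x + e *: v]
    and its derivatives expandable. *)
Lemma expands_parameter m : expands I m (fun e => fun=> e) (fun=> 1).
Proof.
have U s : expandable (fun e : R => fun=> e) (fun=> 1) s.
  exists (fun=> 1); split; [exact: cvg_cst|exact: cvg_cst| |].
  - by near=> p; rewrite mulr1 add0r.
  - by near=> p.
case: m => [|m]; split=> //.
split=> [s Is|s Is|]; first by near=> p; exact: derivable_cst.
  exact: derivable_cst.
by apply: (expands_eq_on openI (expands_cst openI m (smooth_cst I 0)));
   move=> *; rewrite derive1_cst.
Unshelve. all: by end_near. Qed.

Lemma Ds_affine (f g : R -> R) (e : R) k s : smooth_on I f -> smooth_on I g -> I s ->
  Ds k (fun t => f t + e * g t) s = Ds k f s + e * Ds k g s.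
Proof.
move=> sf sg; elim: k s => [//|k ih] s Is /=.
have -> : derive1 (Ds k (fun t => f t + e * g t)) s =
    derive1 (fun t => Ds k f t + e * Ds k g t) s.
  by apply: near_derive1_eq; apply: filterS (near_open openI Is) => t It; exact: ih.
have df := sf k s Is; have dg := sg k s Is.
have deg : derivable (fun t => e * Ds k g t) s 1.
  exact: (derivableM (derivable_cst e s 1) dg).
by rewrite (derive1D df deg) (derive1Z e dg).
Qed.

Section Variation.
Variables (x v : R -> 'cV[R]_3).
Hypotheses (sx : smooth_on I x) (sv : smooth_on I v).

Lemma smooth_variation e : smooth_on I (fun s => x s + e *: v s).
Proof.
have h := smooth_add sx (smooth_scale (smooth_cst I e) sv).
exact: h.
Qed.

Lemma vec_expands_Ds m k : vec_expands m (fun e => Ds k (fun s => x s + e *: v s)) (Ds k v).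
Proof.
move=> i; have sxk := @smooth_on_Ds _ _ _ k (@smooth_coord _ i sx).
have svk := @smooth_on_Ds _ _ _ k (@smooth_coord _ i sv).
have := expandsD openI (expands_cst openI m sxk)
   (expandsM openI (expands_parameter m) (expands_cst openI m svk)).
move/(expands_eq_on openI); apply=> [e s Is|s Is]; last first.
  by rewrite Ds_coord//; ring.
have E1 := Ds_coord k i (@smooth_variation e) Is.
have E2 := Ds_affine e k (@smooth_coord _ i sx) (@smooth_coord _ i sv) Is.
transitivity (Ds k (fun t => x t i 0 + e * v t i 0) s); first exact: esym E2.
by apply: (etrans _ (esym E1)); congr (Ds k _ s); apply/funext => t; rewrite !mxE.
Qed.

Lemma variation0 : (fun s => x s + 0 *: v s) = x.
Proof. by apply/funext => s; rewrite scale0r addr0. Qed.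

End Variation.

End VectorSmooth.

(** * Variation of curvature and torsion *)

Section FrameVariation.
Variables (R : realType) (I : set R).
Hypothesis openI : open I.
Variables (Y1 Y2 Y3 : R -> R -> 'cV[R]_3) (V1 V2 V3 : R -> 'cV[R]_3).
Variables (k : R -> R) (m : nat).
Hypotheses (eY1 : vec_expands I m Y1 V1) (eY2 : vec_expands I m Y2 V2) (eY3 : vec_expands I m Y3 V3).
Hypotheses (k_gt0 : forall s, I s -> 0 < k s)
  (Y11 : forall s, I s -> dot (Y1 0 s) (Y1 0 s) = 1)
  (Y12 : forall s, I s -> dot (Y1 0 s) (Y2 0 s) = 0)
  (Y22 : forall s, I s -> dot (Y2 0 s) (Y2 0 s) = k s ^+ 2).

Let c e s := cross (Y1 e s) (Y2 e s).
Let dc s := cross (V1 s) (Y2 0 s) + cross (Y1 0 s) (V2 s).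

Let norm1 s : I s -> Num.sqrt (dot (Y1 0 s) (Y1 0 s)) = 1.
Proof. by move=> Is; rewrite Y11// sqrtr1. Qed.

Let cc s : I s -> dot (c 0 s) (c 0 s) = k s ^+ 2.
Proof.
by move=> Is; rewrite dot_cross_cross Y11// Y12// Y22// mul1r mul0r subr0.
Qed.

Let normc s : I s -> Num.sqrt (dot (c 0 s) (c 0 s)) = k s.
Proof. by move=> Is; rewrite cc// sqrtr_sqr gtr0_norm// k_gt0. Qed.

Let ec : vec_expands I m c dc.
Proof. exact: (vec_expands_cross openI eY1 eY2). Qed.

Let eN : expands I m (fun e t => dot (Y1 e t) (Y1 e t))
  (fun s => 2 * dot (V1 s) (Y1 0 s)).
Proof.
have h := vec_expands_dot openI eY1 eY1.
apply: (expands_eq_on openI h) => // s Is.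
by rewrite [dot (Y1 0 s) _]dotC mulr_natl mulr2n.
Qed.

Let cdc s : I s ->
  dot (c 0 s) (dc s) = k s ^+ 2 * dot (V1 s) (Y1 0 s) + dot (V2 s) (Y2 0 s).
Proof.
move=> Is; rewrite dotDr !dot_cross_cross Y11// Y22// (dotC (Y2 0 s) (Y1 0 s)) Y12//.
by rewrite [dot (Y1 0 s) (V1 s)]dotC [dot (Y2 0 s) (V2 s)]dotC; ring.
Qed.

Let eC : expands I m (fun e t => dot (c e t) (c e t))
  (fun s => 2 * (k s ^+ 2 * dot (V1 s) (Y1 0 s) + dot (V2 s) (Y2 0 s))).
Proof.
have h := vec_expands_dot openI ec ec.
apply: (expands_eq_on openI h) => // s Is.
by rewrite [dot (dc s) _]dotC cdc// mulr_natl mulr2n.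
Qed.

Lemma expands_speed :
  expands I m (fun e t => enorm (Y1 e t)) (fun s => dot (V1 s) (Y1 0 s)).
Proof.
have p s : I s -> 0 < dot (Y1 0 s) (Y1 0 s) by move=> Is; rewrite Y11.
have h := expands_sqrt openI eN p.
apply: (expands_eq_on openI h) => // s Is.
rewrite norm1// mulr1 mulrAC divff ?mul1r//.
Qed.

(** At unit speed the norm of the cross product is [k]; its first variation is
    [k * dot V1 Y1 + k^-1 * dot V2 Y2], and the inverse cube of the speed contributes
    [- 3 * k * dot V1 Y1]. Hence the coefficient 2. *)
Lemma expands_curvature :
  expands I m (fun e t => enorm (cross (Y1 e t) (Y2 e t)) / enorm (Y1 e t) ^+ 3)
    (fun s => (k s)^-1 * dot (V2 s) (Y2 0 s) - 2 * k s * dot (V1 s) (Y1 0 s)).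
Proof.
have n0 s : I s -> enorm (Y1 0 s) * (enorm (Y1 0 s) * enorm (Y1 0 s)) != 0.
  by move=> Is; rewrite /enorm norm1// !mulr1 oner_neq0.
have pC s : I s -> 0 < dot (c 0 s) (c 0 s).
  by move=> Is; rewrite cc// exprn_gt0// k_gt0.
have eS := expands_speed.
have eV := expandsV openI (expandsM openI eS (expandsM openI eS eS)) n0.
have h := expandsM openI (expands_sqrt openI eC pC) eV.
apply: (expands_eq_on openI h) => [e s Is|s Is]; first by rewrite !exprS expr0 mulr1.
rewrite /enorm normc// norm1// !mulr1 invr1.
have K0 : k s != 0 by rewrite gt_eqF// k_gt0.
move: (dot (V1 s) (Y1 0 s)) (dot (V2 s) (Y2 0 s)) (k s) K0 => a b K K0.
by field.
Qed.

Variables (k' t : R -> R).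
Hypothesis Y3E : forall s, I s -> Y3 0 s =
  - k s ^+ 2 *: Y1 0 s + (k' s / k s) *: Y2 0 s + t s *: c 0 s.

(** The squared norm in the denominator is replaced by [dot c c], which avoids a square root. The
    expansion [Y3E] of the third derivative at [e = 0] serves to evaluate its products with [c] and
    with the variation of [c]. *)
Lemma expands_torsion :
  expands I m (fun e t => dot (Y3 e t) (cross (Y1 e t) (Y2 e t))
                          / enorm (cross (Y1 e t) (Y2 e t)) ^+ 2)
    (fun s => (k s)^-2 * dot (V3 s) (c 0 s) + dot (V1 s) (c 0 s)
      - t s * dot (V1 s) (Y1 0 s) - k' s / k s ^+ 3 * dot (V2 s) (c 0 s)
      - t s / k s ^+ 2 * dot (V2 s) (Y2 0 s)).
Proof.
have C0 s : I s -> dot (c 0 s) (c 0 s) != 0.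
  by move=> Is; rewrite cc// gt_eqF// exprn_gt0// k_gt0.
have h := expandsM openI (vec_expands_dot openI eY3 ec) (expandsV openI eC C0).
apply: (expands_eq_on openI h) => [e s Is|s Is].
  by rewrite /enorm sqr_sqrtr// dotxx_ge0.
rewrite cc//.
have E3c : dot (Y3 0 s) (c 0 s) = t s * k s ^+ 2.
  rewrite Y3E// !dotDl !dotZl cc// [dot (Y1 0 s) (c 0 s)]dot_cross_l.
  by rewrite [dot (Y2 0 s) (c 0 s)]dot_cross_r !mulr0 !add0r.
have E3d : dot (Y3 0 s) (dc s) = k s ^+ 2 * dot (V1 s) (c 0 s)
   - k' s / k s * dot (V2 s) (c 0 s)
   + t s * (k s ^+ 2 * dot (V1 s) (Y1 0 s) + dot (V2 s) (Y2 0 s)).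
  rewrite Y3E// !dotDl !dotZl cdc// !dotDr dot_cross_l dot_cross_r.
  have -> : dot (Y1 0 s) (cross (V1 s) (Y2 0 s)) = - dot (V1 s) (c 0 s).
    exact: dot_crossC.
  have -> : dot (Y2 0 s) (cross (Y1 0 s) (V2 s)) = - dot (V2 s) (c 0 s).
    by rewrite dot_cross_rot dot_crossC dot_cross_rot dot_crossC.

  move: (dot (V1 s) (c 0 s)) (dot (V2 s) (c 0 s)) => a b; ring.
rewrite E3c E3d.
have K0 : k s != 0 by rewrite gt_eqF// k_gt0.
move: (dot (V1 s) (Y1 0 s)) (dot (V2 s) (Y2 0 s)) (dot (V1 s) (c 0 s)) => a b d.
move: (dot (V2 s) (c 0 s)) (dot (V3 s) (c 0 s)) (t s) (k' s) (k s) K0 => e f t0 k0' K K0.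
by field.
Qed.

End FrameVariation.

(** * Inner products of the derivatives of a unit-speed curve *)

Section Curve.
Variables (R : realType) (I : set R) (x : R -> 'cV[R]_3).
Hypotheses (openI : open I) (curve_x : arclength_curve I x).

Let sx : smooth_on I x. Proof. by case: curve_x. Qed.
Let T := Ds 1 x.
Let A := Ds 2 x.
Let J := Ds 3 x.
Let k := kappa x.
Let c s := cross (T s) (A s).

Lemma speed s : I s -> enorm (T s) = 1.
Proof. by case: curve_x => _ + _; exact. Qed.

Lemma dotTT s : I s -> dot (T s) (T s) = 1.
Proof.
move=> /speed h; rewrite -[LHS]sqr_sqrtr ?dotxx_ge0//.
by move: h; rewrite /enorm => ->; rewrite expr1n.
Qed.

Lemma dotTA s : I s -> dot (T s) (A s) = 0.
Proof.
move=> Is; have d := is_derive_dot (vec_is_derive_Ds 1 sx Is) (vec_is_derive_Ds 1 sx Is).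
have e : derive1 (fun t => dot (T t) (T t)) s = 0.
  rewrite -(derive1_cst (1 : R) s); apply: near_derive1_eq.
  by apply: filterS (near_open openI Is) => t It; rewrite dotTT.
have := is_derive_derive1 d; rewrite e (dotC (A s)) => /esym/eqP.
by rewrite -mulr2n mulrn_eq0/= => /eqP.
Qed.

Lemma kappa_neq0 s : I s -> k s != 0.
Proof. by case: curve_x => _ _; exact. Qed.

Lemma kappaE s : I s -> k s = enorm (c s).
Proof. by move=> Is; rewrite /k /kappa -/T -/A speed// expr1n divr1. Qed.

Lemma kappa_gt0 s : I s -> 0 < k s.
Proof.
by move=> Is; rewrite lt0r kappa_neq0//= kappaE// sqrtr_ge0.
Qed.

Lemma kappa_sqr s : I s -> k s ^+ 2 = dot (c s) (c s).
Proof. by move=> Is; rewrite kappaE// sqr_sqrtr// dotxx_ge0. Qed.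

Lemma dotAA s : I s -> dot (A s) (A s) = k s ^+ 2.
Proof.
move=> Is; rewrite kappa_sqr// dot_cross_cross dotTT// dotTA//.
by rewrite mul1r mul0r subr0.
Qed.

Lemma tauE s : I s -> tau x s * k s ^+ 2 = dot (J s) (c s).
Proof.
move=> Is; rewrite kappaE// /tau -/T -/A -/J -/(c s) divfK//.
by rewrite -kappaE// expf_neq0// kappa_neq0.
Qed.

End Curve.

(* When [derive1n] unfolds, comparing [Ds 2 x s] with [Ds 3 x s] diverges. *)
#[local] Opaque derive1n.

(** [cross_frame_expansion] divided by [dot c c], which is [k ^+ 2] here. *)
Lemma frame_expansion (R : realType) (T A J : 'cV[R]_3) (k k1 t : R) :
  dot T T = 1 -> dot T A = 0 -> dot A A = k ^+ 2 -> dot J T = - k ^+ 2 ->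
  dot J A = k * k1 -> dot J (cross T A) = t * k ^+ 2 -> k != 0 ->
  J = - k ^+ 2 *: T + (k1 / k) *: A + t *: cross T A.
Proof.
move=> TT TA AA JT JA JC k0; have := cross_frame_expansion T A J.
rewrite /= dot_cross_cross TT AA (dotC A T) TA JT JA JC.
move: (cross T A) => C; rewrite !mul0r mul1r !subr0 => E.
have k20 : k ^+ 2 != 0 by rewrite expf_neq0.
apply: (scalerI k20); rewrite {}E.
by apply: vec_eq; rewrite !coordE; field.
Qed.

Lemma torsion_variation_frame (R : realType) (V1 V2 V3 T A C : 'cV[R]_3) (k k1 t : R) :
  k != 0 ->
  k ^- 2 * dot V3 C + dot V1 C - t * dot V1 T - k1 / k ^+ 3 * dot V2 C
    - t / k ^+ 2 * dot V2 A =
  k^-1 * dot V3 (k^-1 *: C) + k * dot V1 (k^-1 *: C) - t * dot V1 T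
    - k1 / k ^+ 2 * dot V2 (k^-1 *: C) - t / k * dot V2 (k^-1 *: A).
Proof.
rewrite !dotZr => k0.
move: (dot V3 C) (dot V1 C) (dot V1 T) (dot V2 C) (dot V2 A) => a b c d e.
by field.
Qed.

Lemma derive1_dot_self (R : realType) (u : R -> 'cV[R]_3) (s : R) u' : vec_is_derive u s u' ->
  derive1 (fun r => dot (u r) (u r)) s = 2 * dot u' (u s).
Proof.
move=> du; rewrite (is_derive_derive1 (is_derive_dot du du)).
by rewrite [dot (u s) u']dotC mulr_natl mulr2n.
Qed.

Section Curve.
Variables (R : realType) (I : set R) (x : R -> 'cV[R]_3).
Hypotheses (openI : open I) (curve_x : arclength_curve I x).

Let sx : smooth_on I x. Proof. by case: curve_x. Qed.
Let k := kappa x.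
Let t := tau x.
Let k1 := Ds 1 (kappa x).

Definition tangent s : 'cV[R]_3 := Ds 1 x s.
Definition principal_normal s : 'cV[R]_3 := (k s)^-1 *: Ds 2 x s.
Definition binormal s : 'cV[R]_3 := (k s)^-1 *: cross (Ds 1 x s) (Ds 2 x s).

(** [s] is not arc length on the deformed curve, and the tangential terms in [dkappa] and [dtau]
    compensate the change of speed: along a tangential field [f T] they reduce to [f] times the
    derivative of kappa, respectively tau. *)
Definition dkappa (v : R -> 'cV[R]_3) s :=
  dot (Ds 2 v s) (principal_normal s) - 2 * k s * dot (Ds 1 v s) (tangent s).

Definition dtau (v : R -> 'cV[R]_3) s :=
  (k s)^-1 * dot (Ds 3 v s) (binormal s) + k s * dot (Ds 1 v s) (binormal s)
  - t s * dot (Ds 1 v s) (tangent s)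
  - k1 s / k s ^+ 2 * dot (Ds 2 v s) (binormal s)
  - t s / k s * dot (Ds 2 v s) (principal_normal s).

Lemma expands_kappa m v : smooth_on I v ->
  expands I m (fun e => kappa (fun s => x s + e *: v s)) (dkappa v).
Proof.
move=> sv; have X0 := variation0 x v.
have h := expands_curvature openI (vec_expands_Ds openI sx sv m 1) (vec_expands_Ds openI sx sv m 2)
  (k := k) (kappa_gt0 curve_x).
rewrite X0 in h.
have {}h := h (dotTT curve_x) (dotTA openI curve_x) (dotAA openI curve_x).
apply: (expands_eq_on openI h) => // s Is.
by rewrite /dkappa /principal_normal dotZr.
Qed.

(** The zero variation is fed to [expands_kappa]. This comes before the torsion, whose expansion
    relies on the decomposition of the third derivative and hence on the derivative of kappa. *)
Lemma smooth_kappa : smooth_on I k.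
Proof.
have s0 : smooth_on I (fun=> 0 : 'cV[R]_3).
  apply: smooth_vec => // i; apply: (smooth_on_ext openI _ (smooth_cst I 0)) => s _.
  by rewrite mxE.
have := (expands_smooth (fun m => expands_kappa m s0)).1.
by rewrite variation0.
Qed.

Lemma kappa_derive1_kappa s : I s -> k s * k1 s = dot (Ds 3 x s) (Ds 2 x s).
Proof.
move=> Is; have dk := smooth_on_derivable smooth_kappa Is.
have e : derive1 (fun r => dot (Ds 2 x r) (Ds 2 x r)) s = derive1 (fun r => k r * k r) s.
  apply: near_derive1_eq; apply: filterS (near_open openI Is) => r Ir.
  by rewrite (dotAA openI curve_x Ir) expr2.
have E := derive1_dot_self (vec_is_derive_Ds 2 sx Is).
have n2 : 2 != 0 :> R by rewrite pnatr_eq0.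
apply: (mulfI n2); apply: etrans E; apply: etrans (esym e).
by rewrite (derive1M dk dk) -[k1 s]/(derive1 k s); ring.
Qed.

Lemma dot_Ds3_Ds1 s : I s -> dot (Ds 3 x s) (Ds 1 x s) = - k s ^+ 2.
Proof.
move=> Is; have d := is_derive_dot (vec_is_derive_Ds 2 sx Is) (vec_is_derive_Ds 1 sx Is).
have e : derive1 (fun r => dot (Ds 2 x r) (Ds 1 x r)) s = 0.
  apply: (etrans _ (derive1_cst (0 : R) s)); apply: near_derive1_eq.
  by apply: filterS (near_open openI Is) => r Ir; rewrite dotC (dotTA openI curve_x Ir).
have E := etrans (esym e) (is_derive_derive1 d).
have aux (a b c : R) : 0 = a + b -> b = c -> a = - c.
  by move=> ab <-; apply/eqP; rewrite -addr_eq0 -ab.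
exact: (aux _ _ _ E (dotAA openI curve_x Is)).
Qed.

Lemma frenet_Ds3 s : I s -> Ds 3 x s = - k s ^+ 2 *: Ds 1 x s
  + (k1 s / k s) *: Ds 2 x s + t s *: cross (Ds 1 x s) (Ds 2 x s).
Proof.
move=> Is; apply: frame_expansion.
- exact: (dotTT curve_x).
- exact: (dotTA openI curve_x).
- exact: (dotAA openI curve_x).
- exact: dot_Ds3_Ds1.
- exact: esym (kappa_derive1_kappa Is).
- exact: esym (tauE curve_x Is).
- exact: (kappa_neq0 curve_x).
Qed.

Lemma expands_tau m v : smooth_on I v ->
  expands I m (fun e => tau (fun s => x s + e *: v s)) (dtau v).
Proof.
move=> sv; have X0 := variation0 x v.
have h := @expands_torsion R I openI _ _ _ _ _ _ k m (vec_expands_Ds openI sx sv m 1)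
  (vec_expands_Ds openI sx sv m 2) (vec_expands_Ds openI sx sv m 3) (kappa_gt0 curve_x).
rewrite X0 in h.
have {}h := h (dotTT curve_x) (dotTA openI curve_x) (dotAA openI curve_x) k1 t frenet_Ds3.
apply: (expands_eq_on openI h) => // s Is.
have k0 := kappa_neq0 curve_x Is.
exact: torsion_variation_frame k0.
Qed.

Lemma expands_eta m v : smooth_on I v ->
  expands I m (fun e => Defs.eta (fun s => x s + e *: v s))
    (fun s => dot (Ds 1 v s) (tangent s)).
Proof.
move=> sv; have X0 := variation0 x v.
have h := expands_speed openI (vec_expands_Ds openI sx sv m 1).
rewrite X0 in h; exact: (h (dotTT curve_x)).
Qed.

Lemma smooth_tau : smooth_on I t.
Proof.
have s0 : smooth_on I (fun=> 0 : 'cV[R]_3).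
  apply: smooth_vec => // i; apply: (smooth_on_ext openI _ (smooth_cst I 0)) => s _.
  by rewrite mxE.
have := (expands_smooth (fun m => expands_tau m s0)).1.
by rewrite variation0.
Qed.

End Curve.

(** * The Frenet-Serret equations *)

Section FrameAlgebra.
Variables (R : realType) (T A J : 'cV[R]_3) (k k1 t : R).
Hypotheses (TT : dot T T = 1) (TA : dot T A = 0) (AA : dot A A = k ^+ 2).
Hypothesis k0 : k != 0.
Hypothesis JE : J = - k ^+ 2 *: T + (k1 / k) *: A + t *: cross T A.
Let N := k^-1 *: A.
Let B := k^-1 *: cross T A.

Lemma frame_TN : dot T N = 0.
Proof. by rewrite dotZr TA mulr0. Qed.

Lemma frame_NN : dot N N = 1.
Proof. by rewrite dotZr dotZl AA; field. Qed.

Lemma frame_cTN : cross T N = B.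
Proof. by rewrite crossZr. Qed.

Lemma frame_dN : - (k1 * (k^-1 * k^-1)) *: A + k^-1 *: J = - k *: T + t *: B.
Proof.
rewrite JE /B; move: (cross T A) => C.
by apply: vec_eq; rewrite !coordE; field.
Qed.

Lemma frame_dB : - (k1 * (k^-1 * k^-1)) *: cross T A
    + k^-1 *: (cross A A + cross T J) = - t *: N.
Proof.
have -> : cross A A + cross T J = (k1 / k) *: cross T A - t *: A.
  have -> : cross T J = - k ^+ 2 *: cross T T + (k1 / k) *: cross T A
      + t *: cross T (cross T A).
    by rewrite JE; apply: vec_eq; rewrite !coordE; ring.
  rewrite cross_crossr TT TA; move: (cross T A) => C.
  by apply: vec_eq; rewrite !coordE; ring.
rewrite /N; move: (cross T A) => C.
by apply: vec_eq; rewrite !coordE; field.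
Qed.

End FrameAlgebra.

Section Orthonormal.
Variables (R : realType) (T N B : 'cV[R]_3).
Hypotheses (TT : dot T T = 1) (TN : dot T N = 0) (NN : dot N N = 1).
Hypothesis BE : B = cross T N.

Lemma frame_TB : dot T B = 0.
Proof. by rewrite BE dot_cross_l. Qed.

Lemma frame_NB : dot N B = 0.
Proof. by rewrite BE dot_cross_r. Qed.

Lemma frame_BB : dot B B = 1.
Proof. by rewrite BE dot_cross_cross TT NN TN mul0r mulr1 subr0. Qed.

Lemma frame_cTB : cross T B = - N.
Proof. by rewrite BE cross_crossr TN TT scale0r scale1r sub0r. Qed.

End Orthonormal.

Section Frenet.
Variables (R : realType) (I : set R) (x : R -> 'cV[R]_3).
Hypotheses (openI : open I) (curve_x : arclength_curve I x).

Let sx : smooth_on I x. Proof. by case: curve_x. Qed.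
Let k := kappa x.
Let t := tau x.
Let T := tangent x.
Let N := principal_normal x.
Let B := binormal x.

Let dk s : I s -> is_derive s 1 (fun r => (k r)^-1)
  (- (Ds 1 (kappa x) s * ((k s)^-1 * (k s)^-1))).
Proof.
move=> Is; have k0 := kappa_neq0 curve_x Is.
have d := smooth_on_derivable (smooth_kappa openI curve_x) Is.
have := derivable_is_derive (derivableV k0 d); rewrite (derive1V k0 d).
exact.
Qed.

Lemma vec_is_derive_tangent s : I s -> vec_is_derive T s (k s *: N s).
Proof.
move=> Is; have k0 := kappa_neq0 curve_x Is.
by apply: (vec_is_derive_eq (vec_is_derive_Ds 1 sx Is)); rewrite scalerA divff// scale1r.
Qed.

Lemma vec_is_derive_normal s : I s -> vec_is_derive N s (- k s *: T s + t s *: B s).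
Proof.
move=> Is; have k0 := kappa_neq0 curve_x Is.
apply: (vec_is_derive_eq (vec_is_derive_scale (dk Is) (vec_is_derive_Ds 2 sx Is))).
exact: (frame_dN k0 (frenet_Ds3 openI curve_x Is)).
Qed.

Lemma vec_is_derive_binormal s : I s -> vec_is_derive B s (- t s *: N s).
Proof.
move=> Is; have k0 := kappa_neq0 curve_x Is.
apply: (vec_is_derive_eq (vec_is_derive_scale (dk Is)
  (vec_is_derive_cross (vec_is_derive_Ds 1 sx Is) (vec_is_derive_Ds 2 sx Is)))).
exact: (frame_dB (dotTT curve_x Is) (dotTA openI curve_x Is) k0
  (frenet_Ds3 openI curve_x Is)).
Qed.

Let smooth_k : smooth_on I (fun s => (k s)^-1).
Proof. exact: (smooth_onV openI (smooth_kappa openI curve_x) (kappa_neq0 curve_x)). Qed.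

Lemma smooth_tangent : smooth_on I T.
Proof. exact: (smooth_vec_Ds (k := 1) sx). Qed.

Lemma smooth_normal : smooth_on I N.
Proof. exact: (smooth_scale openI smooth_k (smooth_vec_Ds (k := 2) sx)). Qed.

Lemma smooth_binormal : smooth_on I B.
Proof.
exact: (smooth_scale openI smooth_k (smooth_cross openI
  (smooth_vec_Ds (k := 1) sx) (smooth_vec_Ds (k := 2) sx))).
Qed.

Lemma dot_tangent_normal s : I s -> dot (T s) (N s) = 0.
Proof. by move=> Is; exact: (frame_TN _ (dotTA openI curve_x Is)). Qed.

Lemma dot_normal_normal s : I s -> dot (N s) (N s) = 1.
Proof.
move=> Is; exact: (frame_NN (dotAA openI curve_x Is) (kappa_neq0 curve_x Is)).
Qed.

Lemma binormalE s : B s = cross (T s) (N s).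
Proof. exact: esym (frame_cTN _ _ _). Qed.

Lemma rhoFS_mul s a b c :
  rhoFS x s *m vec3 a b c = a *: T s + b *: N s + c *: B s.
Proof.
apply/matrixP => i j; rewrite [j]ord1 !mxE !big_ord_recl big_ord0 addr0 addrA.
rewrite !mxE /= -!/(T s) -/(N s) -/(B s).
rewrite [T s i 0 * _]mulrC [_ * b]mulrC [_ * c]mulrC.
by [].
Qed.

End Frenet.

#[local] Transparent derive1n.

Lemma sum_I2 (R : realType) (f : 'I_2 -> R) : \sum_(j < 2) f j = f 0 + f 1.
Proof.
by rewrite big_ord_recl big_ord1; congr (f _ + f _); apply/val_inj.
Qed.

Lemma expands_Ds (R : realType) (I : set R) m k (g : R -> R -> R) g1 :
  expands I (k + m) g g1 -> expands I m (fun e => Ds k (g e)) (Ds k g1).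
Proof.
elim: k g g1 => [//|k ih] g g1; rewrite addSn => -[_ [_ _ e]].
have := ih _ _ e.
have -> : (fun e => Ds k (derive1 (g e))) = (fun e => Ds k.+1 (g e)).
  by apply/funext => r; rewrite derive1Sn.
by rewrite -derive1Sn.
Qed.

(** * Lagrangians along a curve *)

Section Telescope.
Variables (R : realType) (I : set R).
Hypothesis openI : open I.
Implicit Types f g : R -> R.

(* The boundary terms of integrating f g^(m) by parts m times. *)
Definition telescope_parts m f g (s : R) : R :=
  \sum_(0 <= i < m) (-1) ^+ i * Ds i f s * Ds (m.-1 - i)%N g s.

Lemma telescope_partsS m f g s :
  telescope_parts m.+1 f g s = f s * Ds m g s - telescope_parts m (derive1 f) g s.
Proof.
rewrite /telescope_parts big_nat_recl// expr0 mul1r subn0; congr (_ + _).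
rewrite -sumrN; apply: eq_big_nat => i /andP[_ im].
(* Subtraction is truncated; [i < m] excludes [m = 0], where the predecessor would be wrong. *)
have -> : (m.+1.-1 - i.+1 = m.-1 - i)%N by case: m im => // m _; rewrite subSS.
by rewrite exprS -derive1Sn !mulNr mul1r.
Qed.

Lemma smooth_telescope m f g : smooth_on I f -> smooth_on I g ->
  smooth_on I (telescope_parts m f g).
Proof.
move=> sf sg; apply: (smooth_on_sum openI) => i _.
have h1 := smooth_onM openI (smooth_cst I ((-1) ^+ i)) (@smooth_on_Ds _ _ _ i sf).
have h2 := smooth_onM openI h1 (@smooth_on_Ds _ _ _ (m.-1 - i)%N sg).
exact: h2.
Qed.

(** Lagrange's identity. Peeling off [f * Ds m g] leaves minus the same sum for the derivative of
    [f], so all intermediate terms cancel in pairs. *)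
Lemma is_derive_telescope m f g s : smooth_on I f -> smooth_on I g -> I s ->
  is_derive s 1 (telescope_parts m f g)
    (f s * Ds m g s - (-1) ^+ m * Ds m f s * g s).
Proof.
move=> sf sg Is; elim: m f sf => [|m ih] f sf.
  have -> : telescope_parts 0 f g = cst 0.
    by apply/funext => r; rewrite /telescope_parts big_nil.
  by rewrite expr0 mul1r subrr; exact: is_derive_cst.
have -> : telescope_parts m.+1 f g =
    (fun r => f r * Ds m g r - telescope_parts m (derive1 f) g r).
  by apply/funext => r; rewrite telescope_partsS.
have df := derivable_is_derive (smooth_on_derivable sf Is).
have dg := derivable_is_derive (sg m s Is).
have d' := ih _ (smooth_on_derive1 sf).
apply: is_derive_eq (is_deriveB (is_deriveM df dg) d') _.
have -> : Ds m.+1 f s = Ds m (derive1 f) s by rewrite derive1Sn.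
have -> : Ds m.+1 g s = derive1 (Ds m g) s by [].
rewrite /GRing.scale/= exprS.
move: (derive1 f s) (Ds m g s) (derive1 (Ds m g) s) (Ds m (derive1 f) s) => a b c e.
move: (f s) (g s) ((-1) ^+ m) => a' b' w.
by ring.
Qed.

End Telescope.

Section Jets.
Variables (R : realType) (n : nat) (U : set 'M[R]_(2, n.+1)).
Variables (I : set R) (x : R -> 'cV[R]_3).
Hypotheses (openU : open U) (openI : open I) (curve_x : arclength_curve I x).
Hypothesis jetU : forall s, I s -> U (jet n x s).
Notation idx := ('I_2 * 'I_n.+1)%type.
Implicit Types (F : 'M[R]_(2, n.+1) -> R) (v : R -> 'cV[R]_3).

Definition dinvariant v (j : 'I_2) : R -> R :=
  if j == 0 then dkappa x v else dtau x v.

Lemma expands_invariant m v j : smooth_on I v ->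
  expands I m (fun e => invariant_fun j (fun s => x s + e *: v s)) (dinvariant v j).
Proof.
rewrite /invariant_fun /dinvariant; case: ifP => _ sv.
  exact: expands_kappa.
exact: expands_tau.
Qed.

Definition djet v (a : idx) (s : R) : R := Ds a.2 (dinvariant v a.1) s.

(** Stated for any smooth [F] because it serves both [L], in the action, and its partial
    derivatives, whose smoothness along the curve is the case of the zero variation. *)
Lemma expands_jet m F v : smooth_lagrangian U F -> smooth_on I v ->
  expands I m (fun e s => F (jet n (fun s => x s + e *: v s) s))
    (fun s => \sum_a djet v a s * dpartial a F (jet n x s)).
Proof.
move=> sF sv; pose g (a : idx) e := Ds a.2 (invariant_fun a.1 (fun s => x s + e *: v s)).
have jE e s : jetmx g e s = jet n (fun s => x s + e *: v s) s.
  by apply/matrixP => j m'; rewrite !mxE.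
have j0 s : jetmx g 0 s = jet n x s by rewrite jE variation0.
have eg a : expands I m (g a) (djet v a).
  exact: (expands_Ds (expands_invariant _ _ sv)).
have h := @expands_comp R n U openU I g (djet v) openI m F sF _ eg.
have {}h := h (fun s Is => eq_ind_r U (jetU Is) (j0 s)).
apply: (expands_eq_on openI h) => [e s _|s _]; first by rewrite jE.
by rewrite j0.
Qed.

Let s0 : smooth_on I (fun=> 0 : 'cV[R]_3).
Proof.
apply: (smooth_vec openI) => i; apply: (smooth_on_ext openI _ (smooth_cst I 0)) => s _.
by rewrite mxE.
Qed.

Lemma smooth_jet F : smooth_lagrangian U F -> smooth_on I (fun s => F (jet n x s)).
Proof.
move=> sF; have := (expands_smooth (fun m => expands_jet m sF s0)).1.
by rewrite variation0.
Qed.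

Lemma smooth_invariant j : smooth_on I (invariant_fun j x).
Proof.
rewrite /invariant_fun; case: ifP => _.
  exact: (smooth_kappa openI curve_x).
exact: (smooth_tau openI curve_x).
Qed.

Variables (L : 'M[R]_(2, n.+1) -> R) (smoothL : smooth_lagrangian U L).

Lemma smooth_dL j m : smooth_on I (dL L x j m).
Proof. exact: (smooth_jet (smooth_dpartial (j, m) smoothL)). Qed.

Lemma smooth_Euler j : smooth_on I (Euler j L x).
Proof.
apply: (smooth_on_sum openI) => m _.
have h := smooth_onM openI (smooth_cst I ((-1) ^+ m)) (@smooth_on_Ds _ _ _ m (@smooth_dL j m)).
exact: h.
Qed.

Lemma is_derive_jet s : I s -> is_derive s 1 (fun s => L (jet n x s))
  (\sum_(j < 2) \sum_(m < n.+1) Ds m.+1 (invariant_fun j x) s * dL L x j m s).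
Proof.
move=> Is; have jE (a : idx) : (fun r => jet n x r a.1 a.2) = Ds a.2 (invariant_fun a.1 x).
  by apply/funext => r; rewrite mxE.
have da (a : idx) : derivable (fun r => jet n x r a.1 a.2) s 1.
  by rewrite jE; exact: smooth_invariant.
have [d dE] := derivable_curve (smooth_differentiable smoothL (jetU Is)) da.
apply: (is_derive_eq (derivable_is_derive d)); rewrite dE pair_bigA/=.
by apply: eq_bigr => a _; rewrite jE.
Qed.

(** Used with two families [g]: the derivatives of kappa and tau give the double sums of
    [lambda_sol], and the first variations of kappa and tau give the boundary terms of the
    action. *)
Definition telescope_jet (g : 'I_2 -> R -> R) (s : R) : R :=
  \sum_(j < 2) \sum_(m < n.+1) telescope_parts m (dL L x j m) (g j) s.

Lemma is_derive_telescope_jet (g : 'I_2 -> R -> R) s :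
  (forall j, smooth_on I (g j)) -> I s ->
  is_derive s 1 (telescope_jet g)
    (\sum_(j < 2) \sum_(m < n.+1) Ds m (g j) s * dL L x j m s
     - (Ekappa L x s * g 0 s + Etau L x s * g 1 s)).
Proof.
move=> sg Is.
have d (j : 'I_2) (m : 'I_n.+1) := is_derive_telescope m (@smooth_dL j m) (sg j) Is.
have dj j : derivable (fun r => \sum_(m < n.+1) telescope_parts m (dL L x j m) (g j) r) s 1.
  by apply: derivable_big_sum => m _; case: (d j m).
apply: DeriveDef; first by apply: derivable_big_sum => j _; exact: dj.
rewrite -derive1E derive1_sum; last by move=> j _; exact: dj.
transitivity (\sum_(j < 2) (\sum_(m < n.+1) Ds m (g j) s * dL L x j m s
   - Euler j L x s * g j s)).
  apply: eq_bigr => j _; rewrite derive1_sum; last by move=> m _; case: (d j m).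
  rewrite /Euler mulr_suml -sumrB; apply: eq_bigr => m _.
  by rewrite (is_derive_derive1 (d j m)) [dL _ _ _ _ _ * _]mulrC.
rewrite big_split/= sumrN; congr (_ - _); exact: (sum_I2 (fun j => Euler j L x s * g j s)).
Qed.

Lemma smooth_telescope_jet (g : 'I_2 -> R -> R) :
  (forall j, smooth_on I (g j)) -> smooth_on I (telescope_jet g).
Proof.
move=> sg; apply: (smooth_on_sum openI) => j _; apply: (smooth_on_sum openI) => m _.
have h := @smooth_telescope _ _ openI m _ _ (@smooth_dL j m) (sg j).
exact: h.
Qed.

Lemma lambda_solE s : lambda_sol L x s = 2 * tau x s * Etau L x s
  - L (jet n x s) + telescope_jet (fun j => derive1 (invariant_fun j x)) s.
Proof.
rewrite /telescope_jet sum_I2 addrA /lambda_sol.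
have E (j : 'I_2) : \sum_(m < n.+1 | (0 < m)%N) \sum_(0 <= i < m)
    (-1) ^+ i * Ds i (dL L x j m) s * Ds (m - i) (invariant_fun j x) s =
    \sum_(m < n.+1) telescope_parts m (dL L x j m) (derive1 (invariant_fun j x)) s.
  rewrite big_mkcond; apply: eq_bigr => m _.
  case: ifPn => [m0|]; last first.
    by rewrite -eqn0Ngt => /eqP ->; rewrite /telescope_parts big_nil.
  apply: eq_big_nat => i /andP[_ im]; congr (_ * _).
  (* [lambda_sol] differentiates the invariant itself; since [i < m], one of the [m - i] derivatives
     can be moved into [g], which leaves the exponent of [telescope_parts]. *)
  have -> : (m - i = (m.-1 - i).+1)%N.
    by case: (nat_of_ord m) m0 im => // k _; rewrite ltnS => /subSn ->.
  exact: (congr1 (fun h => h s) (derive1Sn (invariant_fun j x) (m.-1 - i))).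
by rewrite -!E.
Qed.

Lemma smooth_lambda_sol : smooth_on I (lambda_sol L x).
Proof.
have sT : smooth_on I (telescope_jet (fun j => derive1 (invariant_fun j x))).
  by apply: smooth_telescope_jet => j; apply: smooth_on_derive1; exact: smooth_invariant.
have h1 := smooth_onM openI (smooth_onM openI (smooth_cst I 2) (smooth_tau openI curve_x)) (@smooth_Euler 1).
have h2 := smooth_onD openI (smooth_onB openI h1 (smooth_jet smoothL)) sT.
by apply: (smooth_on_ext openI _ h2) => s _; rewrite lambda_solE.
Qed.

(** The chain rule for [L] along the curve produces exactly the first sum in the derivative of
    [telescope_jet], with opposite sign; only the Euler operators survive. *)
Lemma derive1_lambda_sol s : I s -> derive1 (lambda_sol L x) s =
  derive1 (fun r => 2 * tau x r * Etau L x r) s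
  - (Ds 1 (kappa x) s * Ekappa L x s + Ds 1 (tau x) s * Etau L x s).
Proof.
move=> Is.
have h1 := smooth_onM openI (smooth_onM openI (smooth_cst I 2) (smooth_tau openI curve_x)) (@smooth_Euler 1).
have d1 := derivable_is_derive (smooth_on_derivable h1 Is).
have sT j : smooth_on I (derive1 (invariant_fun j x)).
  by apply: smooth_on_derive1; exact: smooth_invariant.
have d := is_deriveD (is_deriveB d1 (is_derive_jet Is)) (is_derive_telescope_jet sT Is).
have -> : lambda_sol L x = (fun r => 2 * tau x r * Euler 1 L x r - L (jet n x r)
    + telescope_jet (fun j => derive1 (invariant_fun j x)) r).
  by apply/funext => r; rewrite lambda_solE.
apply: (etrans (is_derive_derive1 d)).
rewrite -addrA; congr (_ + _).
have -> : \sum_(j < 2) \sum_(m < n.+1) Ds m.+1 (invariant_fun j x) s * dL L x j m s =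
    \sum_(j < 2) \sum_(m < n.+1) Ds m (derive1 (invariant_fun j x)) s * dL L x j m s.
  by apply: eq_bigr => j _; apply: eq_bigr => m _; rewrite derive1Sn.
rewrite addrA addNr add0r; congr (- (_ + _)); exact: mulrC.
Qed.

End Jets.

#[local] Opaque derive1n.

(** * Conserved vectors *)

Section IsDerive.
Variables (R : realType) (f g : R -> R) (s f' g' : R).

Lemma is_derive1D : is_derive s 1 f f' -> is_derive s 1 g g' ->
  is_derive s 1 (fun r => f r + g r) (f' + g').
Proof. exact: is_deriveD. Qed.

Lemma is_derive1B : is_derive s 1 f f' -> is_derive s 1 g g' ->
  is_derive s 1 (fun r => f r - g r) (f' - g').
Proof. exact: is_deriveB. Qed.

Lemma is_derive1N : is_derive s 1 f f' -> is_derive s 1 (fun r => - f r) (- f').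
Proof. exact: is_deriveN. Qed.

Lemma is_derive1M : is_derive s 1 f f' -> is_derive s 1 g g' ->
  is_derive s 1 (fun r => f r * g r) (f' * g s + f s * g').
Proof.
move=> df dg; apply: (is_derive_eq (is_deriveM df dg)).
by rewrite addrC mulrC.
Qed.

Lemma is_derive1V : f s != 0 -> is_derive s 1 f f' ->
  is_derive s 1 (fun r => (f r)^-1) (- (f' * ((f s)^-1 * (f s)^-1))).
Proof.
move=> f0 df; apply: (is_derive_eq (is_deriveV f0 df)).
by rewrite /GRing.scale/= expr2 invfM mulNr mulrC.
Qed.

End IsDerive.

Lemma is_derive_Ds (R : realType) (I : set R) (f : R -> R) j s :
  smooth_on I f -> I s -> is_derive s 1 (Ds j f) (Ds j.+1 f s).
Proof. by move=> sf Is; exact: derivable_is_derive (sf j s Is). Qed.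

Lemma is_derive_smooth (R : realType) (I : set R) (f : R -> R) s :
  smooth_on I f -> I s -> is_derive s 1 f (Ds 1 f s).
Proof. by move=> sf Is; exact: derivable_is_derive (sf 0%N s Is). Qed.

Section Momentum.
Variables (R : realType) (I : set R).
Hypothesis openI : open I.
Variables (k t Ek Et mu : R -> R) (T N B : R -> 'cV[R]_3).
Hypotheses (sk : smooth_on I k) (st : smooth_on I t) (sEk : smooth_on I Ek)
  (sEt : smooth_on I Et) (smu : smooth_on I mu).
Hypotheses (sT : smooth_on I T) (sN : smooth_on I N) (sB : smooth_on I B).
Hypothesis k0 : forall s, I s -> k s != 0.
Hypotheses (dT : forall s, I s -> vec_is_derive T s (k s *: N s))
  (dN : forall s, I s -> vec_is_derive N s (- k s *: T s + t s *: B s))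
  (dB : forall s, I s -> vec_is_derive B s (- t s *: N s)).

Definition momentum_T s := - k s * Ek s - t s * Et s - mu s.
Definition momentum_N s := - Ds 1 Ek s - t s / k s * Ds 1 Et s.
Definition momentum_B s :=
  1 / k s * Ds 2 Et s - Ds 1 k s / k s ^+ 2 * Ds 1 Et s + k s * Et s - t s * Ek s.
Definition momentum s : 'cV[R]_3 :=
  momentum_T s *: T s + momentum_N s *: N s + momentum_B s *: B s.

(* With [k, t, Ek, Et] the curvature, torsion and Euler operators and [mu] the
   multiplier of [eta - 1], this is Ex for [lam = mu + 2 t Et]; [EL_N] and [EL_B]
   are Ey and Ez. *)
Definition EL_T s := Ds 1 k s * Ek s + Ds 1 t s * Et s + Ds 1 mu s.
Definition EL_N s := Ds 2 Ek s + 2 * t s / k s * Ds 2 Et s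
  + (Ds 1 t s / k s - 2 * t s * Ds 1 k s / k s ^+ 2) * Ds 1 Et s
  + (k s ^+ 2 - t s ^+ 2) * Ek s + 2 * t s * k s * Et s + mu s * k s.
Definition EL_B s := - (1 / k s) * Ds 3 Et s + 2 * Ds 1 k s / k s ^+ 2 * Ds 2 Et s
  + (Ds 2 k s / k s ^+ 2 + t s ^+ 2 / k s - 2 * Ds 1 k s ^+ 2 / k s ^+ 3 - k s) * Ds 1 Et s
  - Ds 1 k s * Et s + 2 * t s * Ds 1 Ek s + Ds 1 t s * Ek s.
Definition EL s : 'cV[R]_3 := EL_T s *: T s + EL_N s *: N s + EL_B s *: B s.

Let smooth1 f := @smooth_on_Ds R I f 1.
Let smooth2 f := @smooth_on_Ds R I f 2.
Let skV : smooth_on I (fun s => (k s)^-1).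
Proof. exact: (smooth_onV openI sk k0). Qed.

Lemma smooth_momentum : smooth_on I momentum.
Proof.
have mulP := smooth_onM openI.
have sNk := smooth_onN openI sk.
have sT' : smooth_on I momentum_T.
  exact: (smooth_onB openI (smooth_onB openI (mulP _ _ sNk sEk) (mulP _ _ st sEt)) smu).
have sN' : smooth_on I momentum_N.
  exact: (smooth_onB openI (smooth_onN openI (smooth1 sEk))
            (mulP _ _ (mulP _ _ st skV) (smooth1 sEt))).
have sB' : smooth_on I momentum_B.
  have k20 s : I s -> k s * k s != 0 by move=> /k0 h; rewrite mulf_neq0.
  have h2 := mulP _ _ (mulP _ _ (smooth1 sk) (smooth_onV openI (mulP _ _ sk sk) k20)) (smooth1 sEt).
  have h1 := mulP _ _ (mulP _ _ (smooth_cst I 1) skV) (smooth2 sEt).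
  have h := smooth_onB openI (smooth_onD openI (smooth_onB openI h1 h2) (mulP _ _ sk sEt))
     (mulP _ _ st sEk).
  exact: h.
exact: (smooth_add openI (smooth_add openI (smooth_scale openI sT' sT)
  (smooth_scale openI sN' sN)) (smooth_scale openI sB' sB)).
Qed.

(** By the Frenet equations the coefficients of the derivative are [W_T' - k W_N],
    [W_N' + k W_T - t W_B] and [W_B' + t W_N]; substituting the three components of the momentum
    gives minus [EL_T], [EL_N] and [EL_B]. *)
Lemma vec_is_derive_momentum s : I s -> vec_is_derive momentum s (- EL s).
Proof.
move=> Is; have ks0 := k0 Is.
have dk := is_derive_smooth sk Is; have dk1 := is_derive_Ds 1 sk Is.
have dt := is_derive_smooth st Is; have dmu := is_derive_smooth smu Is.
have dEk := is_derive_smooth sEk Is; have dEk1 := is_derive_Ds 1 sEk Is.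
have dEt := is_derive_smooth sEt Is; have dEt1 := is_derive_Ds 1 sEt Is.
have dEt2 := is_derive_Ds 2 sEt Is.
have dkV := is_derive1V ks0 dk.
have dk2V := is_derive1V (f := fun r => k r * k r) (mulf_neq0 ks0 ks0) (is_derive1M dk dk).
have d1 := is_derive1B (is_derive1B (is_derive1M (is_derive1N dk) dEk) (is_derive1M dt dEt)) dmu.
have d2 := is_derive1B (is_derive1N dEk1) (is_derive1M (is_derive1M dt dkV) dEt1).
have d3 := is_derive1B (is_derive1D (is_derive1B
  (is_derive1M (is_derive1M (is_derive_cst (1 : R) s (1 : R)) dkV) dEt2)
  (is_derive1M (is_derive1M dk1 dk2V) dEt1)) (is_derive1M dk dEt)) (is_derive1M dt dEk).
have h := vec_is_derive_add (vec_is_derive_add (vec_is_derive_scale d1 (dT Is)) (vec_is_derive_scale d2 (dN Is)))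
  (vec_is_derive_scale d3 (dB Is)).
apply: (vec_is_derive_eq h); rewrite /EL /EL_T /EL_N /EL_B /cst.
move: (T s) (N s) (B s) (Ds 1 k s) (Ds 2 k s) (Ds 1 t s) (Ds 1 mu s) => T0 N0 B0 k1 k2 t1 mu1.
move: (Ds 1 Ek s) (Ds 2 Ek s) (Ds 1 Et s) (Ds 2 Et s) (Ds 3 Et s) => Ek1 Ek2 Et1 Et2 Et3.
move: (k s) ks0 (t s) (mu s) (Ek s) (Et s) => K K0 t0 mu0 Ek0 Et0.
by apply: vec_eq; rewrite !coordE; field.
Qed.

(* The boundary terms of the integrations by parts that replace [Ek dkappa + Et dtau
   - mu T . v'] by [v . EL]. *)
Definition boundary_momentum (v : R -> 'cV[R]_3) s :=
  dot (Ds 2 v s) (B s) * (Et s / k s)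
  - (Ds 1 Et s / k s * dot (Ds 1 v s) (B s) - Ek s * dot (Ds 1 v s) (N s))
  + dot (v s) (momentum s).

Lemma smooth_boundary_momentum v : smooth_on I v -> smooth_on I (boundary_momentum v).
Proof.
move=> sv; have mulP := smooth_onM openI.
have sv1 := @smooth_vec_Ds R I v 1 sv; have sv2 := @smooth_vec_Ds R I v 2 sv.
have h := smooth_onD openI (smooth_onB openI
  (mulP _ _ (smooth_dot openI sv2 sB) (mulP _ _ sEt skV))
  (smooth_onB openI (mulP _ _ (mulP _ _ (smooth1 sEt) skV) (smooth_dot openI sv1 sB))
   (mulP _ _ sEk (smooth_dot openI sv1 sN))))
  (smooth_dot openI sv smooth_momentum).
exact: h.
Qed.

(** The factors of [Ek s] and [Et s] are [dkappa] and [dtau], spelled out for an abstract frame. *)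
Lemma is_derive_boundary_momentum v s : smooth_on I v -> I s ->
  is_derive s 1 (boundary_momentum v)
   (Ek s * (dot (Ds 2 v s) (N s) - 2 * k s * dot (Ds 1 v s) (T s))
    + Et s * ((k s)^-1 * dot (Ds 3 v s) (B s) + k s * dot (Ds 1 v s) (B s)
       - t s * dot (Ds 1 v s) (T s) - Ds 1 k s / k s ^+ 2 * dot (Ds 2 v s) (B s)
       - t s / k s * dot (Ds 2 v s) (N s))
    - mu s * dot (Ds 1 v s) (T s) - dot (v s) (EL s)).
Proof.
move=> sv Is; have ks0 := k0 Is.
have dk := is_derive_smooth sk Is; have dEk := is_derive_smooth sEk Is.
have dEt := is_derive_smooth sEt Is; have dEt1 := is_derive_Ds 1 sEt Is.
have dkV := is_derive1V ks0 dk.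
have dv : vec_is_derive v s (Ds 1 v s) := vec_is_derive_Ds 0 sv Is.
have dv1 := vec_is_derive_Ds 1 sv Is; have dv2 := vec_is_derive_Ds 2 sv Is.
have h := is_derive1D (is_derive1B
   (is_derive1M (is_derive_dot dv2 (dB Is)) (is_derive1M dEt dkV))
   (is_derive1B (is_derive1M (is_derive1M dEt1 dkV) (is_derive_dot dv1 (dB Is)))
      (is_derive1M dEk (is_derive_dot dv1 (dN Is)))))
  (is_derive_dot dv (vec_is_derive_momentum Is)).
apply: (is_derive_eq h).
rewrite /momentum /momentum_T /momentum_N /momentum_B.
move: (v s) (Ds 1 v s) (Ds 2 v s) (Ds 3 v s) (EL s) => v0 v1 v2 v3 G.
move: (T s) (N s) (B s) (Ds 1 k s) (Ds 1 Ek s) (Ds 1 Et s) (Ds 2 Et s) => T0 N0 B0 k1 Ek1 Et1 Et2.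
rewrite !dotDr !dotZr dotNr.
move: (k s) ks0 (t s) (mu s) (Ek s) (Et s) => K K0 t0 mu0 Ek0 Et0.
move: (dot v0 G) (dot v1 T0) (dot v1 N0) (dot v1 B0) (dot v2 N0) (dot v2 B0) (dot v3 B0) => a b c d e f g.
by field.
Qed.

End Momentum.

(** * The conserved vector of rotations *)

Section NoetherMoment.
Variables (R : realType) (I : set R).
Variables (k t Ek Et mu : R -> R) (x T N B : R -> 'cV[R]_3).
Hypotheses (sk : smooth_on I k) (sEk : smooth_on I Ek) (sEt : smooth_on I Et).
Hypothesis k0 : forall s, I s -> k s != 0.
Hypotheses (dx : forall s, I s -> vec_is_derive x s (T s))
  (dT : forall s, I s -> vec_is_derive T s (k s *: N s))
  (dN : forall s, I s -> vec_is_derive N s (- k s *: T s + t s *: B s))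
  (dB : forall s, I s -> vec_is_derive B s (- t s *: N s)).
Hypotheses (cTN : forall s, I s -> cross (T s) (N s) = B s)
  (cTB : forall s, I s -> cross (T s) (B s) = - N s).

Let W := momentum k t Ek Et mu T N B.

Definition moment s : 'cV[R]_3 :=
  cross (x s) (W s) + (Et s *: T s + (1 / k s * Ds 1 Et s) *: N s + Ek s *: B s).

(** As [W] is stationary, the cross product of [x] and [W] has derivative
    [cross T W = W_N B - W_B N]. The derivative of the remaining part has coefficient 0 on [T],
    since the two occurrences of the derivative of [Et] cancel, [W_B] on [N] and [- W_N] on [B]. *)
Lemma vec_is_derive_moment s : I s -> vec_is_derive W s 0 -> vec_is_derive moment s 0.
Proof.
move=> Is dW; have ks0 := k0 Is.
have dk := is_derive_smooth sk Is; have dEk := is_derive_smooth sEk Is.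
have dEt := is_derive_smooth sEt Is; have dEt1 := is_derive_Ds 1 sEt Is.
have dkV := is_derive1V ks0 dk.
have d2 := is_derive1M (is_derive1M (is_derive_cst (1 : R) s (1 : R)) dkV) dEt1.
have h := vec_is_derive_add (vec_is_derive_cross (dx Is) dW)
  (vec_is_derive_add (vec_is_derive_add (vec_is_derive_scale dEt (dT Is)) (vec_is_derive_scale d2 (dN Is)))
    (vec_is_derive_scale dEk (dB Is))).
apply: (vec_is_derive_eq h).
have -> : cross (T s) (W s) = momentum_N k t Ek Et s *: B s
    - momentum_B k t Ek Et s *: N s.
  have E (a b c : R) (T0 N0 B0 : 'cV[R]_3) : cross T0 N0 = B0 -> cross T0 B0 = - N0 ->
      cross T0 (a *: T0 + b *: N0 + c *: B0) = b *: B0 - c *: N0.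
    move=> E1 E2; transitivity (b *: cross T0 N0 + c *: cross T0 B0).
      by apply: vec_eq; rewrite !coordE; ring.
    by rewrite E1 E2 scalerN.
  exact: E (cTN Is) (cTB Is).
have -> : cross (x s) 0 = 0.
  by apply: vec_eq; rewrite !coordE /cx /cy /cz !mxE; ring.
rewrite /momentum_N /momentum_B /cst.
move: (T s) (N s) (B s) (Ds 1 k s) (Ds 1 Ek s) (Ds 1 Et s) (Ds 2 Et s) => T0 N0 B0 k1 Ek1 Et1 Et2.
move: (k s) ks0 (t s) (Ek s) (Et s) => K K0 t0 Ek0 Et0.
apply: vec_eq; rewrite !coordE.
- by rewrite [cx 0]mxE; field.
- by rewrite [cy 0]mxE; field.
- by rewrite [cz 0]mxE; field.
Qed.

End NoetherMoment.

(** * The fundamental lemma *)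

Section Calculus.
Variables (R : realType) (I : set R).
Hypothesis openI : open I.

Lemma smooth_onW (V : normedModType R) (J : set R) (f : R -> V) :
  I `<=` J -> smooth_on J f -> smooth_on I f.
Proof. by move=> IJ sf k s /IJ; exact: sf. Qed.

Lemma Ds_eq0 (f : R -> R) k s : (forall r, I r -> f r = 0) -> I s -> Ds k f s = 0.
Proof.
move=> f0 Is; rewrite (Ds_eq_on k openI f0 Is).
have D0 : derive1 (fun=> 0 : R) = (fun=> 0).
  by apply/funext => r; rewrite derive1_cst.
by elim: k => [//|k ih]; rewrite derive1Sn D0.
Qed.

(** As [I] is open, it contains points to the left of [a] arbitrarily close to it. This and its
    mirror image give the value of the boundary terms at the two ends of the support. *)
Lemma vanishing_left (f : R -> R) (a : R) : I a -> {for a, continuous f} ->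
  (forall s, I s -> s < a -> f s = 0) -> f a = 0.
Proof.
move=> Ia cf f0; apply/eqP/negP => /negP fa.
have : \forall s \near a, f s != 0 /\ I s.
  by apply: filterS2 (near_neq0 cf fa) (near_open openI Ia).
move=> /nbhs_ballP[r /= r0 rP].
have [] := rP (a - r / 2); last first.
  move=> /eqP + Ir; apply; apply: f0 => //.
  by rewrite ltrBlDr ltrDl divr_gt0.
rewrite -ball_normE/= subKr gtr0_norm ?divr_gt0//.
by rewrite ltr_pdivrMr// ltr_pMr// ltr1n.
Qed.

Lemma vanishing_right (f : R -> R) (a : R) : I a -> {for a, continuous f} ->
  (forall s, I s -> a < s -> f s = 0) -> f a = 0.
Proof.
move=> Ia cf f0; apply/eqP/negP => /negP fa.
have : \forall s \near a, f s != 0 /\ I s.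
  by apply: filterS2 (near_neq0 cf fa) (near_open openI Ia).
move=> /nbhs_ballP[r /= r0 rP].
have [] := rP (a + r / 2); last first.
  move=> /eqP + Ir; apply; apply: f0 => //.
  by rewrite ltrDl divr_gt0.
rewrite -ball_normE/= opprD addNKr normrN gtr0_norm ?divr_gt0//.
by rewrite ltr_pdivrMr// ltr_pMr// ltr1n.
Qed.

Hypothesis itvI : is_interval I.

Lemma derive0_constant (f : R -> R) :
  (forall s, I s -> is_derive s 1 f 0) -> exists c, forall s, I s -> f s = c.
Proof.
(* [I] may be empty, in which case any constant will do. *)
move=> df; have [[s0 I0]|nI] := pselect (exists s, I s); last first.
  by exists 0 => s Is; exfalso; apply: nI; exists s.
exists (f s0) => s Is.
wlog le_s : s s0 I0 Is / s0 <= s.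
  move=> h; have [/h|/ltW/h] := leP s0 s; first exact.
  by move=> E; symmetry; exact: E.
have inI r : s0 <= r <= s -> I r by exact: itvI.
have [||c _] := @MVT_segment R f (fun=> 0) s0 s le_s.
- by move=> r; rewrite in_itv/= => /andP[? ?]; apply/df/inI; rewrite !ltW.
- apply: continuous_in_subspaceT => r; rewrite inE/= in_itv/= => /inI Ir.
  exact: is_derive_continuous (df _ Ir).
by rewrite mul0r => /eqP; rewrite subr_eq0 => /eqP.
Qed.

Lemma vec_is_derive0_constant (u : R -> 'cV[R]_3) :
  (forall s, I s -> vec_is_derive u s 0) -> exists c, forall s, I s -> u s = c.
Proof.
move=> du; have /choice[c cP] : forall i : 'I_3, exists c, forall s, I s -> u s i 0 = c.
  by move=> i; apply: derive0_constant => s /du/(_ i); rewrite mxE.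
exists (\col_i c i) => s Is; apply/matrixP => i j.
by rewrite [j]ord1 mxE cP.
Qed.

Lemma fundamental_lemma (G : R -> 'cV[R]_3) :
  (forall i s, I s -> {for s, continuous (fun r => G r i 0)}) ->
  (forall a b v, Defs.variation I a b v ->
     (\int[lebesgue_measure]_(s in `[a, b]) dot (v s) (G s))%R = 0) ->
  forall s, I s -> G s = 0.
Proof.
move=> cG G0 s Is; apply/matrixP => i j; rewrite [j]ord1 mxE {j}.
apply/eqP/negP => /negP Gs.
(* The factor [G s i 0] makes [h] positive at [s] whatever the sign of that entry; the test field
   [v] carries the same factor. *)
pose h r := G s i 0 * G r i 0.
have ch r : I r -> {for r, continuous h}.
  by move=> Ir; apply: continuousM; [exact: cvg_cst|exact: cG].
have hs : 0 < h s by rewrite /h -expr2 lt0r sqrf_eq0 Gs sqr_ge0.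
have : \forall r \near s, 0 < h r /\ I r.
  have h0 : \forall r \near s, 0 < h r by apply: (ch _ Is [set y | 0 < y]); exact: lt_nbhsr.
  by apply: filterS2 h0 (near_open openI Is).
move=> /nbhs_ballP[r /= r0 rP].
(* Half the radius, so that the closed support stays in the ball where [h] is positive and inside
   [I]. *)
pose a := s - r / 2; pose b := s + r / 2.
have abP q : a <= q <= b -> 0 < h q /\ I q.
  move=> /andP[aq qb]; apply: rP; rewrite -ball_normE/= ltr_norml.
  by apply/andP; split; move: aq qb r0; rewrite /a /b; lra.
have asb : a < s < b by apply/andP; split; rewrite /a /b; move: r0; lra.
pose v q : 'cV[R]_3 := (G s i 0 * bump_fun a b q) *: delta_mx i 0.
have var : Defs.variation I a b v.
  split; first by case/andP: asb; exact: lt_trans.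
  - by move=> q; rewrite /= in_itv/= => /abP[].
  - apply: (smooth_vec openT) => j.
    have h1 := smooth_onM openT (smooth_onM openT (smooth_cst setT (G s i 0))
      (@smooth_bump_fun R a b)) (smooth_cst setT (delta_mx i (0 : 'I_1) j 0)).
    by apply: (smooth_on_ext openT _ h1) => q _; rewrite [RHS]mxE.
  - move=> q qab; rewrite /v bump_fun_out ?mulr0 ?scale0r//.
    by apply: contra qab => qab; rewrite inE/= in_itv.
have := G0 _ _ _ var.
have -> : (\int[lebesgue_measure]_(q in `[a, b]) dot (v q) (G q))%R =
    (\int[lebesgue_measure]_(q in `[a, b]) (bump_fun a b q * h q))%R.
  apply: eq_Rintegral => q _; rewrite /dot (bigD1 i)//= big1 ?addr0.
    by rewrite !mxE !eqxx mulr1 /h; ring.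
  by move=> j ji; rewrite !mxE (negPf ji) mulr0 mul0r.
apply/eqP; rewrite gt_eqF//; apply: (Rintegral_gt0 asb).
- move=> q /abP[_ Iq]; apply: continuousM; last exact: ch.
  exact: (@smooth_on_continuous R setT _ q (@smooth_bump_fun R a b) Logic.I).
- by move=> q /abP[hq _]; rewrite mulr_ge0 ?bump_fun_ge0// ltW.
- by rewrite mulr_gt0// bump_fun_gt0.
Qed.

End Calculus.

Lemma dot0l (R : realType) (u : 'cV[R]_3) : dot 0 u = 0.
Proof. by rewrite /dot big1// => i _; rewrite mxE mul0r. Qed.

(** * Extremals *)

Section Variational.
Variables (R : realType) (n : nat) (U : set 'M[R]_(2, n.+1)).
Variables (L : 'M[R]_(2, n.+1) -> R) (I : set R) (x : R -> 'cV[R]_3).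
Hypotheses (openU : open U) (smoothL : smooth_lagrangian U L) (openI : open I).
Hypotheses (curve_x : arclength_curve I x) (jetU : forall s, I s -> U (jet n x s)).
Variables (mu : R -> R) (smu : smooth_on I mu).

Let k := kappa x.
Let t := tau x.
Let Ek := Ekappa L x.
Let Et := Etau L x.
Let T := tangent x.
Let N := principal_normal x.
Let B := binormal x.

Let sk : smooth_on I k := smooth_kappa openI curve_x.
Let st : smooth_on I t := smooth_tau openI curve_x.
Let sEk : smooth_on I Ek := @smooth_Euler R n U I x openU openI curve_x jetU L smoothL 0.
Let sEt : smooth_on I Et := @smooth_Euler R n U I x openU openI curve_x jetU L smoothL 1.
Let sT : smooth_on I T := smooth_tangent curve_x.
Let sN : smooth_on I N := smooth_normal openI curve_x.
Let sB : smooth_on I B := smooth_binormal openI curve_x.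
Let k0 : forall s, I s -> k s != 0 := kappa_neq0 curve_x.
Let dT : forall s, I s -> vec_is_derive T s (k s *: N s) := vec_is_derive_tangent curve_x.
Let dN : forall s, I s -> vec_is_derive N s (- k s *: T s + t s *: B s) := vec_is_derive_normal openI curve_x.
Let dB : forall s, I s -> vec_is_derive B s (- t s *: N s) := vec_is_derive_binormal openI curve_x.

Definition curve_momentum := momentum k t Ek Et mu T N B.
Definition curve_EL := EL k t Ek Et mu T N B.

Lemma smooth_curve_momentum : smooth_on I curve_momentum.
Proof. exact: (smooth_momentum openI sk st sEk sEt smu sT sN sB k0). Qed.

Lemma vec_is_derive_curve_momentum s : I s -> vec_is_derive curve_momentum s (- curve_EL s).
Proof. exact: (vec_is_derive_momentum sk st sEk sEt smu k0 dT dN dB). Qed.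

(** [curve_EL] is minus the derivative of a smooth vector, so its formula need not be expanded. *)
Lemma continuous_curve_EL i s : I s -> {for s, continuous (fun r => curve_EL r i 0)}.
Proof.
have h := smooth_onN openI (smooth_on_derive1 (@smooth_coord _ _ openI _ i smooth_curve_momentum)).
apply: smooth_on_continuous; apply: (smooth_on_ext openI _ h) => r Ir.
by rewrite (is_derive_derive1 (vec_is_derive_curve_momentum Ir i)) mxE opprK.
Qed.

Section Variation.
Variables (a b : R) (v : R -> 'cV[R]_3).
Hypothesis var_v : Defs.variation I a b v.

Let ab : a < b. Proof. by case: var_v. Qed.
Let abI s : a <= s <= b -> I s.
Proof. by case: var_v => _ h _ _ sab; apply: h; rewrite /= in_itv. Qed.
Let sv : smooth_on I v.
Proof. by case: var_v => _ _ h _; apply: smooth_onW h. Qed.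
Let v0 s : ~~ (a <= s <= b) -> v s = 0.
Proof.
case: var_v => _ _ _ h sab; apply: h; apply: contra sab.
by rewrite inE/= in_itv.
Qed.

Let f1 s := \sum_c djet x v c s * dpartial c L (jet n x s) - mu s * dot (Ds 1 v s) (T s).

Lemma expands_action m :
  expands I m (fun e s => L (jet n (fun r => x r + e *: v r) s)
     - mu s * (Defs.eta (fun r => x r + e *: v r) s - 1)) f1.
Proof.
have h1 := expands_jet openU openI curve_x jetU m smoothL sv.
have h2 := expandsB openI (expands_eta openI curve_x m sv)
   (expands_cst openI m (smooth_cst I 1)).
have h := expandsB openI h1 (expandsM openI (expands_cst openI m smu) h2).
apply: (expands_eq_on openI h) => // s Is.
by rewrite /f1 mul0r add0r subr0.
Qed.

(** The total boundary term: the first summand reduces the variation of [L] to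
    [Ek * dkappa + Et * dtau], and the second moves all derivatives off [v]. *)
Let Phi s := telescope_jet x L (dinvariant x v) s + boundary_momentum k t Ek Et mu T N B v s.

Let sinv j : smooth_on I (dinvariant x v j).
Proof. exact: (expands_smooth (fun m => expands_invariant openI curve_x m j sv)).2. Qed.

Lemma smooth_boundary : smooth_on I Phi.
Proof.
have h1 := smooth_telescope_jet openU openI curve_x jetU smoothL sinv.
have h2 := smooth_boundary_momentum openI sk st sEk sEt smu sT sN sB k0 sv.
have h := smooth_onD openI h1 h2.
exact: h.
Qed.

Lemma is_derive_boundary s : I s ->
  is_derive s 1 Phi (f1 s - dot (v s) (curve_EL s)).
Proof.
move=> Is.
have d1 := is_derive_telescope_jet openU openI curve_x jetU smoothL sinv Is.
have d2 : is_derive s 1 (boundary_momentum k t Ek Et mu T N B v)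
    (Ek s * dkappa x v s + Et s * dtau x v s - mu s * dot (Ds 1 v s) (T s)
     - dot (v s) (curve_EL s)).
  exact: (is_derive_boundary_momentum sk st sEk sEt smu k0 dT dN dB sv Is).
apply: (is_derive_eq (is_derive1D d1 d2)).
rewrite /f1 -(pair_bigA _ (fun (j : 'I_2) (m : 'I_n.+1) => Ds m (dinvariant x v j) s * dL L x j m s))/=.
have aux (S e f p q M G : R) : S - (e * p + f * q) + (e * p + f * q - M - G) = S - M - G.
  by ring.
exact: aux.
Qed.

(** [I] minus [[a, b]] is open and [v] vanishes on it, hence so do all derivatives of [v] and the
    first variations of kappa and tau, in which every term of [Phi] is linear. The endpoints are not
    in this open set. *)
Lemma boundary_outside s : I s -> ~~ (a <= s <= b) -> Phi s = 0.
Proof.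
move=> Is sab.
pose O := I `&` ~` `[a, b].
have openO : open O.
  apply: topology_structure.openI => //; apply: closed_openC.
  exact: (@interval_closed R (BLeft a) (BRight b)).
have Os : O s by split=> //=; rewrite in_itv/=; exact/negP.
have vO r : O r -> v r = 0.
  by case=> _ /= rab; apply: v0; apply/negP => h; apply: rab; rewrite in_itv.
have DvO j r : O r -> Ds j v r = 0.
  move=> Or; have svO : smooth_on O v by apply: smooth_onW sv => q [].
  apply/matrixP => i l; rewrite [l]ord1 mxE (Ds_coord openO j i svO Or).
  have vi q : O q -> v q i 0 = 0 by move=> Oq; rewrite vO// mxE.
  exact: (@Ds_eq0 R O openO (fun q => v q i 0) j r vi Or).
have invO j r : O r -> dinvariant x v j r = 0.
  move=> Or; rewrite /dinvariant; case: ifP => _.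
    by rewrite /dkappa !DvO// !dot0l mulr0 subr0.
  by rewrite /dtau !DvO// !dot0l !mulr0 addr0 !subr0.
rewrite /Phi /telescope_jet big1 ?add0r => [|j _]; last first.
  rewrite big1// => m _; rewrite /telescope_parts big1_seq// => i _.
  by rewrite (@Ds_eq0 R O openO (dinvariant x v j) _ s (invO j) Os) mulr0.
by rewrite /boundary_momentum !DvO// vO// !dot0l !mulr0 mul0r subr0 addr0 subr0.
Qed.

Lemma is_derive_action : is_derive (0 : R) 1
  (fun e : R => action L mu a b (fun s => x s + e *: v s))
  (\int[lebesgue_measure]_(s in `[a, b]) dot (v s) (curve_EL s)).
Proof.
have abI' : `[a, b] `<=` I by case: var_v.
have h := is_derive_integral ab abI' (expands_action 1).
apply: (is_derive_eq h).
have aab : a <= a <= b by rewrite lexx ltW.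
have bab : a <= b <= b by rewrite lexx ltW.
(* At an endpoint [Phi] vanishes as the limit of its zero values outside the segment. *)
have Pa : Phi a = 0.
  apply: (vanishing_left openI (abI aab)).
    exact: (smooth_on_continuous smooth_boundary (abI aab)).
  by move=> s Is sa; apply: boundary_outside => //; rewrite negb_and -!ltNge sa.
have Pb : Phi b = 0.
  apply: (vanishing_right openI (abI bab)).
    exact: (smooth_on_continuous smooth_boundary (abI bab)).
  by move=> s Is sa; apply: boundary_outside => //; rewrite negb_and -!ltNge sa orbT.
have cf1 s : a <= s <= b -> {for s, continuous f1}.
  by move=> /abI Is; exact: expandable_continuous1 (expands_expandable (expands_action 0) Is).
have cG s : a <= s <= b -> {for s, continuous (fun s => dot (v s) (curve_EL s))}.
  move=> /abI Is; apply: cvg_bigsum => i _; apply: cvgM.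
    exact: (smooth_on_continuous (@smooth_coord _ _ openI _ i sv) Is).
  exact: continuous_curve_EL.
have F2 := FTC2_point ab (fun s h => continuousB (cf1 s h) (cG s h))
  (fun s h => is_derive_boundary (abI h)).
have if1 := integrable_continuous cf1; have iG := integrable_continuous cG.
move: F2; rewrite Pa Pb subrr RintegralB// => /eqP.
by rewrite subr_eq0 => /eqP.
Qed.

End Variation.
End Variational.

Lemma frame_eq0 (R : realType) (T N B : 'cV[R]_3) (a b c : R) :
  dot T T = 1 -> dot T N = 0 -> dot N N = 1 -> B = cross T N ->
  a *: T + b *: N + c *: B = 0 -> [/\ a = 0, b = 0 & c = 0].
Proof.
move=> TT TN NN BE E.
have TB := frame_TB BE; have NB := frame_NB BE; have BB := frame_BB TT TN NN BE.
have d0 u : dot (a *: T + b *: N + c *: B) u = 0 by rewrite E dot0l.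
split.
- by have := d0 T; rewrite !dotDl !dotZl TT (dotC N) TN (dotC B) TB mulr1 !mulr0 !addr0.
- by have := d0 N; rewrite !dotDl !dotZl TN NN (dotC B) NB mulr1 !mulr0 add0r addr0.
- by have := d0 B; rewrite !dotDl !dotZl TB NB BB mulr1 !mulr0 !add0r.
Qed.

Lemma Xmx_mul (R : realType) (u w : 'cV[R]_3) : Xmx u *m w = cross u w.
Proof.
have E i : (Xmx u *m w) i 0 =
    Xmx u i (inord 0) * cx w + Xmx u i (inord 1) * cy w + Xmx u i (inord 2) * cz w.
  rewrite mxE !big_ord_recl big_ord0 addr0 addrA.
  congr (_ + _ + _); congr (_ * _); congr (_ _ _); apply/val_inj;
    by rewrite /= inordK.
apply: vec_eq; rewrite ![LHS]E !mxE !inordK//= !coordE /cx /cy /cz; ring.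
Qed.

Lemma Dmx_mul (R : realType) (a b c : R) : Dmx R *m vec3 a b c = vec3 a (- b) c.
Proof.
apply/matrixP => i j; rewrite mul_diag_mx !mxE.
by case: i => [[|[|[|//]]] ?] /=; rewrite ?mul1r ?mulN1r.
Qed.

(** * Euler-Lagrange system, elimination of the multiplier, Noether laws *)

Section Main.
Variables (R : realType) (n : nat) (U : set 'M[R]_(2, n.+1)).
Variables (L : 'M[R]_(2, n.+1) -> R) (I : set R) (x : R -> 'cV[R]_3).
Hypotheses (openU : open U) (smoothL : smooth_lagrangian U L).
Hypotheses (openI : open I) (itvI : is_interval I).
Hypotheses (curve_x : arclength_curve I x) (jetU : forall s, I s -> U (jet n x s)).

Let sEt : smooth_on I (Etau L x) :=
  @smooth_Euler R n U I x openU openI curve_x jetU L smoothL 1.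
Let sEk : smooth_on I (Ekappa L x) :=
  @smooth_Euler R n U I x openU openI curve_x jetU L smoothL 0.
Let st := smooth_tau openI curve_x.
Let sk := smooth_kappa openI curve_x.

Lemma smooth_2tauE : smooth_on I (fun s => 2 * tau x s * Etau L x s).
Proof.
have h := smooth_onM openI (smooth_onM openI (smooth_cst I 2) st) sEt.
exact: h.
Qed.

Lemma smooth_constraint_multiplier lam : smooth_on I lam ->
  smooth_on I (constraint_multiplier L x lam).
Proof. by move=> sl; exact: (smooth_onB openI sl smooth_2tauE). Qed.

Lemma extremal_withP mu : smooth_on I mu ->
  extremal_with L mu I x <-> forall s, I s -> curve_EL L x mu s = 0.
Proof.
move=> smu; split=> [ext|G0].
  apply: (fundamental_lemma openI) => [i s Is|a b v var].
    exact: (continuous_curve_EL openU smoothL openI curve_x jetU smu).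
  have [_ <-] := is_derive_action openU smoothL openI curve_x jetU smu var.
  by have [_] := ext a b v var.
move=> a b v var; have h := is_derive_action openU smoothL openI curve_x jetU smu var.
apply: (is_derive_eq h).
transitivity (\int[lebesgue_measure]_(s in `[a, b]) (0 : R))%R.
  apply: eq_Rintegral => s; rewrite inE => sab.
  have Is : I s by case: var => _ h0 _ _; exact: h0.
  by rewrite (G0 s Is) dotC dot0l.
by rewrite /Rintegral integral0.
Qed.

Lemma Ex_constraint lam s : smooth_on I lam -> I s ->
  Ex L lam x s = EL_T (kappa x) (tau x) (Ekappa L x) (Etau L x)
    (constraint_multiplier L x lam) s.
Proof.
move=> sl Is; have d1 := is_derive_smooth sl Is; have d2 := is_derive_smooth smooth_2tauE Is.
have E : Ds 1 (constraint_multiplier L x lam) s =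
    Ds 1 lam s - Ds 1 (fun r => 2 * tau x r * Etau L x r) s.
  exact: is_derive_derive1 (is_derive1B d1 d2).
have aux (p q r u w : R) : w = u - r -> p + q - r + u = p + q + w.
  by move=> ->; ring.
exact: (aux _ _ _ _ _ E).
Qed.

Lemma curve_EL_rho lam s : smooth_on I lam -> I s ->
  let mu := constraint_multiplier L x lam in
  rhoFS x s *m vec3 (Ex L lam x s) (Ey L mu x s) (Ez L x s) = curve_EL L x mu s.
Proof. by move=> sl Is /=; rewrite rhoFS_mul Ex_constraint. Qed.

Lemma curve_EL_eq0 lam s : smooth_on I lam -> I s ->
  let mu := constraint_multiplier L x lam in
  curve_EL L x mu s = 0 <->
  [/\ Ex L lam x s = 0, Ey L mu x s = 0 & Ez L x s = 0].
Proof.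
move=> sl Is /=; rewrite -curve_EL_rho// rhoFS_mul; split=> [|[-> -> ->]].
  apply: frame_eq0.
  - exact: (dotTT curve_x Is).
  - exact: (dot_tangent_normal openI curve_x Is).
  - exact: (dot_normal_normal openI curve_x Is).
  - exact: binormalE.
by rewrite !scale0r !addr0.
Qed.

(** [Ex] contains [lam] only through its derivative, and the other terms are minus the derivative of
    [lambda_sol]. The tangential equation thus says that [lam - lambda_sol] has zero derivative,
    hence is constant on the interval [I]. *)
Lemma Ex_derive_lambda lam s : smooth_on I lam -> I s ->
  Ex L lam x s = Ds 1 lam s - derive1 (lambda_sol L x) s.
Proof.
move=> sl Is.
have E := derive1_lambda_sol openU openI curve_x jetU smoothL Is.
have aux (p q r u w : R) : w = r - (p + q) -> p + q - r + u = u - w.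
  by move=> ->; ring.
exact: (aux _ _ _ _ _ E).
Qed.

Let sl0 : smooth_on I (lambda_sol L x) :=
  smooth_lambda_sol openU openI curve_x jetU smoothL.

Lemma Ex_eq0P lam : smooth_on I lam -> (forall s, I s -> Ex L lam x s = 0) <->
  exists c : R, forall s, I s -> lam s = lambda_sol L x s + c.
Proof.
move=> sl; split=> [E0|[c lamE] s Is]; last first.
  rewrite Ex_derive_lambda//; apply/eqP; rewrite subr_eq0; apply/eqP.
  transitivity (derive1 (fun r => lambda_sol L x r + c) s).
    by apply: near_derive1_eq; apply: filterS (near_open openI Is) => r; exact: lamE.
  have d := is_derive1D (is_derive_smooth sl0 Is) (is_derive_cst c s (1 : R)).
  by apply: (etrans (is_derive_derive1 d)); rewrite addr0.
have [|c cP] := @derive0_constant R I itvI (fun s => lam s - lambda_sol L x s).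
  move=> s Is; have d := is_derive1B (is_derive_smooth sl Is) (is_derive_smooth sl0 Is).
  by apply: (is_derive_eq d); rewrite -(E0 s Is) Ex_derive_lambda.
by exists c => s Is; rewrite -(cP s Is) addrC subrK.
Qed.

(** The shift between the two multipliers reverses the sign of the torsion term in the tangential
    entry: with [mu = lam - 2 tau Et], one has [- tau Et - mu = tau Et - lam]. *)
Lemma curve_momentumE lam s :
  rhoFS x s *m vec3 (tau x s * Etau L x s - kappa x s * Ekappa L x s - lam s)
     (- Ds 1 (Ekappa L x) s - tau x s / kappa x s * Ds 1 (Etau L x) s)
     (1 / kappa x s * Ds 2 (Etau L x) s
       - Ds 1 (kappa x) s / kappa x s ^+ 2 * Ds 1 (Etau L x) s
       + kappa x s * Etau L x s - tau x s * Ekappa L x s) =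
  curve_momentum L x (constraint_multiplier L x lam) s.
Proof.
rewrite rhoFS_mul; congr (_ *: _ + _ + _).
by rewrite /momentum_T /constraint_multiplier; ring.
Qed.

Lemma Noether_constant lam : smooth_on I lam ->
  extremal_with L (constraint_multiplier L x lam) I x ->
  exists c1 c2 : 'cV[R]_3, forall s, I s ->
    Noether_matrix x s *m upsilon L lam x s = col_mx c1 c2.
Proof.
move=> sl; have smu := smooth_constraint_multiplier sl.
move=> /(extremal_withP smu) G0; set mu := constraint_multiplier L x lam in smu G0 *.
have sx : smooth_on I x by case: curve_x.
have dW s : I s -> vec_is_derive (curve_momentum L x mu) s 0.
  move=> Is; apply: vec_is_derive_eq (vec_is_derive_curve_momentum openU smoothL openI curve_x jetU smu Is) _.
  by rewrite G0// oppr0.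
have [c1 c1P] := vec_is_derive0_constant itvI dW.
pose M := moment (kappa x) (tau x) (Ekappa L x) (Etau L x) mu x (tangent x) (principal_normal x) (binormal x).
have cTN s : I s -> cross (tangent x s) (principal_normal x s) = binormal x s.
  by move=> _; rewrite binormalE.
have cTB s : I s -> cross (tangent x s) (binormal x s) = - principal_normal x s.
  move=> Is; apply: (frame_cTB (dotTT curve_x Is)).
    exact: (dot_tangent_normal openI curve_x Is).
  exact: binormalE.
have dM s : I s -> vec_is_derive M s 0.
  move=> Is; apply: (vec_is_derive_moment sk sEk sEt (kappa_neq0 curve_x) _
    (vec_is_derive_tangent curve_x) (vec_is_derive_normal openI curve_x) (vec_is_derive_binormal openI curve_x)
    cTN cTB Is (dW s Is)).
  by move=> r Ir; exact: (vec_is_derive_Ds 0 sx Ir).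
have [m mP] := vec_is_derive0_constant itvI dM.
(* [Dmx R] factors out on the left of both blocks of the lower row. What remains is the moment: the
   inner [Dmx R] turns the fifth entry of [upsilon] into its opposite, the coefficient of the normal
   in [moment]. *)
exists c1, (Dmx R *m m) => s Is.
rewrite /Noether_matrix /upsilon /= mul_block_col mul0mx addr0.
rewrite curve_momentumE (c1P s Is); congr col_mx.
rewrite -mulmxA curve_momentumE.
rewrite -!mulmxA -mulmxDr -(mP s Is); congr (_ *m _).
rewrite Dmx_mul rhoFS_mul Xmx_mul /M /moment; congr (_ + (_ + _ *: _ + _)).
by rewrite mulNr opprK.
Qed.

End Main.

Theorem mainTheorem3 (R : realType) (n : nat)
    (U : set 'M[R]_(2, n.+1)) (L : 'M[R]_(2, n.+1) -> R)
    (I : set R) (x : R -> 'cV[R]_3)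
    (openU : open U) (smoothL : smooth_lagrangian U L)
    (openI : open I) (itvI : is_interval I)
    (curve_x : arclength_curve I x)
    (jetU : forall s, I s -> U (jet n x s)) :
  [/\ forall lam : R -> R, smooth_on I lam ->
        let mu := constraint_multiplier L x lam in
        Euler_Lagrange_expression L mu I x
          (fun s => rhoFS x s *m vec3 (Ex L lam x s) (Ey L mu x s) (Ez L x s))
        /\ (extremal_with L mu I x <->
            forall s, I s ->
              [/\ Ex L lam x s = 0, Ey L mu x s = 0 & Ez L x s = 0]),
      forall lam : R -> R, smooth_on I lam ->
        ((forall s, I s -> Ex L lam x s = 0) <->
         exists c : R, forall s, I s -> lam s = lambda_sol L x s + c),
      extremal_curve L I x <->
        (exists c : R,
           let mu := constraint_multiplier L x (fun s => lambda_sol L x s + c) in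
           forall s, I s -> Ey L mu x s = 0 /\ Ez L x s = 0)
    & forall lam : R -> R, smooth_on I lam ->
        extremal_with L (constraint_multiplier L x lam) I x ->
        exists c : R,
          (forall s, I s -> lam s = lambda_sol L x s + c) /\
          exists c1 c2 : 'cV[R]_3, forall s, I s ->
            Noether_matrix x s *m upsilon L lam x s = col_mx c1 c2].
Proof.
have EL lam : smooth_on I lam -> let mu := constraint_multiplier L x lam in
    extremal_with L mu I x <-> forall s, I s ->
      [/\ Ex L lam x s = 0, Ey L mu x s = 0 & Ez L x s = 0].
  move=> sl mu; have smu : smooth_on I mu.
    exact: (smooth_constraint_multiplier openU smoothL openI curve_x jetU sl).
  have h := extremal_withP openU smoothL openI curve_x jetU smu.
  apply: (iff_trans h); split=> H s Is.
    exact: (curve_EL_eq0 openU smoothL openI curve_x jetU sl Is).1 (H s Is).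
  exact: (curve_EL_eq0 openU smoothL openI curve_x jetU sl Is).2 (H s Is).
have ExP := Ex_eq0P openU smoothL openI itvI curve_x jetU.
have slc c : smooth_on I (fun s => lambda_sol L x s + c).
  have h := smooth_onD openI (smooth_lambda_sol openU openI curve_x jetU smoothL)
    (smooth_cst I c).
  exact: h.
split.
- move=> lam sl mu; split; last exact: EL.
  have smu : smooth_on I mu.
    exact: (smooth_constraint_multiplier openU smoothL openI curve_x jetU sl).
  move=> a b v var; have h := is_derive_action openU smoothL openI curve_x jetU smu var.
  apply: (is_derive_eq h); apply: eq_Rintegral => s; rewrite inE => sab.
  have Is : I s by case: var => _ h0 _ _; exact: h0.
  by rewrite (curve_EL_rho openU smoothL openI curve_x jetU sl Is).
- exact: ExP.
- split=> [[mu smu ext]|[c ELc]].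
  (* The given multiplier is the one of [eta - 1]; [lam] inverts [constraint_multiplier], so that
     the tangential equation then identifies it with [lambda_sol] up to a constant. *)
  + pose lam s := mu s + 2 * tau x s * Etau L x s.
    have muE : constraint_multiplier L x lam = mu.
      by apply/funext => s; rewrite /constraint_multiplier /lam addrK.
    have sl : smooth_on I lam.
      have h := smooth_onD openI smu (smooth_2tauE openU smoothL openI curve_x jetU).
      exact: h.
    have /(EL _ sl) H : extremal_with L (constraint_multiplier L x lam) I x by rewrite muE.
    have [c cP] := (ExP _ sl).1 (fun s Is => let: And3 h _ _ := H s Is in h).
    exists c => mu' s Is; have [_ hy hz] := H s Is; split=> //.
    by rewrite -[RHS]hy /Ey /mu' /constraint_multiplier cP.
  + exists (constraint_multiplier L x (fun s => lambda_sol L x s + c)).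
      exact: (smooth_constraint_multiplier openU smoothL openI curve_x jetU (slc c)).
    apply/(EL _ (slc c)) => s Is; have [hy hz] := ELc s Is; split=> //.
    by apply: (ExP _ (slc c)).2 => //; exists c.
- move=> lam sl ext.
  have [c cP] := (ExP _ sl).1 (fun s Is => let: And3 h _ _ := (EL _ sl).1 ext s Is in h).
  exists c; split=> //.
  exact: (Noether_constant openU smoothL openI itvI curve_x jetU sl ext).
Qed.
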